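(* The decision version of SMC-1 (given an instance of SMC-1 and an integer $b$, decide whether there is a feasible matching with at most $b$ blocking pairs) is $\mathsf{W}[1]$-hard when parameterized by $b+|\mathcal W^\star|$. This holds even when restricted to instances in which there is a master list over men as well as a master list over women, every preference list has length at most $3$, and $|L(w)|=1$ for every woman $w\in\mathcal W^\star$.
   Context: An instance of Stable Marriage with Covering Constraints (SMC) consists of a finite set $\mathcal M$ of men, a finite set $\mathcal W$ of women, for each person $x$ a preference list $L(x)$ strictly ordering a subset of the opposite sex (the persons acceptable to $x$), and subsets $\mathcal W^\star\subseteq\mathcal W$, $\mathcal M^\star\subseteq\mathcal M$ of distinguished persons. A matching is a set of disjoint man–woman pairs $\{m,w\}$ with $m$ and $w$ in each other's lists; $M(x)$ denotes the partner of $x$. A pair $\{m,w\}$ of mutually acceptable persons is blocking for $M$ if $m$ is unmatched or prefers $w$ to $M(m)$, and $w$ is unmatched or prefers $m$ to $M(w)$. A matching is feasible if it matches every person in $\mathcal W^\star\cup\mathcal M^\star$. The goal of SMC is to find a feasible matching with the minimum number of blocking pairs. SMC-1 is the special case $\mathcal M^\star=\emptyset$. A master list over women is a total order $L_{\mathcal W}$ of all women such that every man's preference list is the restriction of $L_{\mathcal W}$ to the women he finds acceptable; a master list over men is defined symmetrically. *)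

(* Defs.v *)
From mathcomp Require Import all_boot.
Set Implicit Arguments.
Unset Strict Implicit.
Unset Printing Implicit Defensive.

(** * Model of computation

    Algorithms are programs of the WHILE language of N. D. Jones
    ("Computability and Complexity from a Programming Perspective"), which
    manipulates binary trees.  Assigning a value costs its size, so that no
    program can build a tree larger than its running time plus its input
    allows (a unit-cost [X := cons X X] could double the data at each step).
    With this cost WHILE programs and multi-tape Turing machines simulate each
    other with polynomial overhead. *)

Inductive tree : Type := Leaf | Node of tree & tree.

Fixpoint tsize (t : tree) : nat :=
  if t is Node l r then (tsize l + tsize r).+1 else 1.

Inductive expr : Type :=
  | EVar of nat
  | ENil
  | ECons of expr & expr
  | EHd of expr
  | ETl of expr.

Definition store := nat -> tree.

Fixpoint eval (e : expr) (s : store) : tree :=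
  match e with
  | EVar x => s x
  | ENil => Leaf
  | ECons e1 e2 => Node (eval e1 s) (eval e2 s)
  | EHd e1 => if eval e1 s is Node l _ then l else Leaf
  | ETl e1 => if eval e1 s is Node _ r then r else Leaf
  end.

Definition update (s : store) (x : nat) (v : tree) : store :=
  fun y => if y == x then v else s y.

Inductive cmd : Type :=
  | Skip
  | Assign of nat & expr
  | Seq of cmd & cmd
  | If of expr & cmd & cmd
  | While of expr & cmd.

(** [exec c s t s']: started in store [s], the command [c] halts in store [s']
    after time [t]; [Leaf] counts as false in tests. *)
Inductive exec : cmd -> store -> nat -> store -> Prop :=
  | ExecSkip s : exec Skip s 1 s
  | ExecAssign s x e :
      exec (Assign x e) s (tsize (eval e s)).+1 (update s x (eval e s))
  | ExecSeq c1 c2 s s1 s2 t1 t2 :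
      exec c1 s t1 s1 -> exec c2 s1 t2 s2 -> exec (Seq c1 c2) s (t1 + t2) s2
  | ExecIfTrue e c1 c2 s s1 t :
      eval e s <> Leaf -> exec c1 s t s1 -> exec (If e c1 c2) s t.+1 s1
  | ExecIfFalse e c1 c2 s s1 t :
      eval e s = Leaf -> exec c2 s t s1 -> exec (If e c1 c2) s t.+1 s1
  | ExecWhileDone e c s :
      eval e s = Leaf -> exec (While e c) s 1 s
  | ExecWhileStep e c s s1 s2 t1 t2 :
      eval e s <> Leaf -> exec c s t1 s1 -> exec (While e c) s1 t2 s2 ->
      exec (While e c) s (t1 + t2).+1 s2.

(** Variable 0 holds the input at the start and the output at the end. *)
Definition init (x : tree) : store := update (fun=> Leaf) 0 x.

Definition runs (c : cmd) (x : tree) (t : nat) (y : tree) : Prop :=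
  exists2 s, exec c (init x) t s & s 0 = y.

(** Natural numbers are encoded in unary. *)
Fixpoint enc_nat (n : nat) : tree :=
  if n is n'.+1 then Node Leaf (enc_nat n') else Leaf.

Definition enc_seq (T : Type) (enc : T -> tree) (s : seq T) : tree :=
  foldr (fun x t => Node (enc x) t) Leaf s.

Definition computable (f : nat -> nat) : Prop :=
  exists c, forall n, exists t, runs c (enc_nat n) t (enc_nat (f n)).

(** * Parameterized problems and fpt-reductions *)

(** A set of pairs (instance, parameter).  Trees that do not encode an instance
    of the problem are no-instances. *)
Definition pproblem := tree -> nat -> Prop.

(** [fpt_reduces_into C A B]: there is an fpt-reduction from [A] to [B] all of
    whose outputs lie in the class [C]. *)
Definition fpt_reduces_into (C A B : pproblem) : Prop :=
  exists (c : cmd) (f g : nat -> nat) (e : nat),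
    [/\ computable f, computable g &
      forall (x : tree) (k : nat), exists (t : nat) (x' : tree) (k' : nat),
        [/\ runs c (Node x (enc_nat k)) t (Node x' (enc_nat k')),
            t <= f k * tsize x ^ e,
            k' <= g k,
            A x k <-> B x' k' &
            C x' k']].

Definition fpt_reduces (A B : pproblem) : Prop :=
  fpt_reduces_into (fun _ _ => True) A B.

(** * Boolean circuits and the class W[1] *)

Inductive gate : Type :=
  | GNot of nat
  | GAnd of seq nat
  | GOr of seq nat.

Definition gate_args (g : gate) : seq nat :=
  match g with GNot i => [:: i] | GAnd s => s | GOr s => s end.

(** Nodes [0 .. cinputs - 1] are the input nodes and node [cinputs + j] is the
    [j]-th gate; gates are listed in topological order. *)
Record circuit : Type := Circuit {
  cinputs : nat;
  cgates : seq gate;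
  coutput : nat
}.

Definition gate_wf (g : gate) : bool :=
  match g with GNot _ => true | GAnd s | GOr s => uniq s && (2 <= size s) end.

Definition circuit_wf (c : circuit) : Prop :=
  coutput c < cinputs c + size (cgates c) /\
  forall j, j < size (cgates c) ->
    let g := nth (GNot 0) (cgates c) j in
    gate_wf g && all (fun i => i < cinputs c + j) (gate_args g).

(** The values of all nodes, given those of the input nodes and the value [f]
    assigns to a gate from the values of the preceding nodes. *)
Definition node_values (A : Type) (inp : seq A) (f : seq A -> gate -> A)
    (gs : seq gate) : seq A :=
  foldl (fun vs g => rcons vs (f vs g)) inp gs.

Definition gate_eval (vs : seq bool) (g : gate) : bool :=
  match g with
  | GNot i => ~~ nth false vs i
  | GAnd s => all (nth false vs) s
  | GOr s => has (nth false vs) s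
  end.

Definition circuit_eval (c : circuit) (a : seq bool) : bool :=
  nth false (node_values a gate_eval (cgates c)) (coutput c).

(** Largest number of edges on a path from an input node to the output. *)
Definition depth (c : circuit) : nat :=
  nth 0 (node_values (nseq (cinputs c) 0)
           (fun ds g => (\max_(i <- gate_args g) nth 0 ds i).+1) (cgates c))
    (coutput c).

(** A gate is large when its fan-in exceeds 2; the weft is the largest number
    of large gates on a path from an input node to the output. *)
Definition large (g : gate) : bool := 2 < size (gate_args g).

Definition weft (c : circuit) : nat :=
  nth 0 (node_values (nseq (cinputs c) 0)
           (fun ws g => large g + \max_(i <- gate_args g) nth 0 ws i)
           (cgates c))
    (coutput c).

Definition enc_gate (g : gate) : tree :=
  match g with
  | GNot i => Node (enc_nat 0) (enc_nat i)
  | GAnd s => Node (enc_nat 1) (enc_seq enc_nat s)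
  | GOr s => Node (enc_nat 2) (enc_seq enc_nat s)
  end.

Definition enc_circuit (c : circuit) : tree :=
  Node (enc_nat (cinputs c))
    (Node (enc_seq enc_gate (cgates c)) (enc_nat (coutput c))).

(** Weighted circuit satisfiability for circuits of weft at most [t] and depth
    at most [d]: is there a satisfying assignment with exactly [k] ones? *)
Definition WCS (t d : nat) : pproblem := fun x k =>
  exists c : circuit,
    [/\ x = enc_circuit c, circuit_wf c, weft c <= t, depth c <= d &
      exists a : seq bool,
        [/\ size a = cinputs c, count_mem true a = k & circuit_eval c a]].

(** The class W[t]. *)
Definition Wclass (t : nat) (A : pproblem) : Prop :=
  exists d : nat, fpt_reduces A (WCS t d).

Definition W1_hard (B : pproblem) : Prop :=
  forall A : pproblem, Wclass 1 A -> fpt_reduces A B.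

(** [B] is W[1]-hard even when restricted to the instances in [C]: every
    problem of W[1] reduces to [B] by a reduction producing only instances
    in [C]. *)
Definition W1_hard_on (C B : pproblem) : Prop :=
  forall A : pproblem, Wclass 1 A -> fpt_reduces_into C A B.

(** * Stable marriage with covering constraints *)

(** Preference lists are in decreasing order of preference.  Acceptability need
    not be symmetric: a pair is mutually acceptable when each is in the list
    of the other. *)
Record smc (M W : finType) : Type := SMC {
  prefM : M -> seq W;
  prefW : W -> seq M;
  starM : {set M};
  starW : {set W};
  prefM_uniq : forall m, uniq (prefM m);
  prefW_uniq : forall w, uniq (prefW w)
}.

Section Matchings.
Variables (M W : finType) (I : smc M W).

Definition acceptable (m : M) (w : W) : bool :=
  (w \in prefM I m) && (m \in prefW I w).

Definition matching (mu : {set M * W}) : Prop :=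
  (forall p, p \in mu -> acceptable p.1 p.2) /\
  (forall p q, p \in mu -> q \in mu -> p.1 = q.1 \/ p.2 = q.2 -> p = q).

(** The partner of a person, [None] if the person is unmatched. *)
Definition partnerM (mu : {set M * W}) (m : M) : option W :=
  [pick w | (m, w) \in mu].

Definition partnerW (mu : {set M * W}) (w : W) : option M :=
  [pick m | (m, w) \in mu].

Definition prefersM (m : M) (w w' : W) : bool :=
  index w (prefM I m) < index w' (prefM I m).

Definition prefersW (w : W) (m m' : M) : bool :=
  index m (prefW I w) < index m' (prefW I w).

Definition blocking (mu : {set M * W}) (m : M) (w : W) : bool :=
  [&& acceptable m w,
      (if partnerM mu m is Some w' then prefersM m w w' else true) &
      (if partnerW mu w is Some m' then prefersW w m m' else true)].

Definition blocking_pairs (mu : {set M * W}) : {set M * W} :=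
  [set p | blocking mu p.1 p.2].

Definition feasible (mu : {set M * W}) : Prop :=
  [/\ matching mu,
      (forall m, m \in starM I -> partnerM mu m != None) &
      (forall w, w \in starW I -> partnerW mu w != None)].

Definition master_list_women (s : seq W) : Prop :=
  [/\ uniq s, (forall w, w \in s) &
      forall m, prefM I m = [seq w <- s | w \in prefM I m]].

Definition master_list_men (s : seq M) : Prop :=
  [/\ uniq s, (forall m, m \in s) &
      forall w, prefW I w = [seq m <- s | m \in prefW I w]].

Definition restricted : Prop :=
  [/\ exists s, master_list_men s,
      exists s, master_list_women s,
      forall m, size (prefM I m) <= 3,
      forall w, size (prefW I w) <= 3 &
      forall w, w \in starW I -> size (prefW I w) = 1].

End Matchings.

(** The instance together with the bound [b] on the number of blocking pairs. *)
Definition enc_smc (m n : nat) (I : smc 'I_m 'I_n) (b : nat) : tree :=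
  let enc_ord := fun (p : nat) (i : 'I_p) => enc_nat i in
  Node (enc_seq (fun x : 'I_m => enc_seq (enc_ord n) (prefM I x)) (enum 'I_m))
 (Node (enc_seq (fun y : 'I_n => enc_seq (enc_ord m) (prefW I y)) (enum 'I_n))
 (Node (enc_seq (enc_ord m) (enum (starM I)))
 (Node (enc_seq (enc_ord n) (enum (starW I)))
       (enc_nat b)))).

(** The decision version of SMC-1, parameterized by [b + |W*|]. *)
Definition SMC1 : pproblem := fun x k =>
  exists (m n : nat) (I : smc 'I_m 'I_n) (b : nat),
    [/\ x = enc_smc I b, k = b + #|starW I|, starM I = set0 &
      exists2 mu : {set 'I_m * 'I_n},
        feasible I mu & #|blocking_pairs I mu| <= b].

Definition SMC1_restricted : pproblem := fun x k =>
  exists (m n : nat) (I : smc 'I_m 'I_n) (b : nat),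
    [/\ x = enc_smc I b, k = b + #|starW I|, starM I = set0 & restricted I].

(* Main.v *)
(** Reduction from weighted satisfiability of circuits of weft 1 and depth [d].

    An assignment with [k] ones is described by the [k + 1] gaps between
    consecutive ones, so that a single gap witnesses the value of an input node:
    a one is the left end of a gap, a zero lies inside a gap.  On a path to the
    output there is at most one large gate, hence at most [2 ^ d] pairs (large
    gate, decisive argument) justify the value of the output; they are guessed as
    a list [beta].  Given [beta] and a few gaps, a three-valued evaluation that
    looks only at the guessed arguments of the large gates tells what the gaps
    do not refute.  A satisfying assignment is never refuted, whereas a
    non-satisfying one is refuted by the gaps around a number of input nodes
    bounded in terms of [d].  So the circuit is satisfiable iff [beta] and the
    [k + 1] gaps can be chosen so that every [q]-tuple of gaps passes a test, [q]
    depending on [d] only.  This becomes a choice of one option in each of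
    [(k + 1) ^ q + k + 5] blocks, subject to implications "option [y] forces
    option [x]" from the options of tuples to those of single variables.

    In the SMC-1 instance the columns are the options and a block is an interval
    of columns.  The starred woman of a block takes away the first man of a path
    through its columns; at the cost of one blocking pair this shortage leaves
    the path at a column, the selected option, where it descends as a token, one
    level per implication.  If the implication at a level is violated, its target
    column gets a token too.  At the bottom, an extra blocking pair is
    unavoidable in a block that receives two tokens. *)

Require Import Defs.
From mathcomp Require Import all_boot.
From mathcomp Require Import zify.
(* Again, because MathComp's tuple.v also defines [tsize]. *)
Import Defs.
Set Implicit Arguments.
Unset Strict Implicit.
Unset Printing Implicit Defensive.

(** The budget is tight. In every block the first man, tied to his starred woman, blocks with the
    first woman of the path, and the selected column gives a second pair; only the last block, a
    single column with no man to its right, is spared the latter. So [nb] blocks force [2 * nb - 1]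
    blocking pairs, all with men of level 0. Within the budget nothing below level 0 may block, and
    the course of the tokens is forced. With the [nb + 1] starred women the parameter is [3 * nb].
    Lists of length 3 leave room for one entry beside the two of the vertical path, whence one level
    per implication. The master lists order persons by level and column, so implications must lead
    to the right. Source and target blocks are disjoint: a token in a target column stays there, and
    a diverted token is not diverted again. A large gate may need all its arguments to refute a
    value, which no bounded number of gaps provides; fixing its decisive arguments in [beta] removes
    this obstacle. Malformed inputs must also yield restricted instances; they are passed on with
    every test failing. *)

(** * Polynomial bounds *)

Definition poly_bounded (b : nat -> nat) : Prop :=
  exists C e, forall n, 0 < n -> b n <= C * n ^ e.

Lemma poly_bounded_const c : poly_bounded (fun=> c).
Proof. by exists c, 0 => n _; rewrite expn0 muln1. Qed.

Lemma poly_bounded_id : poly_bounded id.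
Proof. by exists 1, 1 => n _; rewrite mul1n expn1. Qed.

Lemma poly_bounded_add b1 b2 :
  poly_bounded b1 -> poly_bounded b2 -> poly_bounded (fun n => b1 n + b2 n).
Proof.
move=> [C1 [e1 h1]] [C2 [e2 h2]]; exists (C1 + C2), (maxn e1 e2) => n n0.
rewrite mulnDl leq_add //; [apply: leq_trans (h1 n n0) _|apply: leq_trans (h2 n n0) _];
  by rewrite leq_mul2l leq_pexp2l ?orbT // ?leq_maxl ?leq_maxr.
Qed.

Lemma poly_bounded_mul b1 b2 :
  poly_bounded b1 -> poly_bounded b2 -> poly_bounded (fun n => b1 n * b2 n).
Proof.
move=> [C1 [e1 h1]] [C2 [e2 h2]]; exists (C1 * C2), (e1 + e2) => n n0.
by rewrite expnD mulnACA leq_mul ?h1 ?h2.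
Qed.

Lemma poly_bounded_S b : poly_bounded b -> poly_bounded (fun n => (b n).+1).
Proof.
move=> hb; have [C [e h]] := poly_bounded_add (poly_bounded_const 1) hb.
by exists C, e => n /h.
Qed.

Lemma poly_bounded_exp b e : poly_bounded b -> poly_bounded (fun n => b n ^ e).
Proof.
move=> hb; elim: e => [|e ih].
  by exists 1, 0 => n _; rewrite !expn0.
have [C [e' h]] := poly_bounded_mul hb ih.
by exists C, e' => n n0; rewrite expnS h.
Qed.

Lemma leq_expn m n e : m <= n -> m ^ e <= n ^ e.
Proof. by move=> mn; elim: e => // e ih; rewrite !expnS leq_mul. Qed.

Create HintDb pb.
#[export] Hint Resolve poly_bounded_const poly_bounded_id poly_bounded_add
  poly_bounded_mul poly_bounded_S poly_bounded_exp : pb.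

Lemma tsize_gt0 t : 0 < tsize t.
Proof. by case: t. Qed.

(** * Relocation of programs within the store *)

Fixpoint expr_shift (d : nat) (e : expr) : expr :=
  match e with
  | EVar x => EVar (d + x)
  | ENil => ENil
  | ECons e1 e2 => ECons (expr_shift d e1) (expr_shift d e2)
  | EHd e1 => EHd (expr_shift d e1)
  | ETl e1 => ETl (expr_shift d e1)
  end.

Fixpoint cmd_shift (d : nat) (c : cmd) : cmd :=
  match c with
  | Skip => Skip
  | Assign x e => Assign (d + x) (expr_shift d e)
  | Seq c1 c2 => Seq (cmd_shift d c1) (cmd_shift d c2)
  | If e c1 c2 => If (expr_shift d e) (cmd_shift d c1) (cmd_shift d c2)
  | While e c1 => While (expr_shift d e) (cmd_shift d c1)
  end.

Lemma eval_shift d e s s1 :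
  (forall y, s (d + y) = s1 y) -> eval (expr_shift d e) s = eval e s1.
Proof. by move=> h; elim: e => //= [e1 -> e2 ->|e1 ->|e1 ->]. Qed.

(** The registers below [d] are safe storage while the shifted program runs; this is how programs
    are composed without interference. *)
Lemma exec_shift d c s1 t s1' : exec c s1 t s1' ->
  forall s, (forall y, s (d + y) = s1 y) -> exists s',
    [/\ exec (cmd_shift d c) s t s', (forall y, s' (d + y) = s1' y) &
        forall y, y < d -> s' y = s y].
Proof.
elim=> {c s1 t s1'} [s1|s1 x e|c1 c2 s1 s2 s3 t1 t2 _ ih1 _ ih2|
    e c1 c2 s1 s2 t he _ ih|e c1 c2 s1 s2 t he _ ih|e c s1 he|
    e c s1 s2 s3 t1 t2 he _ ih1 _ ih2] s hs /=.
- by exists s; split=> //; constructor.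
- exists (update s (d + x) (eval (expr_shift d e) s)); split.
  + by rewrite -(eval_shift e hs); constructor.
  + by move=> y; rewrite /update eqn_add2l hs (eval_shift e hs).
  + by move=> y yd; rewrite /update ltn_eqF // ltn_addr.
- have [s' [h1 h2 h3]] := ih1 s hs; have [s'' [h4 h5 h6]] := ih2 s' h2.
  exists s''; split=> //; first exact: ExecSeq h1 h4.
  by move=> y yd; rewrite h6 ?h3.
- have [s' [h1 h2 h3]] := ih s hs; exists s'; split=> //.
  by apply: ExecIfTrue h1; rewrite (eval_shift e hs).
- have [s' [h1 h2 h3]] := ih s hs; exists s'; split=> //.
  by apply: ExecIfFalse h1; rewrite (eval_shift e hs).
- by exists s; split=> //; apply: ExecWhileDone; rewrite (eval_shift e hs).
- have [s' [h1 h2 h3]] := ih1 s hs; have [s'' [h4 h5 h6]] := ih2 s' h2.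
  exists s''; split=> //.
    by apply: ExecWhileStep h1 h4; rewrite (eval_shift e hs).
  by move=> y yd; rewrite h6 ?h3.
Qed.

(** Every assigned value has been paid for. *)
Lemma exec_size c s t s' : exec c s t s' ->
  forall y, s' y = s y \/ tsize (s' y) < t.
Proof.
elim=> {c s t s'} [s|s x e|c1 c2 s1 s2 s3 t1 t2 _ ih1 _ ih2|
    e c1 c2 s1 s2 t he _ ih|e c1 c2 s1 s2 t he _ ih|e c s1 he|
    e c s1 s2 s3 t1 t2 he _ ih1 _ ih2] y; try by left.
- by rewrite /update; case: eqP => _; [right | left].
- case: (ih2 y) => [->|]; last by right; lia.
  by case: (ih1 y) => [->|]; [left | right; lia].
- by case: (ih y) => [->|]; [left | right; lia].
- by case: (ih y) => [->|]; [left | right; lia].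
- case: (ih2 y) => [->|]; last by right; lia.
  by case: (ih1 y) => [->|]; [left | right; lia].
Qed.

(** * Polynomial-time functions *)

Class Enc (A : Type) := enc : A -> tree.

Instance Enc_tree : Enc tree := id.
Instance Enc_unit : Enc unit := fun=> Leaf.
(** [true] must not be a leaf, so that an encoded boolean can serve directly as the test of [If]. *)
Instance Enc_bool : Enc bool := fun b => if b then Node Leaf Leaf else Leaf.
Instance Enc_nat : Enc nat := enc_nat.
Instance Enc_pair A B (EA : Enc A) (EB : Enc B) : Enc (A * B) :=
  fun p => Node (enc p.1) (enc p.2).
Instance Enc_seq A (EA : Enc A) : Enc (seq A) := enc_seq enc.
Instance Enc_gate : Enc gate := enc_gate.
Instance Enc_circuit : Enc circuit := enc_circuit.

Notation esize a := (tsize (enc a)).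

Section Sizes.
Context {A B : Type} {EA : Enc A} {EB : Enc B}.

Lemma esize_pair (p : A * B) : esize p = (esize p.1 + esize p.2).+1.
Proof. by []. Qed.

Lemma esize_nil : esize ([::] : seq A) = 1.
Proof. by []. Qed.

Lemma esize_cons (x : A) l : esize (x :: l) = (esize x + esize l).+1.
Proof. by []. Qed.

Lemma esize_cat (l1 l2 : seq A) : (esize (l1 ++ l2)).+1 = esize l1 + esize l2.
Proof. by elim: l1 => [|x l ih] //; rewrite cat_cons !esize_cons; lia. Qed.

Lemma size_le_esize (l : seq A) : size l < esize l.
Proof. by elim: l => // x l ih; rewrite esize_cons /=; lia. Qed.

End Sizes.

(* Only register 0 is specified: the others may hold garbage at the start, so
   that programs can be run one after the other. *)
Definition poly A B {EA : Enc A} {EB : Enc B} (f : A -> B) : Prop :=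
  exists c b, poly_bounded b /\ forall a s, s 0 = enc a -> exists t s',
    [/\ exec c s t s', s' 0 = enc (f a) & t <= b (esize a)].

Section Primitives.
Context {A B S : Type} {EA : Enc A} {EB : Enc B} {ES : Enc S}.
Implicit Types (a : A).

(** The form in which [poly] is used: one monomial bounds both time and output size, at any offset
    in the store. By [exec_size] the output either has been paid for or is the untouched input,
    whence the bound [n + b n]. *)
Lemma poly_shift (f : A -> B) : poly f -> exists c C e,
  (forall a, esize (f a) <= C * esize a ^ e) /\ forall d a s,
  s d = enc a -> exists t s', [/\ exec (cmd_shift d c) s t s',
    s' d = enc (f a), t <= C * esize a ^ e & forall y, y < d -> s' y = s y].
Proof.
move=> [c [b [hb hc]]].
have [C [e h]] : poly_bounded (fun n => n + b n) by auto with pb.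
exists c, C, e; split=> [a|d a s sd].
  apply: leq_trans (h _ (tsize_gt0 _)).
  have [t [s' [h1 h2 h3]]] := hc a (fun=> enc a) erefl.
  have /= := exec_size h1 0; rewrite h2 => -[->|hh]; first exact: leq_addr.
  exact: leq_trans (ltnW hh) (leq_trans h3 (leq_addl _ _)).
have [|t [s' [h1 h2 h3]]] := hc a (fun y => s (d + y)); first by rewrite addn0.
have [s'' [h4 h5 h6]] := exec_shift h1 (fun y => erefl (s (d + y))).
exists t, s''; split=> //; first by rewrite -{1}[d]addn0 h5.
exact: leq_trans h3 (leq_trans (leq_addl _ _) (h _ (tsize_gt0 _))).
Qed.

Lemma poly_size (f : A -> B) : poly f ->
  exists C e, forall a, esize (f a) <= C * esize a ^ e.
Proof. by move=> /poly_shift [c [C [e [h _]]]]; exists C, e. Qed.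

Lemma poly_ext (f g : A -> B) : f =1 g -> poly f -> poly g.
Proof.
move=> fg [c [b [hb hc]]]; exists c, b; split=> // a s /hc [t [s' []]].
by exists t, s'; rewrite -fg.
Qed.

Lemma poly_expr (f : A -> B) (e : expr) b :
  (forall a s, s 0 = enc a -> eval e s = enc (f a)) ->
  poly_bounded b -> (forall a, esize (f a) <= b (esize a)) -> poly f.
Proof.
move=> h hb hs; exists (Assign 0 e), (fun n => (b n).+1); split; first by auto with pb.
move=> a s sa; exists (tsize (eval e s)).+1, (update s 0 (eval e s)).
by split; [exact: ExecAssign|rewrite /update eqxx (h a)|rewrite (h a) ?ltnS].
Qed.

Lemma poly_const (x : B) : poly (fun _ : A => x).
Proof.
pose fix lit t := if t is Node l r then ECons (lit l) (lit r) else ENil.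
have hl t s : eval (lit t) s = t by elim: t => //= l -> r ->.
by apply: (@poly_expr _ (lit (enc x)) (fun=> esize x)) => //; auto with pb.
Qed.

End Primitives.

Section Combinators.
Context {A B S : Type} {EA : Enc A} {EB : Enc B} {ES : Enc S}.
Implicit Types (a : A).

Lemma poly_comp (g : B -> S) (f : A -> B) :
  poly g -> poly f -> poly (fun a => g (f a)).
Proof.
move=> /poly_shift [c2 [C2 [e2 [_ h2]]]] /poly_shift [c1 [C1 [e1 [s1 h1]]]].
exists (Seq (cmd_shift 0 c1) (cmd_shift 0 c2)),
  (fun n => C1 * n ^ e1 + C2 * (C1 * n ^ e1) ^ e2); split; first by auto 10 with pb.
move=> a s /h1 [t1 [s2 [x1 v1 l1 _]]].
have [t2 [s3 [x2 v2 l2 _]]] := h2 0 (f a) s2 v1.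
exists (t1 + t2), s3; split=> //; first exact: ExecSeq x1 x2.
rewrite leq_add //; apply: leq_trans l2 _.
by rewrite leq_mul2l leq_expn ?s1 ?orbT.
Qed.

(** The input stays in register 0, and each component is computed at an offset above the results
    obtained so far. *)
Lemma poly_pair (f : A -> B) (g : A -> S) :
  poly f -> poly g -> poly (fun a => (f a, g a)).
Proof.
move=> /poly_shift [c1 [C1 [e1 [s1 h1]]]] /poly_shift [c2 [C2 [e2 [s2 h2]]]].
exists (Seq (Assign 1 (EVar 0)) (Seq (cmd_shift 1 c1)
  (Seq (Assign 2 (EVar 0)) (Seq (cmd_shift 2 c2)
    (Assign 0 (ECons (EVar 1) (EVar 2))))))),
  (fun n => n.+1 + C1 * n ^ e1 + n.+1 + C2 * n ^ e2 +
    (C1 * n ^ e1 + C2 * n ^ e2).+2); split; first by auto 20 with pb.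
move=> a s sa.
have [|ta [sA [xa va la ka]]] := h1 1 a (update s 1 (s 0)); first by rewrite /update eqxx.
have a0 : sA 0 = enc a by rewrite ka.
have [|tb [sB [xb vb lb kb]]] := h2 2 a (update sA 2 (sA 0)); first by rewrite /update eqxx.
have b1 : sB 1 = enc (f a) by rewrite kb.
exists ((tsize (s 0)).+1 + (ta + ((tsize (sA 0)).+1 + (tb + (tsize (Node (sB 1) (sB 2))).+1)))).
exists (update sB 0 (Node (sB 1) (sB 2))); split.
- do 4!(apply: ExecSeq; [exact: ExecAssign || eassumption|]).
  exact: (ExecAssign sB 0 (ECons (EVar 1) (EVar 2))).
- by rewrite /update eqxx b1 vb.
- by rewrite sa a0 b1 vb /=; have := s1 a; have := s2 a; lia.
Qed.

Lemma poly_if (p : A -> bool) (f g : A -> B) :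
  poly p -> poly f -> poly g -> poly (fun a => if p a then f a else g a).
Proof.
move=> /poly_shift [c1 [C1 [e1 [s1 h1]]]] /poly_shift [c2 [C2 [e2 [_ h2]]]]
  /poly_shift [c3 [C3 [e3 [_ h3]]]].
exists (Seq (Assign 1 (EVar 0)) (Seq (cmd_shift 1 c1)
  (If (EVar 1) (cmd_shift 0 c2) (cmd_shift 0 c3)))),
  (fun n => n.+1 + C1 * n ^ e1 + (C2 * n ^ e2 + C3 * n ^ e3).+1); split; first by auto 20 with pb.
move=> a s sa.
have [|ta [sA [xa va la ka]]] := h1 1 a (update s 1 (s 0)); first by rewrite /update eqxx.
have a0 : sA 0 = enc a by rewrite ka.
have [tb [sB [xb vb lb _]]] := h2 0 a sA a0.
have [tc [sC [xc vc lc _]]] := h3 0 a sA a0.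
case ep: (p a); rewrite ep in va.
- exists ((tsize (s 0)).+1 + (ta + tb.+1)), sB; split=> //; last by rewrite sa; lia.
  do 2!(apply: ExecSeq; [exact: ExecAssign || eassumption|]).
  by apply: ExecIfTrue xb => /=; rewrite va.
- exists ((tsize (s 0)).+1 + (ta + tc.+1)), sC; split=> //; last by rewrite sa; lia.
  do 2!(apply: ExecSeq; [exact: ExecAssign || eassumption|]).
  by apply: ExecIfFalse xc => /=; rewrite va.
Qed.

Lemma poly_foldl (l : A -> seq B) (x0 : A -> S) (h : A -> S -> B -> S) :
  poly l -> poly x0 -> poly (fun p : A * (S * B) => h p.1 p.2.1 p.2.2) ->
  (exists b, poly_bounded b /\ forall a l1 l2, l a = l1 ++ l2 ->
     esize (foldl (h a) (x0 a) l1) <= b (esize a)) ->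
  poly (fun a => foldl (h a) (x0 a) (l a)).
Proof.
move=> /poly_shift [c1 [C1 [e1 [s1 h1]]]] /poly_shift [c2 [C2 [e2 [s2 h2]]]]
  /poly_shift [c3 [C3 [e3 [s3 h3]]]] [b [hb bnd]].
pose body := Seq (Assign 3 (ECons (EVar 0) (ECons (EVar 2) (EHd (EVar 1)))))
  (Seq (cmd_shift 3 c3) (Seq (Assign 2 (EVar 3)) (Assign 1 (ETl (EVar 1))))).
pose M n := (n + b n + C1 * n ^ e1).+2.
pose step n := (M n).+1 + C3 * M n ^ e3 + (b n).+1 + (C1 * n ^ e1).+1.
have loop a l2 : forall l1 s, l a = l1 ++ l2 ->
    s 0 = enc a -> s 1 = enc l2 -> s 2 = enc (foldl (h a) (x0 a) l1) ->
    exists t s', [/\ exec (While (EVar 1) body) s t s',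
      s' 2 = enc (foldl (h a) (x0 a) (l a)) &
      t <= size l2 * (step (esize a)).+1 + 1].
  elim: l2 => [|x l2 ih] l1 s el v0 v1 v2.
    exists 1, s; split=> //; first exact: ExecWhileDone.
    by rewrite el cats0.
  pose q : A * (S * B) := (a, (foldl (h a) (x0 a) l1, x)).
  pose (sA := update s 3 (enc q)).
  have [|tb [sB [xb vb lb kb]]] := h3 3 q sA; first by rewrite /sA /update eqxx.
  have b0 : sB 0 = enc a by rewrite kb.
  have b1 : sB 1 = enc (x :: l2) by rewrite kb.
  pose sC := update sB 2 (sB 3).
  pose (sD := update sC 1 (enc l2)).
  have el' : l a = rcons l1 x ++ l2 by rewrite cat_rcons.
  have [] := ih (rcons l1 x) sD el' b0 erefl; first by rewrite -cats1 foldl_cat -vb.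
  move=> tE [sE [xE vE lE]].
  exists ((esize q).+1 + (tb + ((tsize (sB 3)).+1 + (esize l2).+1)) + tE).+1, sE.
  have eqv : eval (ECons (EVar 0) (ECons (EVar 2) (EHd (EVar 1)))) s = enc q.
    by rewrite /= v0 v1 v2.
  have eqt : eval (ETl (EVar 1)) sC = enc l2 by rewrite /= /sC /update /= b1.
  split=> //.
  - apply: ExecWhileStep xE; first by rewrite /= v1.
    have xA := ExecAssign s 3 (ECons (EVar 0) (ECons (EVar 2) (EHd (EVar 1)))).
    have xD := ExecAssign sC 1 (ETl (EVar 1)).
    rewrite eqv in xA; rewrite eqt in xD.
    exact: ExecSeq xA (ExecSeq xb (ExecSeq (ExecAssign sB 2 (EVar 3)) xD)).
  - have n0 : esize l2 <= C1 * esize a ^ e1 /\ esize x <= C1 * esize a ^ e1.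
      have := s1 a; rewrite el => hl.
      have h1l : esize (l1 ++ x :: l2) = esize l1 + esize x + esize l2.
        by apply: succn_inj; rewrite esize_cat esize_cons; lia.
      by move: hl; rewrite h1l; split; lia.
    have bq : esize q <= M (esize a).
      have := bnd a l1 _ el; rewrite /M /q !esize_pair /=; lia.
    have bt : tb <= C3 * M (esize a) ^ e3.
      by apply: leq_trans lb _; rewrite leq_mul2l leq_expn ?bq ?orbT.
    have b3 : tsize (sB 3) <= b (esize a).
      by rewrite vb; have := bnd a (rcons l1 x) l2 el'; rewrite -cats1 foldl_cat.
    by move: lE n0; rewrite /step [size (x :: l2)]/= mulSn; lia.
exists (Seq (Assign 1 (EVar 0)) (Seq (cmd_shift 1 c1)
  (Seq (Assign 2 (EVar 0)) (Seq (cmd_shift 2 c2)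
  (Seq (While (EVar 1) body) (Assign 0 (EVar 2))))))),
  (fun n => n.+1 + C1 * n ^ e1 + n.+1 + C2 * n ^ e2 +
    (C1 * n ^ e1 * (step n).+1 + 1) + (b n).+1).
split; first by rewrite /step /M; auto 40 with pb.
move=> a s sa.
have [|ta [sA [xa va la ka]]] := h1 1 a (update s 1 (s 0)); first by rewrite /update eqxx.
have a0 : sA 0 = enc a by rewrite ka.
have [|tb [sB [xb vb lb kb]]] := h2 2 a (update sA 2 (sA 0)); first by rewrite /update eqxx.
have b0 : sB 0 = enc a by rewrite kb.
have b1 : sB 1 = enc (l a) by rewrite kb.
have [tC [sC [xC vC lC]]] := loop a (l a) [::] sB erefl b0 b1 vb.
exists ((tsize (s 0)).+1 + (ta + ((tsize (sA 0)).+1 + (tb + (tC + (tsize (sC 2)).+1))))).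
exists (update sC 0 (sC 2)); split.
- do 5!(apply: ExecSeq; [exact: ExecAssign || eassumption|]).
  exact: (ExecAssign sC 0 (EVar 2)).
- by rewrite /update eqxx.
- rewrite sa a0 vC.
  have sl : size (l a) <= C1 * esize a ^ e1.
    exact: leq_trans (ltnW (size_le_esize _)) (s1 a).
  have := bnd a (l a) [::] (esym (cats0 _)).
  have : size (l a) * (step (esize a)).+1 <= C1 * esize a ^ e1 * (step (esize a)).+1.
    by rewrite leq_mul2r sl orbT.
  lia.
Qed.

End Combinators.

Section Recode.
Context {A B S : Type} {EA : Enc A} {EB : Enc B} {ES : Enc S}.

(** A program sees only encodings, so functions into different types may share one: a cons is a
    pair, a number is a list of units, a gate or circuit is a tuple. *)
Lemma poly_recode (f : A -> B) (g : A -> S) :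
  (forall a, enc (f a) = enc (g a)) -> poly f -> poly g.
Proof.
move=> fg [c [b [hb hc]]]; exists c, b; split=> // a s /hc [t [s' []]].
by exists t, s'; rewrite -fg.
Qed.

End Recode.

Section Structural.
Context {A B S : Type} {EA : Enc A} {EB : Enc B} {ES : Enc S}.

Lemma poly_id : poly (fun a : A => a).
Proof. by apply: (@poly_expr _ _ _ _ _ (EVar 0) id) => //; auto 20 with pb. Qed.

Lemma poly_fst (f : A -> B * S) : poly f -> poly (fun a => (f a).1).
Proof.
apply: (@poly_comp _ _ _ _ _ _ (fun p : B * S => p.1)).
apply: (@poly_expr _ _ _ _ _ (EHd (EVar 0)) id) => [p s /= ->| |p] //.
  by auto 20 with pb.
by rewrite esize_pair; lia.
Qed.

Lemma poly_snd (f : A -> B * S) : poly f -> poly (fun a => (f a).2).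
Proof.
apply: (@poly_comp _ _ _ _ _ _ (fun p : B * S => p.2)).
apply: (@poly_expr _ _ _ _ _ (ETl (EVar 0)) id) => [p s /= ->| |p] //.
  by auto 20 with pb.
by rewrite esize_pair; lia.
Qed.

Lemma poly_cons (f : A -> B) (g : A -> seq B) :
  poly f -> poly g -> poly (fun a => f a :: g a).
Proof. by move=> pf pg; apply: (poly_recode _ (poly_pair pf pg)). Qed.

Lemma poly_behead (f : A -> seq B) : poly f -> poly (fun a => behead (f a)).
Proof.
apply: (@poly_comp _ _ _ _ _ _ (fun l : seq B => behead l)).
apply: (@poly_expr _ _ _ _ _ (ETl (EVar 0)) id) => [[|x l] s /= ->| |[|x l]] //.
  by auto 20 with pb.
by rewrite esize_cons [behead _]/=; lia.
Qed.

End Structural.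

Section Logic.
Context {A B : Type} {EA : Enc A} {EB : Enc B}.

Lemma poly_notb (p : A -> bool) : poly p -> poly (fun a => ~~ p a).
Proof.
move=> hp; apply: (poly_ext (f := fun a => if p a then false else true)).
  by move=> a; case: (p a).
exact: poly_if hp (poly_const _) (poly_const _).
Qed.

Lemma poly_andb (p q : A -> bool) : poly p -> poly q -> poly (fun a => p a && q a).
Proof. by move=> hp hq; apply: poly_if hp hq (poly_const _). Qed.

Lemma poly_orb (p q : A -> bool) : poly p -> poly q -> poly (fun a => p a || q a).
Proof. by move=> hp hq; apply: poly_if hp (poly_const _) hq. Qed.

Lemma poly_implb (p q : A -> bool) : poly p -> poly q -> poly (fun a => p a ==> q a).
Proof. by move=> hp hq; apply: poly_if hp hq (poly_const _). Qed.

Lemma poly_nonnil (f : A -> seq B) : poly f -> poly (fun a => ~~ nilp (f a)).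
Proof.
move=> pf; have : poly (fun l : seq B => ~~ nilp l).
  exists (If (EVar 0) (Assign 0 (ECons ENil ENil)) Skip), (fun=> 5).
  split; first by auto 20 with pb.
  move=> [|x l] s s0.
    exists 2, s; split=> //; apply: ExecIfFalse; [by rewrite /= s0|exact: ExecSkip].
  exists 5, (update s 0 (Node Leaf Leaf)); split=> //.
  apply: ExecIfTrue; first by rewrite /= s0.
  exact: (ExecAssign s 0 (ECons ENil ENil)).
by move=> h; apply: (poly_comp h pf).
Qed.

Lemma poly_nilp (f : A -> seq B) : poly f -> poly (fun a => nilp (f a)).
Proof.
move=> /poly_nonnil/poly_notb; apply: poly_ext => a; exact: negbK.
Qed.

End Logic.

(** * Automation: closure rules for [poly], extended whenever further ones have been proved *)

Ltac poly_list_rule := fail.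

Ltac poly_rule := lazymatch goal with
  | H : @poly _ _ _ _ ?f |- @poly _ _ _ _ ?f => exact: H
  | |- @poly _ _ _ _ (fun _ => ?c) => exact: poly_const
  | |- @poly _ _ _ _ (fun a => a) => exact: poly_id
  | |- @poly _ _ _ _ (fun _ => (_, _)) => apply: poly_pair
  | |- @poly _ _ _ _ (fun _ => fst _) => apply: poly_fst
  | |- @poly _ _ _ _ (fun _ => snd _) => apply: poly_snd
  | |- @poly _ _ _ _ (fun _ => _ :: _) => apply: poly_cons
  | |- @poly _ _ _ _ (fun _ => behead _) => apply: poly_behead
  | |- @poly _ _ _ _ (fun _ => ~~ nilp _) => apply: poly_nonnil
  | |- @poly _ _ _ _ (fun _ => nilp _) => apply: poly_nilp
  | |- @poly _ _ _ _ (fun _ => ~~ _) => apply: poly_notb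
  | |- @poly _ _ _ _ (fun _ => _ && _) => apply: poly_andb
  | |- @poly _ _ _ _ (fun _ => _ || _) => apply: poly_orb
  | |- @poly _ _ _ _ (fun _ => _ ==> _) => apply: poly_implb
  | |- @poly _ _ _ _ (fun _ => if _ then _ else _) => apply: poly_if
  | |- _ => poly_list_rule
  end.
Ltac poly_eta := match goal with
  | |- @poly ?A ?B ?EA ?EB ?f => lazymatch f with
     | fun _ => _ => idtac
     | _ => change (@poly A B EA EB (fun a => f a))
     end
  end.
Ltac poly := repeat (cbv beta; first [eassumption | poly_eta; poly_rule]).

(** * Lists, unary arithmetic and decidable equality in polynomial time *)

Section Lists.
Context {A B S : Type} {EA : Enc A} {EB : Enc B} {ES : Enc S}.

Lemma poly_catrev (f g : A -> seq B) : poly f -> poly g ->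
  poly (fun a => catrev (f a) (g a)).
Proof.
move=> pf pg.
apply: (poly_ext (f := fun a => foldl (fun s x => x :: s) (g a) (f a))).
  by move=> a; elim: (f a) (g a) => //= x l ih s; rewrite ih.
apply: (poly_foldl (h := fun _ s x => x :: s)) => //.
  by poly.
have [C1 [e1 h1]] := poly_size pf; have [C2 [e2 h2]] := poly_size pg.
exists (fun n => C1 * n ^ e1 + C2 * n ^ e2); split; first by auto 20 with pb.
move=> a l1 l2 el; apply: leq_trans (leq_add (h1 a) (h2 a)); rewrite el.
have -> : esize (foldl (fun s x => x :: s) (g a) l1) = (esize l1 + esize (g a)).-1.
  elim: l1 (g a) {el} => [|x l1 ih] s; first by rewrite esize_nil.
  by rewrite [foldl _ _ _]/= ih !esize_cons; pose proof (size_le_esize l1); lia.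
pose proof (size_le_esize l2).
by have -> : esize (l1 ++ l2) = (esize l1 + esize l2).-1; [rewrite -esize_cat | lia].
Qed.

Lemma poly_rev (f : A -> seq B) : poly f -> poly (fun a => rev (f a)).
Proof. by move=> pf; apply: (poly_catrev pf (poly_const _)). Qed.

Lemma poly_cat (f g : A -> seq B) : poly f -> poly g -> poly (fun a => f a ++ g a).
Proof.
move=> pf pg; apply: (poly_ext (f := fun a => catrev (rev (f a)) (g a))).
  by move=> a; rewrite catrevE revK.
by apply: poly_catrev => //; apply: poly_rev.
Qed.

End Lists.

Lemma leq_esize_cat {A} {EA : Enc A} (u v : seq A) : esize u <= esize (u ++ v).
Proof. by elim: u => [|x u ih]; rewrite ?tsize_gt0 // cat_cons !esize_cons; lia. Qed.

Lemma esize_catrev {A} {EA : Enc A} (u v : seq A) :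
  (esize (catrev u v)).+1 = esize u + esize v.
Proof.
elim: u v => [|x u ih] v; first by rewrite esize_nil.
by rewrite [catrev _ _]/= ih !esize_cons; lia.
Qed.

Section FlatMap.
Context {A B S : Type} {EA : Enc A} {EB : Enc B} {ES : Enc S}.

(** The accumulator grows additively, by one piece of polynomial size per element, which settles the
    size condition of [poly_foldl] once and for all; map, filter, [all] and [has] are derived from
    here. Pieces are pushed in reverse and a final [rev] restores the order. *)
Lemma poly_flatmap (l : A -> seq B) (h : A -> B -> seq S) :
  poly (fun p : A * B => h p.1 p.2) -> poly l ->
  poly (fun a => flatten [seq h a x | x <- l a]).
Proof.
move=> ph pl.
apply: (poly_ext (f := fun a => rev (foldl (fun s x => catrev (h a x) s) [::] (l a)))).
  move=> a; rewrite -[RHS]revK; congr rev; rewrite -[RHS]cats0.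
  elim: (l a) [::] => //= x l' ih s.
  by rewrite ih rev_cat -catA catrevE.
apply: poly_rev; apply: (poly_foldl (h := fun a s x => catrev (h a x) s)) => //.
- exact: poly_const.
- apply: poly_catrev; last by poly.
  by apply: (poly_comp (g := fun p => h p.1 p.2) (f := fun p : A * (seq S * B) => (p.1, p.2.2)));
     [exact: ph | poly].
have [C1 [e1 h1]] := poly_size pl; have [C2 [e2 h2]] := poly_size ph.
exists (fun n => C1 * n ^ e1 * (C2 * (n + C1 * n ^ e1).+1 ^ e2) + 1); split; first by auto 20 with pb.
move=> a l1 l2 el.
have hs N s : esize l1 <= N -> esize (foldl (fun s x => catrev (h a x) s) s l1) <=
    esize s + size l1 * (C2 * (esize a + N).+1 ^ e2).
  elim: l1 s {el} => [|x l1 ih] s; first by rewrite addn0.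
  rewrite esize_cons => hN; apply: leq_trans (ih _ _) _; first by lia.
  have hx : esize (h a x) <= C2 * (esize a + N).+1 ^ e2.
    apply: leq_trans (h2 (a, x)) _; rewrite leq_mul2l leq_expn ?orbT // esize_pair /=.
    by rewrite ltnS leq_add2l; lia.
  pose proof (esize_catrev (h a x) s); rewrite [size (_ :: _)]/= mulSn; lia.
have hl : esize l1 <= C1 * esize a ^ e1.
  apply: leq_trans (h1 a); rewrite el.
  exact: leq_esize_cat.
apply: leq_trans (hs _ _ hl) _; rewrite esize_nil addnC leq_add2r leq_mul2r.
by rewrite (leq_trans (ltnW (size_le_esize _)) hl) orbT.
Qed.

End FlatMap.

Section ListFunctions.
Context {A B S : Type} {EA : Enc A} {EB : Enc B} {ES : Enc S}.

Lemma poly_map (l : A -> seq B) (h : A -> B -> S) :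
  poly (fun p : A * B => h p.1 p.2) -> poly l ->
  poly (fun a => [seq h a x | x <- l a]).
Proof.
move=> ph pl; apply: (poly_ext (f := fun a => flatten [seq [:: h a x] | x <- l a])).
  by move=> a; elim: (l a) => //= x s ->.
by apply: poly_flatmap => //; apply: poly_cons => //; exact: poly_const.
Qed.

Lemma poly_filter (l : A -> seq B) (h : A -> B -> bool) :
  poly (fun p : A * B => h p.1 p.2) -> poly l ->
  poly (fun a => [seq x <- l a | h a x]).
Proof.
move=> ph pl.
apply: (poly_ext (f := fun a => flatten [seq if h a x then [:: x] else [::] | x <- l a])).
  by move=> a; elim: (l a) => //= x s ->; case: ifP.
by apply: poly_flatmap => //; poly.
Qed.

Lemma poly_all (l : A -> seq B) (h : A -> B -> bool) :
  poly (fun p : A * B => h p.1 p.2) -> poly l ->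
  poly (fun a => all (h a) (l a)).
Proof.
move=> ph pl; apply: (poly_ext (f := fun a => nilp [seq x <- l a | ~~ h a x])).
  move=> a; rewrite /nilp size_filter -leqn0 leqNgt -has_count has_predC.
  by rewrite negbK.
by apply: poly_nilp; apply: poly_filter => //; apply: poly_notb.
Qed.

Lemma poly_has (l : A -> seq B) (h : A -> B -> bool) :
  poly (fun p : A * B => h p.1 p.2) -> poly l ->
  poly (fun a => has (h a) (l a)).
Proof.
move=> ph pl; apply: (poly_ext (f := fun a => ~~ nilp [seq x <- l a | h a x])).
  by move=> a; rewrite /nilp size_filter -leqn0 leqNgt -has_count negbK.
by apply: poly_nonnil; apply: poly_filter.
Qed.

Lemma poly_flatten (l : A -> seq (seq B)) : poly l -> poly (fun a => flatten (l a)).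
Proof.
move=> pl; apply: (poly_ext (f := fun a => flatten [seq x | x <- l a])).
  by move=> a; rewrite map_id.
by apply: (poly_flatmap (h := fun _ x => x)) => //; poly.
Qed.

Lemma poly_head (x0 : A -> B) (l : A -> seq B) :
  poly x0 -> poly l -> poly (fun a => head (x0 a) (l a)).
Proof.
move=> p0 pl; apply: (poly_ext (f := fun a => foldl (fun _ x => x) (x0 a) (rev (l a)))).
  by move=> a; case: (l a) => //= x s; rewrite rev_cons -cats1 foldl_cat.
apply: (poly_foldl (h := fun _ _ x => x)) => //; [exact: poly_rev | by poly |].
have [C1 [e1 h1]] := poly_size p0; have [C2 [e2 h2]] := poly_size (poly_rev pl).
exists (fun n => C1 * n ^ e1 + C2 * n ^ e2); split; first by auto 20 with pb.
move=> a l1 l2 el; apply: leq_trans (leq_add (h1 a) (h2 a)); rewrite el.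
case/lastP: l1 {el} => [|l1 x]; first exact: leq_addr.
rewrite -cats1 foldl_cat [foldl _ _ [:: x]]/= -catA.
apply: leq_trans (leq_addl _ _); elim: l1 => [|y l1 ih]; rewrite cat_cons esize_cons; lia.
Qed.

End ListFunctions.

Section Counting.
Context {A B : Type} {EA : Enc A} {EB : Enc B}.

(** In unary, [n] and the list of [n] units have the same encoding; this reduces arithmetic to
    lists. *)
Lemma poly_size_seq (l : A -> seq B) : poly l -> poly (fun a => size (l a)).
Proof.
move=> pl; apply: (poly_recode (f := fun a => [seq tt | x <- l a])).
  by move=> a; rewrite /enc; elim: (l a) => //= x s ->.
by apply: poly_map => //; exact: poly_const.
Qed.

Lemma poly_nseq_tt (n : A -> nat) : poly n -> poly (fun a => nseq (n a) tt).
Proof.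
by apply: poly_recode => a; rewrite /enc /Enc_seq; elim: (n a) => //= m ->.
Qed.

Lemma poly_iter (n : A -> nat) (x0 : A -> B) (h : A -> B -> B) :
  poly n -> poly x0 -> poly (fun p : A * B => h p.1 p.2) ->
  (exists b, poly_bounded b /\ forall a m, m <= n a ->
     esize (iter m (h a) (x0 a)) <= b (esize a)) ->
  poly (fun a => iter (n a) (h a) (x0 a)).
Proof.
move=> /poly_nseq_tt pn p0 ph [b [hb bnd]].
have iterE a m x : iter m (h a) x = foldl (fun s _ => h a s) x (nseq m tt).
  by elim: m x => // m ih x; rewrite iterSr ih.
apply: (poly_ext (fun a => esym (iterE a (n a) (x0 a)))).
apply: (poly_foldl (h := fun a s _ => h a s)) => //.
  by apply: (poly_comp (g := fun p => h p.1 p.2) (f := fun p : A * (B * unit) => (p.1, p.2.1))); [exact: ph | poly].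
exists b; split=> // a l1 l2 el.
have -> : l1 = nseq (size l1) tt by elim: (l1) => // -[] s /= ->; rewrite size_nseq.
by rewrite -iterE; apply: bnd; rewrite -(size_nseq (n a) tt) el size_cat leq_addr.
Qed.

End Counting.

Section Naturals.
Context {A : Type} {EA : Enc A}.
Implicit Types f g : A -> nat.

Lemma esize_nat (n : nat) : esize n = n.*2.+1.
Proof. by rewrite /enc /Enc_nat; elim: n => //= n ->; rewrite doubleS add1n. Qed.

Lemma poly_size_nat f : poly f -> exists C e, forall a, f a <= C * esize a ^ e.
Proof.
move=> /poly_size [C [e h]]; exists C, e => a; apply: leq_trans (h a).
by rewrite esize_nat; lia.
Qed.

Lemma poly_succ f : poly f -> poly (fun a => (f a).+1).
Proof.
apply: (@poly_comp _ _ _ _ _ _ (fun n => n.+1)).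
apply: (@poly_expr _ _ _ _ _ (ECons ENil (EVar 0)) (fun n => n.+2)) => [n s /= ->| |n] //.
by auto 20 with pb.
Qed.

Lemma poly_pred f : poly f -> poly (fun a => (f a).-1).
Proof.
apply: (@poly_comp _ _ _ _ _ _ (fun n => n.-1)).
apply: (@poly_expr _ _ _ _ _ (ETl (EVar 0)) id) => [[|n] s /= ->| |[|n]] //.
  by auto 20 with pb.
by rewrite !esize_nat; lia.
Qed.

End Naturals.

Section Arithmetic.
Context {A : Type} {EA : Enc A}.
Implicit Types f g : A -> nat.

Lemma poly_addn f g : poly f -> poly g -> poly (fun a => f a + g a).
Proof.
move=> pf pg; apply: (poly_ext (f := fun a => iter (f a) succn (g a))).
  by move=> a; elim: (f a) => //= n ->.
apply: (poly_iter (h := fun _ n => n.+1)) => //; first by apply: poly_succ; poly.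
have [C1 [e1 h1]] := poly_size_nat pf; have [C2 [e2 h2]] := poly_size_nat pg.
exists (fun n => (C1 * n ^ e1 + C2 * n ^ e2) * 2 + 1); split; first by auto 20 with pb.
move=> a m ma; have -> : iter m succn (g a) = m + g a by elim: (m) => //= k ->.
by rewrite esize_nat; have := h1 a; have := h2 a; lia.
Qed.

Lemma poly_subn f g : poly f -> poly g -> poly (fun a => f a - g a).
Proof.
move=> pf pg; apply: (poly_ext (f := fun a => iter (g a) predn (f a))).
  by move=> a; elim: (g a) => [|n /= ->] /=; lia.
apply: (poly_iter (h := fun _ n => n.-1)) => //; first by apply: poly_pred; poly.
have [C1 [e1 h1]] := poly_size pf.
exists (fun n => C1 * n ^ e1); split; first by auto 20 with pb.
move=> a m ma; apply: leq_trans (h1 a); rewrite !esize_nat.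
have -> : iter m predn (f a) = f a - m by elim: (m) => [|k /= ->] /=; lia.
by lia.
Qed.

Lemma poly_leq f g : poly f -> poly g -> poly (fun a => f a <= g a).
Proof.
move=> pf pg; apply: (poly_ext (f := fun a => nilp (nseq (f a - g a) tt))).
  by move=> a; rewrite /nilp size_nseq.
by apply: poly_nilp; apply: poly_nseq_tt; apply: poly_subn.
Qed.

Lemma poly_eqn f g : poly f -> poly g -> poly (fun a => f a == g a).
Proof.
move=> pf pg; apply: (poly_ext (f := fun a => (f a <= g a) && (g a <= f a))).
  by move=> a; rewrite eqn_leq.
by apply: poly_andb; apply: poly_leq.
Qed.

Lemma poly_muln f g : poly f -> poly g -> poly (fun a => f a * g a).
Proof.
move=> pf pg.
apply: (poly_ext (f := fun a => size (flatten [seq nseq (g a) tt | _ <- nseq (f a) tt]))).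
  by move=> a; elim: (f a) => //= n; rewrite size_cat size_nseq mulSn => ->.
apply: poly_size_seq; apply: (poly_flatmap (h := fun a _ => nseq (g a) tt)).
  apply: poly_nseq_tt.
  by apply: (poly_comp (g := g) (f := fun p : A * unit => p.1)); [exact: pg | poly].
exact: poly_nseq_tt.
Qed.

Lemma poly_expn f e : poly f -> poly (fun a => f a ^ e).
Proof.
move=> pf; elim: e => [|e ih]; first exact: poly_const.
by apply: (poly_ext (f := fun a => f a * f a ^ e)) => [a|]; [rewrite expnS | apply: poly_muln].
Qed.

Lemma poly_iota0 f : poly f -> poly (fun a => iota 0 (f a)).
Proof.
move=> pf.
have iterE m : iter m (fun s => size s :: s) [::] = rev (iota 0 m).
  elim: m => // m ih; rewrite iterS ih size_rev size_iota -[in RHS]addn1 iotaD add0n.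
  by rewrite rev_cat.
apply: (poly_ext (f := fun a => rev (iter (f a) (fun s => size s :: s) [::]))).
  by move=> a; rewrite iterE revK.
apply: poly_rev; apply: (poly_iter (h := fun _ s => size s :: s)) => //.
- exact: poly_const.
- by apply: poly_cons; [apply: poly_size_seq|]; poly.
have [C1 [e1 h1]] := poly_size_nat pf.
exists (fun n => C1 * n ^ e1 * (C1 * n ^ e1 * 2 + 2) + 1); split; first by auto 20 with pb.
move=> a m ma; have {ma} hm := leq_trans ma (h1 a).
have h : esize (iter m (fun s => size s :: s) [::]) <= m * (C1 * esize a ^ e1 * 2 + 2) + 1; last first.
  by apply: leq_trans h _; rewrite leq_add2r leq_mul2r hm orbT.
elim: m hm => [|m ih] hm; first by rewrite esize_nil.
have sz : size (iter m (fun s => size s :: s) [::]) = m.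
  by rewrite iterE size_rev size_iota.
by rewrite iterS esize_cons esize_nat sz mulSn; have := ih (ltnW hm); lia.
Qed.

End Arithmetic.

Section Access.
Context {A B : Type} {EA : Enc A} {EB : Enc B}.

Lemma poly_drop (n : A -> nat) (l : A -> seq B) :
  poly n -> poly l -> poly (fun a => drop (n a) (l a)).
Proof.
move=> pn pl; have dropE m (s : seq B) : iter m behead s = drop m s.
  by elim: m s => [|m ih] s; rewrite ?drop0 // iterSr ih; case: s.
apply: (poly_ext (f := fun a => iter (n a) behead (l a))) => [a|].
  by rewrite dropE.
apply: (poly_iter (h := fun _ s => behead s)) => //; first by poly.
have [C1 [e1 h1]] := poly_size pl.
exists (fun n => C1 * n ^ e1); split; first by auto 20 with pb.
move=> a m _; apply: leq_trans (h1 a); rewrite dropE.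
elim: (l a) m => [|x s ih] [|m] //.
by rewrite [drop _ _]/=; apply: leq_trans (ih m) _; rewrite esize_cons; lia.
Qed.

End Access.

Section Equality.
Context {A : Type} {EA : Enc A}.

Lemma poly_nth {B} {EB : Enc B} (x0 : A -> B) (n : A -> nat) (l : A -> seq B) :
  poly x0 -> poly n -> poly l -> poly (fun a => nth (x0 a) (l a) (n a)).
Proof.
move=> p0 pn pl; apply: (poly_ext (f := fun a => head (x0 a) (drop (n a) (l a)))).
  by move=> a; rewrite -nth0 nth_drop addn0.
by apply: poly_head => //; apply: poly_drop.
Qed.

Definition poly_eq (B : eqType) {EB : Enc B} := poly (fun p : B * B => p.1 == p.2).
Arguments poly_eq B {EB}.

Lemma poly_eqE {B : eqType} {EB : Enc B} (f g : A -> B) :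
  poly_eq B -> poly f -> poly g -> poly (fun a => f a == g a).
Proof.
by move=> h pf pg; apply: (poly_comp (f := fun a => (f a, g a)) h); apply: poly_pair.
Qed.

Lemma poly_eq_nat : poly_eq nat.
Proof. by apply: poly_eqn; poly. Qed.

End Equality.
Arguments poly_eq B {EB}.

Lemma poly_eq_pair (B C : eqType) (EB : Enc B) (EC : Enc C) :
  poly_eq B -> poly_eq C -> poly_eq (B * C)%type.
Proof.
move=> hB hC; apply: (poly_ext (f := fun p : (B * C) * (B * C) => (p.1.1 == p.2.1) && (p.1.2 == p.2.2))).
  by move=> [[a b] [c d]].
by apply: poly_andb; apply: poly_eqE => //; poly.
Qed.

Lemma poly_eq_seq (B : eqType) (EB : Enc B) : poly_eq B -> poly_eq (seq B).
Proof.
move=> hB.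
(* The state is the verdict so far together with the unread part of the second list; the lists are
   equal when the verdict stays true and nothing remains unread. *)
pose h (x0 : unit) (s : bool * seq B) x :=
  (s.1 && ~~ nilp s.2 && (head x s.2 == x), behead s.2).
have hE (s t : seq B) b : (foldl (h tt) (b, t) s) = (b && (take (size s) t == s), drop (size s) t).
  elim: s t b => [|x s ih] t b; first by rewrite take0 eqxx andbT drop0.
  rewrite [foldl _ _ _]/= ih; case: t => [|y t] /=; first by rewrite andbF.
  by rewrite eqseq_cons /= andbT andbA.
apply: (poly_ext (f := fun p : seq B * seq B =>
    (foldl (h tt) (true, p.2) p.1).1 && nilp (foldl (h tt) (true, p.2) p.1).2)).
  move=> [s t]; rewrite hE /= /nilp size_drop subn_eq0.
  apply/andP/eqP => [[/eqP e hle]|->]; last by rewrite take_size eqxx.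
  by rewrite -e take_oversize.
have p : poly (fun p : seq B * seq B => foldl (h tt) (true, p.2) p.1).
  apply: (poly_foldl (l := fst) (x0 := fun p => (true, p.2)) (h := fun _ => h tt)); [by poly|by poly| |].
    rewrite /h; poly; apply: poly_eqE => //; last by poly.
    by apply: poly_head; poly.
  exists (fun n => n + 5); split; first by auto 20 with pb.
  move=> [s t] l1 l2 _; rewrite hE.
  have hb (b : bool) : esize b <= 3 by case: b.
  have ht : esize (drop (size l1) t) <= esize t.
    elim: t (size l1) => [|x t ih] [|n] //.
    by rewrite [drop _ _]/=; apply: leq_trans (ih n) _; rewrite esize_cons; lia.
  rewrite (esize_pair (_, _)) (esize_pair (s, t)).
  apply: (@leq_trans (3 + esize t).+1); first by rewrite ltnS leq_add ?hb.
  by change (esize (s, t).2) with (esize t); lia.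
by apply: poly_andb; poly.
Qed.

Section Misc.
Context {A : Type} {EA : Enc A}.

Lemma poly_mem {B : eqType} {EB : Enc B} (x : A -> B) (s : A -> seq B) :
  poly_eq B -> poly x -> poly s -> poly (fun a => x a \in s a).
Proof.
move=> h px ps; apply: (poly_ext (f := fun a => has (pred1 (x a)) (s a))).
  by move=> a; rewrite has_pred1.
apply: (poly_has (h := fun a => pred1 (x a))) => //; apply: poly_eqE => //; first by poly.
by apply: (poly_comp (g := x) (f := fst)) => //; poly.
Qed.

End Misc.

Section MoreLists.
Context {A B C S : Type} {EA : Enc A} {EB : Enc B} {EC : Enc C} {ES : Enc S}.

Lemma poly_allpairs (l : A -> seq B) (l' : A -> seq C) (h : A -> B -> C -> S) :
  poly (fun p : A * B * C => h p.1.1 p.1.2 p.2) -> poly l -> poly l' ->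
  poly (fun a => [seq h a x y | x <- l a, y <- l' a]).
Proof.
move=> ph pl pl'.
apply: (poly_flatmap (h := fun a x => [seq h a x y | y <- l' a])) => //.
apply: (poly_map (h := fun p y => h p.1 p.2 y) (l := fun p : A * B => l' p.1)) => //.
by apply: (poly_comp pl'); poly.
Qed.

End MoreLists.

Ltac poly_list_rule ::= lazymatch goal with
  | |- @poly _ _ _ _ (fun _ => S _) => apply: poly_succ
  | |- @poly _ _ _ _ (fun _ => predn _) => apply: poly_pred
  | |- @poly _ _ _ _ (fun _ => addn _ _) => apply: poly_addn
  | |- @poly _ _ _ _ (fun _ => subn _ _) => apply: poly_subn
  | |- @poly _ _ _ _ (fun _ => muln _ _) => apply: poly_muln
  | |- @poly _ _ _ _ (fun _ => expn _ _) => apply: poly_expn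
  | |- @poly _ _ _ _ (fun _ => leq _ _) => apply: poly_leq
  | |- @poly _ _ _ _ (fun _ => eq_op _ _) => apply: poly_eqE
  | |- @poly _ _ _ _ (fun _ => iota 0 _) => apply: poly_iota0
  | |- @poly _ _ _ _ (fun _ => nth _ _ _) => apply: poly_nth
  | |- @poly _ _ _ _ (fun _ => head _ _) => apply: poly_head
  | |- @poly _ _ _ _ (fun _ => size _) => apply: poly_size_seq
  | |- @poly _ _ _ _ (fun _ => rev _) => apply: poly_rev
  | |- @poly _ _ _ _ (fun _ => cat _ _) => apply: poly_cat
  | |- @poly _ _ _ _ (fun _ => in_mem _ _) => apply: poly_mem
  | |- @poly _ _ _ _ (fun _ => flatten (map (fun x => map _ _) _)) => apply: poly_allpairs
  | |- @poly _ _ _ _ (fun _ => flatten (map _ _)) => apply: poly_flatmap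
  | |- @poly _ _ _ _ (fun _ => flatten _) => apply: poly_flatten
  | |- @poly _ _ _ _ (fun _ => map _ _) => apply: poly_map
  | |- @poly _ _ _ _ (fun _ => filter _ _) => apply: poly_filter
  | |- @poly _ _ _ _ (fun _ => all _ _) => apply: poly_all
  | |- @poly _ _ _ _ (fun _ => has _ _) => apply: poly_has
  end.

Ltac poly_eqs := lazymatch goal with |- poly_eq _ =>
  solve [repeat first [exact: poly_eq_nat | apply: poly_eq_pair | apply: poly_eq_seq]] end.
Ltac poly ::= repeat (cbv beta; first [eassumption | poly_eqs | poly_eta; poly_rule]).

(** * The SMC-1 gadget *)

(* [bd] marks the first column of each block; the default [true] makes the last
   column of all an end. *)
Definition seg_end (bd : seq bool) (y : nat) : bool := nth true bd y.+1.

(* Persons are pairs (level, column), both sexes being ranked by increasing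
   level, then column.  The paths of the blocks are at level 0; level [l <= E]
   carries the [l]-th link from [y] to [x], by which man [(l, x)] accepts woman
   [(l, y)]; at level [E.+1] each block has one man more than women, which
   accommodates a single token; level [E.+2] is a path leading to a starred woman,
   who loses her husband if a second token gets there.  The starred women of the
   blocks are at level [E.+3]. *)
Definition adj (bd : seq bool) (links : seq (nat * nat)) (m w : nat * nat) : bool :=
  let E := size links in
  let near := (m.2 == w.2) || (m.2 == w.2.+1) in
  if m.1 == 0 then
    (w.1 == 0) && near || (w.1 == E.+3) && (m.2 == w.2) && nth false bd m.2
  else if m.1 <= E then
    (m.2 == w.2) && ((w.1.+1 == m.1) || (w.1 == m.1)) ||
    (w.1 == m.1) && ((w.2, m.2) == nth (0, 0) links m.1.-1)
  else if m.1 == E.+1 then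
    (w.1 == E) && (m.2 == w.2) || (w.1 == E.+1) && near && ~~ seg_end bd w.2
  else (m.1 == E.+2) && ((w.1 == E.+1) && (m.2 == w.2) && ~~ seg_end bd w.2
         || (w.1 == E.+2) && near).

Definition starred (bd : seq bool) (links : seq (nat * nat)) (w : nat * nat) : bool :=
  (w.1 == (size links).+3) && nth false bd w.2 ||
  (w.1 == (size links).+2) && (w.2.+1 == size bd).

Definition names (a T : nat) : seq (nat * nat) :=
  [seq (l, x) | l <- iota 0 a, x <- iota 0 T].

Definition smc_data := (seq (seq nat) * (seq (seq nat) * (seq nat * (seq nat * nat))))%type.

Definition gadget (bd : seq bool) (links : seq (nat * nat)) (b : nat) : smc_data :=
  let E := size links in let T := size bd in
  let men := names E.+3 T in let women := names E.+4 T in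
  ([seq [seq j <- iota 0 (size women) | adj bd links (nth (0,0) men i) (nth (0,0) women j)]
     | i <- iota 0 (size men)],
  ([seq [seq i <- iota 0 (size men) | adj bd links (nth (0,0) men i) (nth (0,0) women j)]
     | j <- iota 0 (size women)],
  ([::], ([seq j <- iota 0 (size women) | starred bd links (nth (0,0) women j)], b)))).

(** * Block numbers, and the acceptable pairs level by level *)

(** Blocks are counted from 1; a column beyond the last one gets the number of the last block. *)
Definition seg (bd : seq bool) (x : nat) : nat := count id (take x.+1 bd).

(** The ranking common to both sexes, smaller being better: the order of indices in [names], hence
    both master lists at once. *)
Definition lex (p q : nat * nat) : bool := (p.1 < q.1) || (p.1 == q.1) && (p.2 < q.2).

Section Segments.
Variable bd : seq bool.
Notation T := (size bd).
Notation start x := (nth false bd x).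

Lemma start_lt x : start x -> x < T.
Proof. by rewrite ltnNge; apply: contraL => h; rewrite nth_default. Qed.

Lemma segS x : seg bd x.+1 = seg bd x + start x.+1.
Proof.
rewrite /seg; have [h|h] := ltnP x.+1 T.
  by rewrite (take_nth false) // -cats1 count_cat /= addn0.
by rewrite nth_default // addn0 !take_oversize //; exact: leq_trans h _.
Qed.

Lemma seg_mono x y : x <= y -> seg bd x <= seg bd y.
Proof.
elim: y => [|y ih]; first by rewrite leqn0 => /eqP ->.
rewrite leq_eqVlt => /predU1P [-> //|/ih h].
by rewrite segS; lia.
Qed.

Lemma seg_start x y : y < x -> start x -> seg bd y < seg bd x.
Proof.
by case: x => // x yx sx; rewrite segS sx; have := @seg_mono y x yx; lia.
Qed.

Lemma seg_le x : seg bd x <= count id bd.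
Proof. by rewrite -[in leqRHS](cat_take_drop x.+1 bd) count_cat leq_addr. Qed.

End Segments.

Section Adjacency.
Variables (bd : seq bool) (links : seq (nat * nat)).
Let E := size links.
Notation start x := (nth false bd x).

Lemma adj_w0 m y : adj bd links m (0, y) ->
  [\/ m = (0, y), m = (0, y.+1) | m = (1, y)].
Proof.
case: m => l x; rewrite /adj /= -/E; case: ifP => [/eqP ->|l0].
  rewrite /= orbF => /orP [] /eqP ->; [exact: Or31 | exact: Or32].
case: ifP => lE.
  rewrite [0 == l]eq_sym l0 /= !orbF => /andP [/eqP -> /eqP <-]; exact: Or33.
case: ifP => [/eqP le|_].
  by rewrite ?orbF => /andP [/eqP e0 /eqP ->]; apply: Or33; rewrite le -e0.
by rewrite ?andbF.
Qed.

Lemma adj_wl m l y : 0 < l <= E -> adj bd links m (l, y) ->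
  [\/ m = (l, y), m = (l.+1, y) | m.1 = l /\ nth (0, 0) links l.-1 = (y, m.2)].
Proof.
case: m => l' x hl; rewrite /adj /= -/E; case: ifP => [/eqP ->|l0]; first lia.
case: ifP => lE.
  case/orP; last by move=> /andP [/eqP -> /eqP h]; exact: Or33.
  by move=> /andP [/eqP -> /orP [] /eqP <-]; [exact: Or32 | exact: Or31].
case: ifP => [/eqP ->|_]; last lia.
rewrite [l == E.+1]ltn_eqF //= ?orbF; last lia.
by move=> /andP [/eqP -> /eqP ->]; exact: Or32.
Qed.

Lemma adj_wL m y : adj bd links m (E.+1, y) -> ~~ seg_end bd y /\
  [\/ m = (E.+1, y), m = (E.+1, y.+1) | m = (E.+2, y)].
Proof.
case: m => l x; rewrite /adj /= -/E; case: ifP => [/eqP ->|l0]; first lia.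
case: ifP => lE; first lia.
case: ifP => [/eqP ->|_].
  case/orP; first lia.
  by move=> /andP [/andP [_ /orP [] /eqP ->] ->]; split=> //; [exact: Or31 | exact: Or32].
move=> /andP [/eqP -> /orP [/andP [/andP [_ /eqP ->] ->]|]]; last lia.
by split=> //; exact: Or33.
Qed.

Lemma adj_wS m y : adj bd links m (E.+2, y) -> m = (E.+2, y) \/ m = (E.+2, y.+1).
Proof.
case: m => l x; rewrite /adj /= -/E; case: ifP => [/eqP ->|l0]; first lia.
case: ifP => lE; first lia.
case: ifP => [/eqP ->|_]; first lia.
move=> /andP [/eqP -> /orP []]; first lia.
by move=> /andP [_ /orP [] /eqP ->]; [left|right].
Qed.

Lemma adj_wstar m y : adj bd links m (E.+3, y) -> m = (0, y) /\ start y.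
Proof.
case: m => l x; rewrite /adj /= -/E; case: ifP => [/eqP ->|l0].
  by rewrite eqxx /= => /andP [/eqP -> ->].
case: ifP => lE; first lia.
by case: ifP => [/eqP ->|_]; lia.
Qed.

(** The man below prefers the vertical pair to everything else, so whether it blocks depends on its
    woman only. *)
Lemma adj_top l x w : l <= E.+1 -> adj bd links (l.+1, x) w -> w <> (l, x) -> lex (l, x) w.
Proof.
case: w => l' y hl; rewrite /adj /= -/E /lex /=.
case: ifP => lE.
  case/orP; last by move=> /andP [/eqP -> _] _; rewrite ltnSn.
  by move=> /andP [/eqP -> /orP [] /eqP e]; [case: e => -> | rewrite e ltnSn].
case: ifP => [/eqP [->]|_].
  case/orP; first by move=> /andP [/eqP -> /eqP ->].
  by move=> /andP [/andP [/eqP -> _] _] _; rewrite ltnSn.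
move=> /andP [/eqP [->] /orP [/andP [/andP [/eqP -> /eqP -> //]]|]].
by move=> /andP [/eqP -> _] _; rewrite ltnSn.
Qed.

Lemma adj_vert l x : l <= E -> adj bd links (l.+1, x) (l, x).
Proof.
move=> hl; rewrite /adj /= -/E; case: ifP => lE; first by rewrite !eqxx.
have -> : l = E by lia.
by rewrite !eqxx.
Qed.

Lemma adj_S m : m.1 = E.+2 -> forall w, adj bd links m w =
  ((w.1 == E.+1) && (m.2 == w.2) && ~~ seg_end bd w.2
   || (w.1 == E.+2) && ((m.2 == w.2) || (m.2 == w.2.+1))).
Proof.
case: m => l x /= -> w; rewrite /adj /= -/E eqxx.
by rewrite leqNgt ltnW ?ltnS //= eqSS gtn_eqF.
Qed.

Lemma adj_L m : m.1 = E.+1 -> forall w, adj bd links m w =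
  ((w.1 == E) && (m.2 == w.2)
   || (w.1 == E.+1) && ((m.2 == w.2) || (m.2 == w.2.+1)) && ~~ seg_end bd w.2).
Proof. by case: m => l x /= -> w; rewrite /adj /= -/E eqxx ltnn. Qed.

Lemma adj_l m : 0 < m.1 <= E -> forall w, adj bd links m w =
  ((m.2 == w.2) && ((w.1.+1 == m.1) || (w.1 == m.1)) ||
    (w.1 == m.1) && ((w.2, m.2) == nth (0, 0) links m.1.-1)).
Proof. by case: m => [[|l] x] //= h w; rewrite /adj /= -/E h. Qed.

End Adjacency.

Section Gadget.
Variables (bd : seq bool) (links : seq (nat * nat)).
Let T := size bd.
Let E := size links.
Let nb := count id bd.
Notation start x := (nth false bd x).

Definition selection (sel : pred nat) : Prop :=
  [/\ forall x, x < T -> exists y, [/\ y < T, seg bd y = seg bd x & sel y],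
      forall x y, x < T -> y < T -> sel x -> sel y -> seg bd x = seg bd y -> x = y &
      forall p, p \in links -> sel p.1 -> sel p.2].

Hypothesis T0 : 0 < T.
Hypothesis start0 : start 0.
Hypothesis start_last : start T.-1.
Hypothesis linksT : forall p, p \in links -> p.1 < p.2 < T.

Lemma seg_exists j : 0 < j <= nb -> exists2 x, x < T & seg bd x = j.
Proof.
move=> /andP [j0 jn].
have segT : seg bd T.-1 = nb by rewrite /seg prednK // take_size.
have seg0 : seg bd 0 = 1.
  rewrite /seg; case: (bd) start0 T0 => //= b s; rewrite /= => -> _; by rewrite take0.
suff h n : forall j, 0 < j <= seg bd n -> exists2 x, x <= n & seg bd x = j.
  by have [|x hx <-] := h T.-1 j; [rewrite segT j0 | exists x; lia].
elim: n => [|n ih] k; first by rewrite seg0 => hk; exists 0; lia.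
rewrite segS => hk; case: (leqP k (seg bd n)) => hn.
  by have [|x hx <-] := ih k; [lia | exists x => //; lia].
by exists n.+1 => //; rewrite segS; lia.
Qed.

Lemma seg_gt0 x : 0 < seg bd x.
Proof.
have seg0 : seg bd 0 = 1.
  rewrite /seg; case: (bd) start0 T0 => //= b s; rewrite /= => -> _; by rewrite take0.
by have := seg_mono bd (leq0n x); rewrite seg0.
Qed.

Lemma seg_first x : x < T -> exists s, [/\ s <= x, start s & seg bd s = seg bd x].
Proof.
elim: x => [|x ih] hx; first by exists 0.
case sx: (start x.+1); first by exists x.+1.
have [s [h1 h2 h3]] := ih (ltnW hx); exists s; rewrite segS sx addn0.
by split=> //; lia.
Qed.

(** An unmatched person imposes no condition, the quantifier over partners being vacuous. *)
Definition blocking_names (mt : nat * nat -> nat * nat -> bool) (m w : nat * nat) : Prop :=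
  [/\ m.2 < T, w.2 < T, adj bd links m w,
      forall w', mt m w' -> lex w w' & forall m', mt m' w -> lex m m'].

(** * From a matching within the budget to a selection *)

Section Soundness.
Variable mt : nat * nat -> nat * nat -> bool.
Hypothesis mt_range : forall m w, mt m w -> [/\ m.2 < T, w.2 < T & adj bd links m w].
Hypothesis mt_w : forall m w w', mt m w -> mt m w' -> w = w'.
Hypothesis mt_star : forall w, w.2 < T -> starred bd links w -> exists m, mt m w.

Notation blocks_pair := (blocking_names mt).

Hypothesis few_blocking : forall bl : seq ((nat * nat) * (nat * nat)),
  uniq bl -> (forall p, p \in bl -> blocks_pair p.1 p.2) -> size bl <= (2 * nb).-1.

(** The column where the shortage leaves the path: neither level-0 man is with this woman, so only
    man [(1, y)] can take her. *)
Let sel y := ~~ mt (0, y) (0, y) && ~~ mt (0, y.+1) (0, y).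

Lemma start_matched x : start x -> mt (0, x) (E.+3, x).
Proof.
move=> sx; have [|m hm] := mt_star (w := (E.+3, x)) (start_lt sx).
  by rewrite /starred eqxx sx.
have [_ _ h] := mt_range hm.
by have [<- _] := adj_wstar h.
Qed.

Lemma sink_matched : mt (E.+2, T.-1) (E.+2, T.-1).
Proof.
have tT : T.-1 < T by lia.
have [|m hm] := mt_star (w := (E.+2, T.-1)) tT.
  by rewrite /starred /= -/E -/T prednK // !eqxx orbT.
have [h1 _ h] := mt_range hm; have [e|e] := adj_wS h; first by rewrite -{1}e.
by exfalso; move: h1; rewrite e /=; lia.
Qed.

(** Man [(0, x)] is with his starred woman, the last on his list, while he is the first choice of
    woman [(0, x)]. *)
Lemma block_start x : start x -> blocks_pair (0, x) (0, x).
Proof.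
move=> sx; have xT := start_lt sx; split=> //=; first by rewrite /adj /= eqxx.
  by move=> w' /(mt_w (start_matched sx)) <-.
move=> m' h; have [_ _ /adj_w0 [] e] := mt_range h; rewrite e /lex /=; try lia.
by have := mt_w (start_matched sx) (m := (0, x)); rewrite -e => /(_ _ h).
Qed.

(** Woman [(0, y)] has at best man [(1, y)], and she heads the list of man [(0, y.+1)]. *)
Lemma block_sel y : y.+1 < T -> sel y -> blocks_pair (0, y.+1) (0, y).
Proof.
move=> yT /andP [n1 n2]; split=> //=; try lia; first by rewrite /adj /= eqxx orbT.
  move=> w' h; have [_ _] := mt_range h; rewrite /adj /= /lex => /orP [|/andP [/andP [/eqP -> _] _]] //.
  case: w' h => l z /= h /andP [/eqP e /orP [] /eqP ez].
    by rewrite e -ez ltnSn.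
  by rewrite e ez in h n2 *; case: ez => ez; rewrite ez h in n2.
move=> m' h; have [_ _ /adj_w0 [] e] := mt_range h; rewrite e in h *; last by [].
  by rewrite h in n1.
by rewrite h in n2.
Qed.

(** Starting from the first column of the block, take the first [y] such that man [(0, y.+1)] is not
    with woman [(0, y)]. The shift to the left cannot cross into the next block, whose first man is
    with his starred woman; and man [(0, y)] is either such a man or already shifted. *)
Lemma sel_exists x : x < T -> exists y, [/\ y < T, seg bd y = seg bd x & sel y].
Proof.
move=> xT; have [s [_ ss <-]] := seg_first xT.
have sT := start_lt ss; rewrite -/T in sT.
have ex : exists y, (s <= y) && ~~ mt (0, y.+1) (0, y).
  (* There is no man in column [T]. *)
  exists T.-1; apply/andP; split; first lia.
  by apply/negP => /mt_range [/=]; lia.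
case: (ex_minnP ex) => y /andP [sy ny] ymin.
have mtz z : s <= z < y -> mt (0, z.+1) (0, z).
  move=> hz; apply: contraT => h; have := ymin z; rewrite h; lia.
have yT : y < T.
  rewrite ltnNge; apply/negP => h.
  have hz : s <= T.-1 < y by have := start_lt ss; lia.
  by have [/= h1 _ _] := mt_range (mtz _ hz); lia.
exists y; split=> //.
  have : forall z, s <= z <= y -> seg bd z = seg bd s; last by apply; lia.
  elim=> [|z ih] hz; first by congr seg; lia.
  have [e|e] := eqVneq z.+1 s; first by rewrite e.
  rewrite segS ih; last lia.
  case sz: (start z.+1); last by rewrite addn0.
  have hz' : s <= z < y by lia.
  by have := mt_w (start_matched sz) (mtz z hz').
rewrite /sel ny andbT; apply/negP => h.
have [e|e] := eqVneq y s.
  by have := mt_w (start_matched ss) (w' := (0, s)); rewrite -e => /(_ h).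
have hz : s <= y.-1 < y by lia.
by have := mtz _ hz; rewrite prednK; [move=> /(mt_w h) [] | ]; lia.
Qed.

Let selL := [seq y <- iota 0 T | sel y].
Let B1 := [seq ((0, x), (0, x)) | x <- iota 0 T & start x].
Let B2 := [seq ((0, y.+1), (0, y)) | y <- iota 0 T & sel y && (y.+1 < T)].

Lemma B_uniq : uniq (B1 ++ B2).
Proof.
rewrite cat_uniq !map_inj_uniq ?filter_uniq ?iota_uniq //=; try by move=> ? ? [].
rewrite andbT; apply/hasPn => p /mapP [y _ ->]; apply/negP => /mapP [x _ []]; lia.
Qed.

Lemma B_blocks p : p \in B1 ++ B2 -> blocks_pair p.1 p.2.
Proof.
rewrite mem_cat => /orP [] /mapP [x]; rewrite mem_filter => /andP [h _] ->.
  exact: block_start.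
by move/andP: h => [h1 h2]; exact: block_sel.
Qed.

Lemma size_B1 : size B1 = nb.
Proof.
rewrite size_map size_filter /nb -[in RHS](mkseq_nth false bd) count_map.
by apply: eq_count.
Qed.

(** Only column [T.-1] can be selected without a blocking pair, there being no man to its right. *)
Lemma size_B2 : size selL <= (size B2).+1.
Proof.
rewrite size_map /selL.
have [n eT] : exists n, T = n.+1 by exists T.-1; rewrite prednK.
rewrite !size_filter eT -addn1 iotaD !count_cat /= add0n addn0.
have -> : count sel (iota 0 n) = count (fun y => sel y && (y.+1 < n.+1)) (iota 0 n).
  by apply: eq_in_count => y; rewrite mem_iota => h; rewrite /= ltnS (andP h).2 andbT.
by rewrite addn1; have := leq_b1 (sel n); lia.
Qed.

Lemma seg_selL : {subset iota 1 nb <= map (seg bd) selL}.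
Proof.
move=> j; rewrite mem_iota => hj; have [|x xT <-] := @seg_exists j; first lia.
have [y [yT <- sy]] := sel_exists xT.
by apply: map_f; rewrite mem_filter sy mem_iota.
Qed.

(** The [nb] pairs at the starts leave room for at most [nb - 1] further ones, hence for at most
    [nb] selected columns; each block has at least one. *)
Lemma size_selL : size selL = nb.
Proof.
have h1 : nb <= size selL.
  rewrite -(size_iota 1 nb) -(size_map (seg bd) selL).
  exact: uniq_leq_size (iota_uniq _ _) seg_selL.
have := few_blocking B_uniq B_blocks; rewrite size_cat size_B1.
by have := size_B2; have := leq_trans (seg_gt0 0) (seg_le bd 0); lia.
Qed.

(** The pairs already listed exhaust the budget, and all their men are at level 0. *)
Lemma no_block m w : 0 < m.1 -> ~ blocks_pair m w.
Proof.
move=> m0 hb; have := few_blocking (bl := (m, w) :: B1 ++ B2).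
rewrite cons_uniq B_uniq andbT.
have -> : (m, w) \notin B1 ++ B2.
  by rewrite mem_cat; apply/negP => /orP [] /mapP [x _ [e]]; rewrite e in m0.
rewrite [size _]/= size_cat size_B1 => /(_ isT).
have := size_B2; rewrite size_selL => h1 h2.
have : (nb + size B2).+1 <= (2 * nb).-1; last by lia.
by apply: h2 => p; rewrite inE => /predU1P [-> //|/B_blocks].
Qed.

Lemma sel_unique x y : x < T -> y < T -> sel x -> sel y -> seg bd x = seg bd y -> x = y.
Proof.
move=> xT yT sx sy exy.
have u : uniq (map (seg bd) selL).
  apply: (@leq_size_uniq _ (iota 1 nb)); [exact: iota_uniq|exact: seg_selL|].
  by rewrite size_map size_iota size_selL.
have inL z : z < T -> sel z -> z \in selL by move=> hz sz; rewrite mem_filter sz mem_iota.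
have := nth_index 0 (inL x xT sx); have := nth_index 0 (inL y yT sy).
move=> <- <-; congr nth; apply/eqP.
have hx := inL x xT sx; have hy := inL y yT sy.
rewrite -(nth_uniq 0 _ _ u) ?size_map ?index_mem //.
by rewrite !(nth_map 0) ?index_mem // !nth_index // exy.
Qed.

(** Otherwise the woman would be single and the first choice of the man below her, a blocking pair
    that [no_block] excludes. *)
Lemma vertical l x : l <= E.+1 -> x < T -> adj bd links (l.+1, x) (l, x) ->
  (forall m, mt m (l, x) -> m = (l.+1, x)) -> mt (l.+1, x) (l, x).
Proof.
move=> hl xT ha hm; apply: contraT => hn.
case: (@no_block (l.+1, x) (l, x)) => //; split=> // [w' h|m' h].
  have [_ _ h'] := mt_range h; apply: adj_top hl h' _ => e.
  by rewrite e in h; rewrite h in hn.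
by have e := hm _ h; rewrite e in h; rewrite h in hn.
Qed.

(* The token of column [x] has descended below level [l]. *)
Let V l x := mt (l.+1, x) (l, x).

(** Woman [(l.+1, x)] has lost man [(l.+1, x)] upwards. Besides the man below, only the man of a
    link starting at [x] could take her, and he too is above if the token of his column has passed.
    The link of level [l.+1] has list index [l]. *)
Lemma V_down l x : l < E -> x < T -> V l x ->
  ((nth (0, 0) links l).1 = x -> V l (nth (0, 0) links l).2) -> V l.+1 x.
Proof.
move=> hl xT hV hp; apply: vertical => //; [lia | exact: adj_vert |] => m h.
have [_ mT /adj_wl []] := mt_range h; first lia.
- by move=> e; rewrite e in h; have [] := mt_w hV h; lia.
- by [].
case: m h mT => l' y /= h mT [e1 e2]; rewrite e1 {l' e1} in h *.
move: hp; rewrite e2 /= => /(_ erefl) hy.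
by have [] := mt_w hy h; lia.
Qed.

(** A bipartition of the blocks, links leading from one side to the other; it keeps a diverted token
    from being diverted again. *)
Variable tgt : pred nat.
Hypothesis tgt_links : forall p, p \in links -> ~~ tgt p.1 /\ tgt p.2.
Hypothesis tgt_seg : forall x y, seg bd x = seg bd y -> tgt x = tgt y.

Lemma link_at l : l < E -> nth (0, 0) links l \in links.
Proof. exact: mem_nth. Qed.

(** Man [(l.+1, x)] is not above, so the link woman [(l.+1, p)], further left than his own, is the
    best he can get; deserted by man [(l.+1, p)], she prefers him to the man below. Thus woman
    [(l.+1, x)] is deserted in turn, and the token moves from column [p] to column [x]. *)
Lemma V_divert l p x : l < E -> nth (0, 0) links l = (p, x) ->
  V l p -> ~~ V l x -> V l.+1 x.
Proof.
move=> hl el hVp nVx.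
have := link_at hl; rewrite el => hin; have /andP [px xT] := linksT hin; rewrite /= -/T in px xT.
have pT : p < T by lia.
have hpx : mt (l.+1, x) (l.+1, p).
  apply: contraT => hn; case: (@no_block (l.+1, x) (l.+1, p)) => //; split=> //.
  - by rewrite /adj /= -/E hl el !eqxx !orbT.
  - case=> l' y h; have [_ _] := mt_range h; rewrite /adj /= -/E hl el /lex /=.
    case/orP; last first.
      by move=> /andP [/eqP e1 /eqP [e2]]; rewrite e1 e2 in h; rewrite h in hn.
    move=> /andP [/eqP e1 /orP [] /eqP e2]; last by rewrite e2 -e1; lia.
    by case: e2 => e2; rewrite -e1 e2 in h; rewrite /V h in nVx.
  - move=> m h; have [_ _ /adj_wl []] := mt_range h; first lia.
    + by move=> e; rewrite e in h; have [] := mt_w hVp h; lia.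
    + by move=> ->; rewrite /lex /=; lia.
    case: m h => l' y /= h [e1]; rewrite el => -[e2].
    by rewrite e1 -e2 in h; rewrite h in hn.
apply: vertical => //; [lia | exact: adj_vert |] => m h.
have [_ _ /adj_wl []] := mt_range h; first lia.
- by move=> e; rewrite e in h; have [] := mt_w hpx h; lia.
- by [].
by rewrite el => -[_ [e _]]; lia.
Qed.

Lemma sel_V0 x : x < T -> sel x -> V 0 x.
Proof.
move=> xT /andP [n1 n2]; apply: vertical => //; first exact: adj_vert.
move=> m h; have [_ _ /adj_w0 []] := mt_range h => // e; rewrite e in h.
  by rewrite h in n1.
by rewrite h in n2.
Qed.

(* Tokens never leave the target segments. *)
Lemma V_tgt l l' x : x < T -> tgt x -> V l x -> l <= l' -> l' <= E -> V l' x.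
Proof.
move=> xT tx hV; elim: l' => [|l' ih]; first by rewrite leqn0 => /eqP <-.
rewrite leq_eqVlt => /predU1P [<- //|h1 h2].
apply: V_down => //; first by apply: ih; lia.
by move=> e; have [] := tgt_links (link_at h2); rewrite e tx.
Qed.

(** If man [(E.+2, y)] goes up, woman [(E.+2, y)] draws the next man, unless he has gone up himself;
    in either case his own woman is deserted. This propagates to the right end, where the starred
    woman would lose the only man she accepts. *)
Lemma no_sink y : y < T -> ~~ mt (E.+2, y) (E.+1, y).
Proof.
move=> yT; apply/negP => h.
have [n en] : exists n, T.-1 = y + n by exists (T.-1 - y); lia.
have : forall k, y + k < T -> exists2 w, mt (E.+2, y + k) w & w <> (E.+2, y + k).
  elim=> [|k ih] hk; first by exists (E.+1, y); rewrite addn0 //; case; lia.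
  have [|w hw nw] := ih; first lia.
  have nm : ~~ mt (E.+2, y + k) (E.+2, y + k) by apply/negP => /(mt_w hw).
  have [w' hw' nw'] : exists2 w', mt (E.+2, y + k.+1) w' & ~~ lex (E.+2, y + k) w'.
    case hm: (mt (E.+2, y + k.+1) (E.+2, y + k)).
      by exists (E.+2, y + k) => //; rewrite /lex /= !ltnn andbF.
    case ht: (mt (E.+2, y + k.+1) (E.+1, y + k.+1)).
      by exists (E.+1, y + k.+1) => //; rewrite /lex /=; lia.
    exfalso; apply: (@no_block (E.+2, y + k.+1) (E.+2, y + k)) => //; split=> //=; first lia.
    - by rewrite adj_S //= !eqxx addnS eqxx !orbT.
    - case=> l z h1; have [_ _] := mt_range h1; rewrite adj_S //= => /orP [/andP [/andP [/eqP e1 /eqP e2] _]|/andP [/eqP e1 /orP [] /eqP e2]].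
      + by rewrite -e2 e1 ht in h1.
      + by rewrite /lex /=; lia.
      + have e3 : z = y + k by lia.
        by rewrite e1 e3 hm in h1.
    - move=> m h1; have [_ _ /adj_wS []] := mt_range h1 => e; rewrite e in h1.
        by rewrite h1 in nm.
      by rewrite addnS h1 in hm.
  exists w' => // e; rewrite e /lex /= in nw'; lia.
move=> /(_ n); rewrite -en; case; first lia.
by move=> w /(mt_w sink_matched) <-.
Qed.

(** With two tokens [x < y], the men [(E.+1, x)] and [(E.+1, y)] have gone up. By [no_sink] the
    women of columns [x] to [y.-1] at level [E.+1] must live on the men of that level: the woman of
    column [x] takes the man of column [x.+1], and so on, until the last one needs the absent man
    [(E.+1, y)]. *)
Lemma V_inj x y : x < T -> y < T -> V E x -> V E y -> seg bd x = seg bd y -> x = y.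
Proof.
wlog xy : x y / x < y.
  move=> h xT yT hx hy e; case: (ltngtP x y) => // hxy; first exact: h.
  by apply/esym; apply: h.
move=> xT yT hx hy e; exfalso.
have hz z : x <= z < y -> ~~ seg_end bd z.
  move=> hz; rewrite /seg_end; apply/negP => se.
  have zs : start z.+1 by rewrite (set_nth_default true) //; rewrite -/T; lia.
  have := seg_start (leqnn z.+1) zs.
  have h1 : seg bd x <= seg bd z by apply: seg_mono; lia.
  have h2 : seg bd z.+1 <= seg bd y by apply: seg_mono; lia.
  lia.
have mz z : x <= z < y -> mt (E.+1, z) (E.+1, z) || mt (E.+1, z.+1) (E.+1, z).
  move=> hxz; have zT : z < T by lia.
  apply: contraT; rewrite negb_or => /andP [n1 n2].
  apply: contraNT (no_sink zT) => _; apply: vertical => //.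
    by rewrite adj_S //= !eqxx hz.
  move=> m h; have [_ _ /adj_wL [_ []]] := mt_range h => // em; rewrite em in h.
    by rewrite h in n1.
  by rewrite h in n2.
have : forall n, x + n < y -> mt (E.+1, (x + n).+1) (E.+1, x + n).
  elim=> [|n ih] hn.
    have := mz x; rewrite addn0 leqnn xy => /(_ isT) /orP [|//].
    by move=> /(mt_w hx) [] ; lia.
  have := mz (x + n.+1); rewrite hn leq_addr => /(_ isT) /orP [|//].
  rewrite addnS; have h : mt (E.+1, (x + n).+1) (E.+1, x + n) by apply: ih; lia.
  by move=> /(mt_w h) []; lia.
move=> /(_ (y - x).-1); have -> : x + (y - x).-1 = y.-1 by lia.
rewrite prednK; last lia.
by move=> /(_ (leqnn y)) /(mt_w hy) []; lia.
Qed.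

(** For closure under links: a token at the bottom of a target column comes from the selected column
    of its block, because the token of the selected column gets there as well and [V_inj] leaves
    room for one. *)
Lemma gadget_sound : exists sel', selection sel'.
Proof.
exists sel; split=> [x xT|x y xT yT sx sy|p hp sp].
- exact: sel_exists.
- exact: sel_unique.
have [ntp tp] := tgt_links hp; have /andP [pp pT] := linksT hp; rewrite -/T in pT.
have p1T : p.1 < T by lia.
have VE x : x < T -> tgt x -> V E x -> sel x.
  move=> xT tx hx; have [z [zT sz hz]] := sel_exists xT.
  have -> // : x = z; apply: V_inj => //.
  by apply: (V_tgt (l := 0)) => //; [rewrite (tgt_seg sz) | exact: sel_V0].
have Vsel l x : x < T -> tgt x -> l <= E -> V l x -> sel x.
  by move=> xT tx hl hx; apply: VE => //; apply: V_tgt hx _ _.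
(* A diverted token would reach the bottom, making its column selected; but then this column had a
   token from the top, and there was no diversion. *)
have Vlink l q : l < E -> nth (0, 0) links l = q -> V l q.1 -> V l q.2.
  move=> hl eq hq; apply: contraT => nV.
  have qin : q \in links by rewrite -eq link_at.
  have /andP [_ qT] := linksT qin; have [_ tq] := tgt_links qin.
  have h1 : V l.+1 q.2.
    by apply: V_divert nV => //; [rewrite eq; case: (q) | exact: hq].
  have : sel q.2 by apply: Vsel h1.
  move=> /(sel_V0 qT) h0; rewrite (V_tgt _ _ h0) // in nV; lia.
have hV l : l <= E -> V l p.1.
  elim: l => [|l ih] hl; first exact: sel_V0.
  apply: V_down => //; first by apply: ih; lia.
  by move=> e; apply: Vlink => //; rewrite e; apply: ih; lia.
have hi : index p links < E by rewrite index_mem.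
apply: (Vsel (index p links)) => //; first exact: ltnW.
by apply: Vlink => //; [rewrite nth_index | apply: hV; exact: ltnW].
Qed.

End Soundness.

(** * From a selection to a matching within the budget *)

Section Completeness.
Variable sel : pred nat.
Hypothesis sel_sel : selection sel.

Let past x := has (fun y => sel y && (seg bd y == seg bd x)) (iota 0 x).

(** At level 0 the men up to the selected column move one column left, making up for the man taken
    by the starred woman. In the selected column everyone down to level [E.+1] moves up one level,
    and at level [E.+1] the men to its right move left to fill the place vacated. Level [E.+2] stays
    put. *)
Definition partner (m : nat * nat) : nat * nat :=
  let: (l, x) := m in
  if l == 0 then
    if start x then (E.+3, x) else if past x then (0, x) else (0, x.-1)
  else if l <= E then if sel x then (l.-1, x) else (l, x)
  else if l == E.+1 then
    if sel x then (E, x) else if past x then (E.+1, x.-1) else (E.+1, x)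
  else (l, x).

(** The inverse of [partner]; injectivity of the matching is read off [husbandP]. *)
Definition husband (w : nat * nat) : nat * nat :=
  let: (l, y) := w in
  if l == 0 then if sel y then (1, y) else if past y then (0, y) else (0, y.+1)
  else if l <= E then if sel y then (l.+1, y) else (l, y)
  else if l == E.+1 then if past y || sel y then (l, y.+1) else (l, y)
  else if l == E.+2 then (l, y) else (0, y).

Lemma pastP x : reflect (exists2 y, y < x & sel y /\ seg bd y = seg bd x) (past x).
Proof.
apply: (iffP hasP) => [[y]|[y yx [sy e]]].
  by rewrite mem_iota => h /andP [sy /eqP e]; exists y.
by exists y; rewrite ?mem_iota ?sy ?e /=.
Qed.

Lemma past_start x : past x -> ~~ start x.
Proof.
move=> /pastP [y yx [_ e]]; apply/negP => sx.
by have := seg_start yx sx; rewrite e ltnn.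
Qed.

Lemma past_sel x : x < T -> past x -> ~~ sel x.
Proof.
move=> xT /pastP [y yx [sy e]]; apply/negP => sx; case: sel_sel => _ h _.
by have := h y x (ltn_trans yx xT) xT sy sx e; lia.
Qed.

Lemma pastS x : ~~ start x.+1 -> past x.+1 = past x || sel x.
Proof.
move=> /negPf ns; have e : seg bd x.+1 = seg bd x by rewrite segS ns addn0.
have ei : iota 0 x.+1 = iota 0 x ++ [:: x] by rewrite -addn1 iotaD.
by rewrite /past ei has_cat /= e eqxx andbT orbF.
Qed.

Lemma past_end x : x < T -> seg_end bd x -> past x || sel x.
Proof.
move=> xT he; case: sel_sel => h _ _; have [y [yT e sy]] := h x xT.
case: (ltngtP y x) => [yx|xy|<-]; last by rewrite sy orbT.
  by apply/orP; left; apply/pastP; exists y.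
have sx : start x.+1 by rewrite (set_nth_default true) //; rewrite -/T; lia.
have := seg_start (leqnn x.+1) sx; have := seg_mono bd xy; lia.
Qed.

Lemma seg_endN x : x < T -> ~~ seg_end bd x -> ~~ start x.+1 /\ x.+1 < T.
Proof.
rewrite /seg_end => xT h; have h' : x.+1 < T.
  by rewrite ltnNge; apply/negP => /(nth_default true) e; rewrite e in h.
by rewrite (set_nth_default true).
Qed.

Lemma startN_end x : x < T -> ~~ start x -> exists2 y, x = y.+1 & ~~ seg_end bd y.
Proof.
case: x => [|x] xT h; first by rewrite start0 in h.
by exists x => //; rewrite /seg_end (set_nth_default false).
Qed.

Let mt m w := [&& m.1 <= E.+2, m.2 < T & partner m == w].

Lemma husbandP m w : mt m w -> husband w = m.
Proof.
case: m => l x /and3P [/= hl xT /eqP <-].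
case: eqP => [->|/eqP l0].
  case sx: (start x) => /=; first by do 3![case: ifP => [|_]; first lia].
  have [y ex hy] := startN_end xT (negbT sx); subst x.
  have := pastS (negbT sx); have := past_sel xT.
  case px: (past y.+1) => /= hs; first by rewrite px (negPf (hs isT)).
  by move=> /esym/norP [/negPf -> /negPf ->].
case: ifP => lE.
  case sx: (sel x) => /=; last by rewrite (negPf l0) lE sx.
  case: l l0 hl lE => // -[|l] _ hl lE /=; first by rewrite sx.
  by rewrite ltnW // sx.
case: ifP => [/eqP el|hE].
  subst l; case sx: (sel x).
    by rewrite /= sx leqnn; case: (E).
  case px: (past x).
    have [y ex hy] := startN_end xT (past_start px); subst x.
    have [ns _] := seg_endN (ltnW xT) hy.
    by move: px; rewrite pastS // => px; rewrite /= ltnn eqxx px.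
  by rewrite /= ltnn eqxx px sx.
have -> : l = E.+2 by lia.
by rewrite /= ltnNge ltnW //= gtn_eqF // eqxx.
Qed.

Lemma mt_adj m w : mt m w -> [/\ m.2 < T, w.2 < T & adj bd links m w].
Proof.
case: m => l x /and3P [/= hl xT /eqP <-]; split=> //.
  do ![case: ifP => ?] => //=; lia.
case: eqP => [->|/eqP l0].
  case sx: (start x); first by rewrite /adj /= -/E eqxx sx eqxx.
  have [y ex hy] := startN_end xT (negbT sx); rewrite ex.
  by case: ifP => _; rewrite /adj /= eqxx ?orbT.
have lgt : 0 < l by rewrite lt0n.
case: ifP => lE.
  case: ifP => _; rewrite adj_l /= ?lgt ?lE // !eqxx ?orbT //=.
  by rewrite prednK ?eqxx.
case: ifP => [/eqP ->|hE].
  rewrite adj_L //=; case sx: (sel x); first by rewrite !eqxx.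
  case px: (past x).
    have [y ex hy] := startN_end xT (past_start px).
    by rewrite ex /= !eqxx hy !orbT.
  rewrite !eqxx /=; apply/orP; right; apply/negP => he.
  by have := past_end xT he; rewrite px sx.
have -> : l = E.+2 by lia.
by rewrite adj_S //= !eqxx !orbT.
Qed.

Lemma mt_starred w : w.2 < T -> starred bd links w -> exists m, mt m w.
Proof.
case: w => l y /= yT; rewrite /starred /= -/E -/T.
case/orP => /andP [/eqP -> h]; [exists (0, y) | exists (E.+2, y)].
  by rewrite /mt /= yT h eqxx.
by rewrite /mt /= yT leqnn ltnNge ltnW //= gtn_eqF // eqxx.
Qed.

(* Unselected columns leave the women above the capacity level with upper men. *)
Lemma unselected l x : l <= E -> x < T -> ~~ sel x ->
  exists2 m, mt m (l, x) & m.1 <= l /\ (0 < l -> m = (l, x)).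
Proof.
move=> hl xT ns; case: l hl => [|l] hl.
  case px: (past x).
    exists (0, x); rewrite //= /mt /= xT px ifN ?eqxx //; exact: past_start.
  have [s1 s2] : ~~ start x.+1 /\ x.+1 < T.
    by apply: seg_endN => //; apply/negP => /(past_end xT); rewrite px (negPf ns).
  exists (0, x.+1); rewrite //= /mt /= s2 (negPf s1) pastS // px (negPf ns) /=.
  by rewrite eqxx.
by exists (l.+1, x); rewrite //= /mt /= xT hl (negPf ns) eqxx; lia.
Qed.

Lemma lexS l x l' y : l' <= l -> lex (l.+1, x) (l', y) = false.
Proof. by rewrite /lex /=; lia. Qed.

Let bl := [seq ((0, x), (0, x)) | x <- iota 0 T & start x] ++
  [seq ((0, y.+1), (0, y)) | y <- iota 0 T & sel y && (y.+1 < T)].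

Lemma blocking_listed m w : blocking_names mt m w -> (m, w) \in bl.
Proof.
case: m => l x; case: w => l' y [/= xT yT ha hm hw].
have in_range : l <= E.+2.
  move: ha; rewrite /adj /= -/E; do ![case: ifP => ?]; lia.
have hf : lex (l', y) (partner (l, x)).
  by apply: hm; apply/and3P; split.
move: hf.
case: (posnP l) => [l0|l0].
  subst l.
  have inB1 : start x -> y = x -> ((0, x), (0, y)) \in bl.
    move=> sx ->; rewrite mem_cat; apply/orP; left; apply/mapP; exists x => //.
    by rewrite mem_filter sx mem_iota.
  have inB2 : sel y -> x = y.+1 -> ((0, x), (0, y)) \in bl.
    move=> sy ex; rewrite mem_cat; apply/orP; right; apply/mapP; exists y; rewrite -?ex //.
    by rewrite mem_filter sy -ex xT mem_iota yT.
  have noP : past y -> x = y.+1 -> l' = 0 -> False.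
    move=> py ex l0; have := hw (0, y); rewrite ex l0 /lex /= /mt /= yT py ifN ?past_start //.
    by rewrite eqxx => /(_ isT); lia.
  move: ha; rewrite /adj /= -/E => /orP [/andP [/eqP e1 /orP [] /eqP e2]|].
  - subst l' y.
    case: ifP => sx; first by move=> _; apply: inB1.
    by case: ifP => _; rewrite /lex /=; lia.
  - subst l'.
    case sy: (sel y); first by move=> _; apply: inB2.
    case: ifP => sx.
      have : past y || sel y by apply: past_end => //; rewrite /seg_end -e2 (set_nth_default false).
      by rewrite sy orbF => py; case: noP.
    rewrite e2; rewrite e2 in sx; rewrite (pastS (negbT sx)) sy orbF.
    by case: ifP => py; [case: noP | rewrite /lex /=; lia].
  by move=> /andP [/andP [/eqP -> /eqP ->] sx]; rewrite sx /lex /=; lia.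
rewrite /partner gtn_eqF //.
(* An unselected column has no token, so the woman above is with a man of her level or higher and
   does not want the man below. *)
have up : ~~ sel x -> y = x -> l = l'.+1 -> l' <= E -> False.
  move=> ns ey el hl; have [m h1 [h2 _]] := unselected hl xT ns.
  have := hw m; rewrite ey => /(_ h1); rewrite el; case: m h1 h2 => a b _ /= h2.
  by rewrite lexS.
case: ifP => lE.
  move: ha; rewrite adj_l /= ?l0 //.
  case/orP => [/andP [/eqP e1 /orP [] /eqP e2]|/andP [/eqP e1 /eqP e2]].
  - case: ifP => sx; first by rewrite /lex /=; lia.
    by move=> _; case: up; rewrite ?sx //; lia.
  - by case: ifP => _; rewrite /lex /=; lia.
  (* The man of a link is tempted only if [x] is unselected. Then so is [y], and woman [(l, y)] is
     with man [(l, y)], whom she prefers because [y < x]. *)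
  - have hin : (y, x) \in links by rewrite e2; apply: mem_nth; rewrite -/E; lia.
    have /andP [/= yx _] := linksT hin.
    case: ifP => sx; first by rewrite /lex /=; lia.
    move=> _; have ny : ~~ sel y.
      by apply/negP => sy; case: sel_sel => _ _ h; have := h _ hin sy; rewrite /= sx.
    have [m h1 [_ h2]] := unselected lE yT ny; rewrite h2 // in h1.
    by have := hw (l, y); rewrite e1 => /(_ h1); rewrite /lex /=; lia.
case: ifP => [/eqP el|hE].
  rewrite el in ha hw up *; move: ha; rewrite adj_L //=.
  case/orP => [/andP [/eqP e1 /eqP e2]|/andP [/andP [/eqP e1 h] he]].
    case sx: (sel x); first by rewrite /lex /=; lia.
    by move=> _; case: up; rewrite ?sx //; lia.
  case sx: (sel x); first by rewrite /lex /=; lia.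
  have [ns y1T] := seg_endN yT he.
  case/orP: h => /eqP ex; first by case: ifP; rewrite /lex /=; lia.
  have px := pastS ns; case: ifP => pe; first by rewrite /lex /=; lia.
  rewrite -ex pe in px; move/esym/norP: px => [py sy] _.
  have := hw (E.+1, y); rewrite e1 /mt /= yT (negPf py) (negPf sy) eqxx ltnn leqnSn /=.
  by move=> /(_ (eqxx _)); rewrite /lex /=; lia.
have el : l = E.+2 by lia.
rewrite el in ha hw *; move: ha; rewrite adj_S //=.
case/orP => [/andP [/andP [/eqP e1 /eqP e2] he]|/andP [/eqP e1 /orP [] /eqP e2]].
- move=> _; have [ns y1T] := seg_endN yT he.
  case hp: (past y || sel y).
    have hq : past y.+1 by rewrite pastS.
    have := hw (E.+1, y.+1); rewrite e1 /mt /= y1T (negPf (past_sel y1T hq)) hq eqxx ltnn leqnSn /=.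
    by move=> /(_ (eqxx _)); rewrite /lex /=; lia.
  move/norP: (negbT hp) => [py sy].
  have := hw (E.+1, y); rewrite e1 /mt /= yT (negPf py) (negPf sy) eqxx ltnn leqnSn /=.
  by move=> /(_ (eqxx _)); rewrite /lex /=; lia.
- by rewrite /lex /=; lia.
- move=> _; have := hw (E.+2, y); rewrite e1 /mt /= yT leqnn ltnNge ltnW //= gtn_eqF // eqxx.
  by move=> /(_ isT); rewrite /lex /=; lia.
Qed.

Lemma size_bl : size bl <= (2 * nb).-1.
Proof.
have sB1 : size [seq ((0, x), (0, x)) | x <- iota 0 T & start x] = nb.
  rewrite size_map size_filter /nb -[in RHS](mkseq_nth false bd) count_map.
  by apply: eq_count.
rewrite size_cat sB1 size_map.
(* The last block is the single column [T.-1]: it is selected but contributes nothing to the second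
   list, whence the [.-1] in the bound. *)
have hl : sel T.-1.
  case: sel_sel => h _ _; have [|y [yT e sy]] := h T.-1; first by lia.
  have [e'|ne] := eqVneq y T.-1; first by rewrite -e'.
  by have := @seg_start bd T.-1 y _ start_last; rewrite e; lia.
pose s := [seq y <- iota 0 T | sel y].
have u : uniq (map (seg bd) s).
  rewrite map_inj_in_uniq ?filter_uniq ?iota_uniq // => x y.
  rewrite !mem_filter !mem_iota => /andP [sx xT] /andP [sy yT].
  by case: sel_sel => _ h _; apply: h.
have hs : size s <= nb.
  rewrite -(size_map (seg bd)) -(size_iota 1 nb); apply: uniq_leq_size => // j /mapP [x _ ->].
  by rewrite mem_iota; have := seg_gt0 x; have := seg_le bd x; lia.
have : (size [seq y <- iota 0 T | sel y && (y.+1 < T)]).+1 <= size s; last by lia.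
have [n eT] : exists n, T = n.+1 by exists T.-1; rewrite prednK.
have ei : iota 0 T = iota 0 n ++ [:: n] by rewrite eT -addn1 iotaD.
have eF : (n.+1 < T) = false by lia.
rewrite eT /= in hl; rewrite /s !size_filter ei !count_cat /= hl eF andbF !addn0 addn1 ltnS.
by apply: sub_count => y /andP [].
Qed.

Lemma gadget_complete : exists mt' : nat * nat -> nat * nat -> bool,
  [/\ forall m w, mt' m w -> [/\ m.2 < T, w.2 < T & adj bd links m w],
      forall m w w', mt' m w -> mt' m w' -> w = w',
      forall m m' w, mt' m w -> mt' m' w -> m = m',
      forall w, w.2 < T -> starred bd links w -> exists m, mt' m w &
      exists bl : seq ((nat * nat) * (nat * nat)), size bl <= (2 * nb).-1 /\
        forall m w, blocking_names mt' m w -> (m, w) \in bl].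
Proof.
exists mt; split.
- exact: mt_adj.
- by move=> m w w' /and3P [_ _ /eqP <-] /and3P [_ _ /eqP <-].
- by move=> m m' w /husbandP <- /husbandP <-.
- exact: mt_starred.
- by exists bl; split; [exact: size_bl | exact: blocking_listed].
Qed.

End Completeness.
End Gadget.

(** * From trees to instances, and from ordinals to named persons *)

Lemma enc_nat_inj : injective (enc : nat -> tree).
Proof. by elim=> [|m ih] [|n] // [/ih ->]. Qed.

Lemma enc_seq_inj A {EA : Enc A} : injective (enc : A -> tree) -> injective (enc : seq A -> tree).
Proof. by move=> h; elim=> [|x s ih] [|y t] // [/h -> /ih ->]. Qed.

Lemma enc_pair_inj A B {EA : Enc A} {EB : Enc B} :
  injective (enc : A -> tree) -> injective (enc : B -> tree) -> injective (enc : A * B -> tree).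
Proof. by move=> hA hB [a b] [c d] [/hA -> /hB ->]. Qed.

Lemma enc_smc_data_inj : injective (enc : smc_data -> tree).
Proof.
by repeat first [exact: enc_nat_inj | apply: enc_pair_inj | apply: enc_seq_inj].
Qed.

(** Forgetting the ordinal types allows instances with different numbers of persons to be
    compared. *)
Definition data_of (m n : nat) (I : smc 'I_m 'I_n) (b : nat) : smc_data :=
  ([seq [seq val w | w <- prefM I x] | x <- enum 'I_m],
  ([seq [seq val x | x <- prefW I w] | w <- enum 'I_n],
  ([seq val x | x <- enum (starM I)], ([seq val w | w <- enum (starW I)], b)))).

Lemma enc_seq_map (A B : Type) (e : B -> tree) (f : A -> B) s :
  enc_seq (fun x => e (f x)) s = enc_seq e (map f s).
Proof. by elim: s => //= x s ->. Qed.

Lemma enc_smcE m n (I : smc 'I_m 'I_n) b : enc_smc I b = enc (data_of I b).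
Proof.
have h (k : nat) (s : seq 'I_k) : enc_seq (fun i : 'I_k => enc_nat i) s = enc [seq val x | x <- s].
  by rewrite (enc_seq_map enc_nat).
rewrite /enc_smc /data_of /enc /Enc_pair /= !h; congr Node.
  rewrite -[RHS](enc_seq_map (enc : seq nat -> tree)); elim: (enum _) => //= x s ->.
  by rewrite h.
congr Node; rewrite -[RHS](enc_seq_map (enc : seq nat -> tree)); elim: (enum _) => //= x s ->.
by rewrite h.
Qed.

Section Names.
Variable T : nat.
Hypothesis T0 : 0 < T.

Definition name (i : nat) : nat * nat := (i %/ T, i %% T).

Lemma name_inj : injective name.
Proof. by move=> i j [e1 e2]; rewrite (divn_eq i T) (divn_eq j T) e1 e2. Qed.

Lemma nameE l x : x < T -> name (l * T + x) = (l, x).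
Proof. by move=> h; rewrite /name divnMDl // modnMDl divn_small // addn0 modn_small. Qed.

Lemma lex_name i j : lex (name i) (name j) = (i < j).
Proof.
rewrite /lex /=; have ei := divn_eq i T; have ej := divn_eq j T.
have h1 := ltn_pmod i T0; have h2 := ltn_pmod j T0.
case: (ltngtP (i %/ T) (j %/ T)) => /= h.
- have : (i %/ T).+1 * T <= j %/ T * T by rewrite leq_mul2r h orbT.
  by rewrite mulSn; lia.
- have : (j %/ T).+1 * T <= i %/ T * T by rewrite leq_mul2r h orbT.
  by rewrite mulSn; lia.
- by rewrite h in ei; lia.
Qed.

Lemma namesE a : names a T = map name (iota 0 (a * T)).
Proof.
elim: a => [|a ih] //; rewrite /names -addn1 iotaD allpairs_cat -/(names a T) ih mulnDl mul1n iotaD map_cat.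
congr cat; rewrite /= cats0 add0n add0n -[a * T]addn0 iotaDl -map_comp.
by apply/eq_in_map => x; rewrite mem_iota => h; rewrite [RHS]nameE.
Qed.

Lemma size_names a : size (names a T) = a * T.
Proof. by rewrite namesE size_map size_iota. Qed.

Lemma nth_names a i : i < a * T -> nth (0, 0) (names a T) i = name i.
Proof. by move=> h; rewrite namesE (nth_map 0) ?size_iota // nth_iota. Qed.

End Names.

Section Increasing.
Variables (m n : nat) (I : smc 'I_m 'I_n).
Hypothesis sortM : forall x, sorted ltn [seq val w | w <- prefM I x].
Hypothesis sortW : forall w, sorted ltn [seq val x | x <- prefW I w].

Lemma index_increasing k (s : seq 'I_k) : sorted ltn (map val s) ->
  {in s &, forall x y, (index x s < index y s) = (x < y)}.
Proof.
move=> hs x y xs ys.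
have hlt (u v : 'I_k) : u \in s -> v \in s -> index u s < index v s -> u < v.
  move=> us vs h; apply: (@sorted_ltn_index _ ltn ltn_trans (map val s) hs); rewrite ?map_f //.
  by rewrite !index_map //; exact: val_inj.
case: (ltngtP (index x s) (index y s)) => h.
- by rewrite hlt.
- by have := hlt _ _ ys xs h; case: ltngtP.
- by have := nth_index x xs; rewrite h nth_index // => ->; rewrite ltnn.
Qed.

(** As all lists are increasing, preference among acceptable partners is the order of the
    ordinals. *)
Lemma blockingP (mu : {set 'I_m * 'I_n}) x w : matching I mu ->
  reflect [/\ acceptable I x w, forall w', (x, w') \in mu -> w < w' &
              forall x', (x', w) \in mu -> x < x'] (blocking I mu x w).
Proof.
move=> [hacc huniq]; apply: (iffP and3P) => [[h1 h2 h3]|[h1 h2 h3]]; split=> //.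
- move=> w' hw'; move: h2; rewrite /partnerM; case: pickP => [w2 hw2|/(_ w')]; last by rewrite hw'.
  have [->] := huniq _ _ hw' hw2 (or_introl erefl).
  rewrite /prefersM index_increasing //; first by case/andP: h1.
  by case/andP: (hacc _ hw2).
- move=> x' hx'; move: h3; rewrite /partnerW; case: pickP => [x2 hx2|/(_ x')]; last by rewrite hx'.
  have [->] := huniq _ _ hx' hx2 (or_intror erefl).
  rewrite /prefersW index_increasing //; first by case/andP: h1.
  by case/andP: (hacc _ hx2).
- rewrite /partnerM; case: pickP => // w' hw'.
  rewrite /prefersM index_increasing ?h2 //; first by case/andP: h1.
  by case/andP: (hacc _ hw').
- rewrite /partnerW; case: pickP => // x' hx'.
  rewrite /prefersW index_increasing ?h3 //; first by case/andP: h1.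
  by case/andP: (hacc _ hx').
Qed.

End Increasing.

Lemma adj_range bd links m w : adj bd links m w ->
  m.1 <= (size links).+2 /\ w.1 <= (size links).+3.
Proof.
case: m => l x; case: w => l' y; rewrite /adj /=; set E := size links.
by do ![case: ifP => ?]; lia.
Qed.

Section Lists.
Variables (bd : seq bool) (links : seq (nat * nat)).
Let E := size links.

(** Candidates containing every acceptable woman, which suffices for the length bound; entries may
    be repeated or unacceptable. *)
Definition men_list (m : nat * nat) : seq (nat * nat) :=
  let: (l, y) := m in
  if l == 0 then [:: (0, y); (0, y.-1); (E.+3, y)]
  else if l <= E then [:: (l.-1, y); (l, y); (l, (nth (0, 0) links l.-1).1)]
  else if l == E.+1 then [:: (E, y); (E.+1, y); (E.+1, y.-1)]
  else [:: (E.+1, y); (E.+2, y); (E.+2, y.-1)].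

Definition women_list (w : nat * nat) : seq (nat * nat) :=
  let: (l, y) := w in
  if l == 0 then [:: (0, y); (0, y.+1); (1, y)]
  else if l <= E then [:: (l, y); (l.+1, y); (l, (nth (0, 0) links l.-1).2)]
  else if l == E.+1 then [:: (E.+1, y); (E.+1, y.+1); (E.+2, y)]
  else [:: (l, y); (l, y.+1); (0, y)].

Lemma size_men_list m : size (men_list m) <= 3.
Proof. by case: m => l y; rewrite /=; do ![case: ifP]. Qed.

Lemma size_women_list w : size (women_list w) <= 3.
Proof. by case: w => l y; rewrite /=; do ![case: ifP]. Qed.

Lemma adj_man m w : adj bd links m w -> w \in men_list m.
Proof.
case: m => l x; case: w => l' y; rewrite /adj -/E [men_list _]/=.
have near : (x == y) || (x == y.+1) -> y = x \/ y = x.-1 by lia.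
case: ifP => _ /=.
  case/orP => [/andP [/eqP -> /near [] ->]|/andP [/andP [/eqP -> /eqP ->] _]];
    by rewrite !inE ?eqxx ?orbT.
case: ifP => _.
  case/orP => [/andP [/eqP -> /orP [] /eqP <-]|/andP [/eqP <- /eqP <-]];
    by rewrite !inE ?eqxx ?orbT.
case: ifP => _.
  case/orP => [/andP [/eqP -> /eqP ->]|/andP [/andP [/eqP -> /near [] ->] _]];
    by rewrite !inE ?eqxx ?orbT.
case/andP => _ /orP [/andP [/andP [/eqP -> /eqP ->] _]|/andP [/eqP -> /near [] ->]];
  by rewrite !inE ?eqxx ?orbT.
Qed.

Lemma adj_woman m w : adj bd links m w -> m \in women_list w.
Proof.
case: w => l y ha; rewrite /women_list; case: (posnP l) => [l0|l0].
  by move: ha; rewrite l0 => /adj_w0 [] ->; rewrite !inE ?eqxx ?orbT.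
rewrite /=; case lE: (l <= E).
  have hl : 0 < l <= size links by rewrite l0 lE.
  case: (adj_wl hl ha) => [->|->|]; try by rewrite !inE ?eqxx ?orbT.
  by case: m {ha} => l' x /= [-> ->]; rewrite !inE ?eqxx ?orbT.
case: (eqVneq l E.+1) => [el|nl].
  by move: ha; rewrite el => /adj_wL [_ [] ->]; rewrite !inE ?eqxx ?orbT.
have [_ hl] := adj_range ha; rewrite /= -/E in hl.
have [e|e] : l = E.+2 \/ l = E.+3 by lia.
  by move: ha; rewrite e => /adj_wS [] ->; rewrite !inE ?eqxx ?orbT.
by move: ha; rewrite e => /adj_wstar [-> _]; rewrite !inE ?eqxx ?orbT.
Qed.

End Lists.

(** * The gadget as an instance of SMC-1 *)

Section Instance.
Variables (bd : seq bool) (links : seq (nat * nat)).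
Let T := size bd.
Let E := size links.
Let nb := count id bd.
Hypothesis T0 : 0 < T.
Notation start x := (nth false bd x).
Hypothesis start0 : start 0.
Hypothesis start_last : start T.-1.
Hypothesis linksT : forall p, p \in links -> p.1 < p.2 < T.

Let nm := E.+3 * T.
Let nw := E.+4 * T.
Notation N := (name T).

Definition gadget_men (x : 'I_nm) : seq 'I_nw := [seq w : 'I_nw <- enum 'I_nw | adj bd links (N x) (N w)].
Definition gadget_women (w : 'I_nw) : seq 'I_nm := [seq x : 'I_nm <- enum 'I_nm | adj bd links (N x) (N w)].

Definition gadget_smc : smc 'I_nm 'I_nw :=
  SMC set0 [set w : 'I_nw | starred bd links (N w)]
    (fun x => filter_uniq _ (enum_uniq _) : uniq (gadget_men x))
    (fun w => filter_uniq _ (enum_uniq _) : uniq (gadget_women w)).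

Lemma val_filter_enum k (p : pred nat) :
  [seq val i | i <- [seq i : 'I_k <- enum 'I_k | p i]] = [seq i <- iota 0 k | p i].
Proof. by rewrite -[in RHS]val_enum_ord filter_map. Qed.

Lemma data_gadget_smc b : data_of gadget_smc b = gadget bd links b.
Proof.
rewrite /data_of /gadget -/E -/T !size_names //; congr (_, (_, (_, (_, _)))).
- rewrite -/nm -/nw -[iota 0 nm]val_enum_ord -map_comp; apply: eq_map => x /=.
  rewrite /gadget_men (val_filter_enum nw (fun w => adj bd links (N x) (N w))).
  by apply: eq_in_filter => w; rewrite mem_iota => hw; rewrite !nth_names.
- rewrite -/nm -/nw -[iota 0 nw]val_enum_ord -map_comp; apply: eq_map => w /=.
  rewrite /gadget_women (val_filter_enum nm (fun x => adj bd links (N x) (N w))).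
  by apply: eq_in_filter => x; rewrite mem_iota => hx; rewrite !nth_names.
- by rewrite enum_set0.
- rewrite -/nw -(val_filter_enum nw (fun w => starred bd links (nth (0, 0) (names E.+4 T) w))).
  congr map; rewrite enumT /enum_mem -enumT; apply: eq_filter => w.
  by rewrite /= inE nth_names.
Qed.

Lemma size_filter_names k (p : pred (nat * nat)) (s : seq (nat * nat)) :
  (forall i, i < k -> p (N i) -> N i \in s) ->
  size [seq i : 'I_k <- enum 'I_k | p (N i)] <= size s.
Proof.
move=> h; rewrite -(size_map (fun i : 'I_k => N i)); apply: uniq_leq_size.
  rewrite map_inj_uniq; first exact: filter_uniq (enum_uniq _).
  by move=> i j e; apply: val_inj; apply: name_inj e.
by move=> q /mapP [i]; rewrite mem_filter => /andP [hp _] ->; apply: h.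
Qed.

Lemma gadget_restricted : restricted gadget_smc.
Proof.
split.
- exists (enum 'I_nm); split; [exact: enum_uniq | by move=> x; rewrite mem_enum |].
  move=> w; rewrite /= {1}/gadget_women; apply: eq_in_filter => x _.
  by rewrite mem_filter mem_enum andbT.
- exists (enum 'I_nw); split; [exact: enum_uniq | by move=> x; rewrite mem_enum |].
  move=> x; rewrite /= {1}/gadget_men; apply: eq_in_filter => w _.
  by rewrite mem_filter mem_enum andbT.
- move=> x; apply: leq_trans _ (size_men_list links (N x)).
  by apply: (size_filter_names (p := adj bd links (N x))) => i _; exact: adj_man.
- move=> w; apply: leq_trans _ (size_women_list links (N w)).
  by apply: (size_filter_names (p := fun m => adj bd links m (N w))) => i _; exact: adj_woman.
- move=> w; rewrite inE => hw; apply/eqP; rewrite eqn_leq; apply/andP; split.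
    case e : (N w) hw => [l y]; rewrite /starred /= -/E -/T.
    case/orP => /andP [/eqP el hy].
      apply: leq_trans (size_filter_names (p := fun m => adj bd links m (N w)) (s := [:: (0, y)]) _) _ => // i _.
      by rewrite e el => /adj_wstar [-> _]; rewrite inE.
    apply: leq_trans (size_filter_names (p := fun m => adj bd links m (N w)) (s := [:: (E.+2, y)]) _) _ => // i _.
    rewrite e el => /adj_wS [] ei; rewrite ei ?inE //.
    (* The second candidate of the starred woman at the end of level [E.+2] would be in column [T],
       which does not exist. *)
    have : (N i).2 < T by rewrite ltn_pmod.
    by rewrite ei /= -(eqP hy) ltnn.
  have hN : forall x l y, l < E.+3 -> y < T -> N x = (l, y) -> x < nm.
    move=> x l y hl hy [e1 e2]; rewrite (divn_eq x T) e1 e2.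
    by apply: leq_trans (_ : l.+1 * T <= _); [rewrite mulSn; lia | rewrite leq_mul2r hl orbT].
  have hex l y : l < E.+3 -> y < T -> adj bd links (l, y) (N w) ->
      0 < size (gadget_women w).
    move=> hl hy ha; have hx := hN (l * T + y) l y hl hy (nameE T0 l hy).
    rewrite -has_predT; apply/hasP; exists (Ordinal hx) => //.
    by rewrite mem_filter mem_enum andbT /= nameE.
  case e : (N w) hw => [l y]; rewrite /starred /= -/E -/T.
  have yT : y < T by have := ltn_pmod w T0; case: e => _ ->.
  case/orP => /andP [/eqP el hy].
    by apply: (hex 0 y) => //; rewrite e el /adj /= -/E !eqxx.
  apply: (hex E.+2 y) => //; rewrite e el adj_S //= !eqxx ?orbT //.
Qed.

(** A tree determines the preference functions only pointwise, so an instance behind it is compared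
    with [gadget_smc] extensionally, not as a record. *)
Lemma gadget_smc_eq (I : smc 'I_nm 'I_nw) b b' : data_of I b = gadget bd links b' ->
  [/\ prefM I =1 gadget_men, prefW I =1 gadget_women,
      starW I = starW gadget_smc & b = b'].
Proof.
rewrite -data_gadget_smc => -[e1 e2 _ e4 e5]; split=> //.
- move=> x; apply: (inj_map val_inj).
  by move/eq_in_map: e1 => /(_ x (mem_enum _ _)).
- move=> w; apply: (inj_map val_inj).
  by move/eq_in_map: e2 => /(_ w (mem_enum _ _)).
- apply/setP => w; rewrite -[w \in starW I]mem_enum.
  by rewrite (inj_map val_inj e4) mem_enum.
Qed.

Lemma card_starW : #|starW gadget_smc| = nb.+1.
Proof.
rewrite cardE -(size_map (fun w : 'I_nw => N w)).
pose s := [seq (E.+3, y) | y <- iota 0 T & start y] ++ [:: (E.+2, T.-1)].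
have -> : nb.+1 = size s.
  rewrite size_cat size_map addn1 size_filter /nb -[in LHS](mkseq_nth false bd) count_map.
  by congr _.+1; apply: eq_count.
apply: perm_size; apply: uniq_perm.
- rewrite map_inj_uniq ?enum_uniq // => i j e; apply: val_inj; exact: name_inj e.
- rewrite cat_uniq map_inj_uniq ?filter_uniq ?iota_uniq //= => [|? ? [] //].
  rewrite orbF andbT; apply/negP => /mapP [y _ []]; lia.
have hname l y : l < E.+4 -> y < T -> exists2 w : 'I_nw, N w = (l, y) & True.
  move=> hl hy; have h : l * T + y < nw.
    by apply: leq_trans (_ : l.+1 * T <= _); [rewrite mulSn; lia | rewrite leq_mul2r hl orbT].
  by exists (Ordinal h) => //; rewrite nameE.
move=> q; apply/mapP/idP => [[w]|].
  rewrite mem_enum inE => h ->; have := ltn_pmod w T0; case e: (N w) h => [l y].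
  case: e => _ ey; rewrite -/(name T w) ey /starred /= -/E -/T => h yT.
  case/orP: h => /andP [/eqP -> h]; rewrite mem_cat; apply/orP; [left|right].
    by apply/mapP; exists y => //; rewrite mem_filter h mem_iota.
  by rewrite inE -(eqP h).
rewrite mem_cat => /orP [/mapP [y]|].
  rewrite mem_filter mem_iota => /andP [sy yT] ->; have [w ew _] := hname E.+3 y (leqnn _) yT.
  by exists w => //; rewrite mem_enum inE ew /starred /= eqxx sy.
rewrite inE => /eqP ->; have tT : T.-1 < T by lia.
have [w ew _] := hname E.+2 T.-1 (leqnSn _) tT.
by exists w => //; rewrite mem_enum inE ew /starred /= prednK // !eqxx orbT.
Qed.

Section Equivalence.
Variable I : smc 'I_nm 'I_nw.
Hypothesis prefMI : prefM I =1 gadget_men.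
Hypothesis prefWI : prefW I =1 gadget_women.
Hypothesis starWI : starW I = starW gadget_smc.
Hypothesis starMI : starM I = set0.

Lemma sorted_filter_enum k (p : pred nat) :
  sorted ltn [seq val i | i <- [seq i : 'I_k <- enum 'I_k | p i]].
Proof. by rewrite val_filter_enum sorted_filter ?iota_ltn_sorted //; exact: ltn_trans. Qed.

Lemma sorted_prefM x : sorted ltn [seq val w | w <- prefM I x].
Proof. by rewrite prefMI (sorted_filter_enum nw (fun w => adj bd links (N x) (N w))). Qed.

Lemma sorted_prefW w : sorted ltn [seq val x | x <- prefW I w].
Proof. by rewrite prefWI (sorted_filter_enum nm (fun x => adj bd links (N x) (N w))). Qed.

Lemma acceptableE x w : acceptable I x w = adj bd links (N x) (N w).
Proof. by rewrite /acceptable prefMI prefWI mem_filter mem_enum mem_filter mem_enum !andbT andbb. Qed.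

Lemma man_named m : m.1 < E.+3 -> m.2 < T -> exists x : 'I_nm, N x = m.
Proof.
case: m => l y /= hl hy; have h : l * T + y < nm.
  by apply: leq_trans (_ : l.+1 * T <= _); [rewrite mulSn; lia | rewrite leq_mul2r hl orbT].
by exists (Ordinal h) => //; rewrite nameE.
Qed.

Lemma woman_named w : w.1 < E.+4 -> w.2 < T -> exists x : 'I_nw, N x = w.
Proof.
case: w => l y /= hl hy; have h : l * T + y < nw.
  by apply: leq_trans (_ : l.+1 * T <= _); [rewrite mulSn; lia | rewrite leq_mul2r hl orbT].
by exists (Ordinal h) => //; rewrite nameE.
Qed.

Lemma name_pair_inj : injective (fun p : 'I_nm * 'I_nw => (N p.1, N p.2)).
Proof.
by move=> [x w] [x' w'] /= [e1 e2 e3 e4]; congr pair; apply: val_inj; apply: (@name_inj T);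
   rewrite /name ?e1 ?e2 ?e3 ?e4.
Qed.

Lemma name_lt i : (N i).2 < T. Proof. exact: ltn_pmod. Qed.

Lemma selection_of_matching (tgt : pred nat) (mu : {set 'I_nm * 'I_nw}) :
  (forall p, p \in links -> ~~ tgt p.1 /\ tgt p.2) ->
  (forall x y, seg bd x = seg bd y -> tgt x = tgt y) ->
  feasible I mu -> #|blocking_pairs I mu| <= (2 * nb).-1 ->
  exists sel, selection bd links sel.
Proof.
move=> tgt1 tgt2 [hm _ hw] hb; have [hacc huniq] := hm.
pose mt (m w : nat * nat) := [exists p : 'I_nm * 'I_nw, (p \in mu) && ((N p.1, N p.2) == (m, w))].
have mtP m w : reflect (exists2 p : 'I_nm * 'I_nw, p \in mu & N p.1 = m /\ N p.2 = w) (mt m w).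
  apply: (iffP existsP) => [[p /andP [h /eqP [<- <-]]]|[p h [<- <-]]]; exists p => //.
  by rewrite h eqxx.
have Ninj (k : nat) (i j : 'I_k) : N i = N j -> i = j by move=> e; apply: val_inj; apply: name_inj e.
apply: (gadget_sound T0 start0 start_last linksT (mt := mt) _ _ _ _ tgt1 tgt2).
- move=> m w /mtP [p hp [<- <-]]; split; try exact: name_lt.
  by rewrite -acceptableE; exact: hacc.
- move=> m w w' /mtP [p hp [<- <-]] /mtP [q hq [e <-]].
  by rewrite (huniq p q) //; left; apply: Ninj.
- move=> w wT ws; have hw3 : w.1 < E.+4 by move: ws; rewrite /starred -/E; lia.
  have [j ej] := woman_named hw3 wT.
  have := hw j; rewrite starWI inE ej => /(_ ws).
  rewrite /partnerW; case: pickP => // x hx _; exists (N x); apply/mtP.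
  by exists (x, j).
move=> bl ubl hbl; apply: leq_trans hb.
rewrite cardE -(size_map (fun p : 'I_nm * 'I_nw => (N p.1, N p.2))).
apply: uniq_leq_size => // -[m w] hin; have [/= h1 h2 h3 h4 h5] := hbl _ hin.
have [r1 r2] := adj_range h3; have [x ex] := man_named r1 h1; have [j ej] := woman_named r2 h2.
apply/mapP; exists (x, j); last by rewrite /= ex ej.
have -> : ((x, j) \in enum (blocking_pairs I mu)) = blocking I mu x j by rewrite mem_enum inE.
apply/(blockingP sorted_prefM sorted_prefW _ _ hm); split.
- by rewrite acceptableE ex ej.
- move=> w' hw'; rewrite -(lex_name T0) ej; apply: h4; apply/mtP.
  by exists (x, w').
- move=> x' hx'; rewrite -(lex_name T0) ex; apply: h5; apply/mtP.
  by exists (x', j).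
Qed.

Lemma matching_of_selection sel : selection bd links sel ->
  exists2 mu, feasible I mu & #|blocking_pairs I mu| <= (2 * nb).-1.
Proof.
move=> hs; have [mt [m1 m2 m3 m4 [bl [sbl hbl]]]] := gadget_complete T0 start0 start_last linksT hs.
have Ninj (k : nat) (i j : 'I_k) : N i = N j -> i = j by move=> e; apply: val_inj; apply: name_inj e.
pose mu := [set p : 'I_nm * 'I_nw | mt (N p.1) (N p.2)].
have hm : matching I mu.
  split=> [p|p q]; rewrite !inE.
    by move=> /m1 [_ _ h]; rewrite acceptableE.
  case: p q => [x w] [x' w'] /= h h' [e|e]; rewrite e in h *.
    by congr pair; apply: Ninj; exact: m2 h h'.
  by congr pair; apply: Ninj; exact: m3 h h'.
have man_ex m w : mt m w -> exists x : 'I_nm, N x = m.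
  by move=> /m1 [h1 _ /adj_range [r _]]; exact: man_named.
exists mu.
  split=> // [x|w]; first by rewrite starMI inE.
  rewrite starWI inE => ws; have [m hmw] := m4 _ (name_lt w) ws.
  have [x ex] := man_ex _ _ hmw; rewrite /partnerW; case: pickP => // /(_ x).
  by rewrite inE /= ex hmw.
apply: leq_trans sbl; rewrite cardE -(size_map (fun p : 'I_nm * 'I_nw => (N p.1, N p.2))).
apply: uniq_leq_size; first by rewrite (map_inj_uniq name_pair_inj) enum_uniq.
move=> q /mapP [[x w]].
have -> : ((x, w) \in enum (blocking_pairs I mu)) = blocking I mu x w by rewrite mem_enum inE.
move=> /(blockingP sorted_prefM sorted_prefW _ _ hm).
move=> [h1 h2 h3] ->; apply: hbl; split; try exact: name_lt.
- by rewrite -acceptableE.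
- move=> w' hw'; have [_ wT /adj_range [_ r]] := m1 _ _ hw'.
  have [j ej] := woman_named r wT; rewrite -ej lex_name //; apply: h2.
  by rewrite inE /= ej.
- move=> m hm'; have [x' ex'] := man_ex _ _ hm'; rewrite -ex' lex_name //; apply: h3.
  by rewrite inE /= ex'.
Qed.

End Equivalence.

Lemma SMC1_gadget (tgt : pred nat) :
  (forall p, p \in links -> ~~ tgt p.1 /\ tgt p.2) ->
  (forall x y, seg bd x = seg bd y -> tgt x = tgt y) ->
  SMC1 (enc (gadget bd links (2 * nb).-1)) (3 * nb) <-> exists sel, selection bd links sel.
Proof.
move=> tgt1 tgt2; have nb0 : 0 < nb by rewrite -has_count; apply/(has_nthP false); exists 0.
split=> [[m [n [I [b [e _ sM [mu hmu hb]]]]]]|[sel hs]].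
  rewrite enc_smcE in e; move/enc_smc_data_inj: e => e.
  have em : m = nm.
    have := congr1 (fun d => size d.1) e; rewrite /data_of /gadget /= !size_map -?enumT ?size_enum_ord size_iota -?enumT ?size_enum_ord.
    by rewrite size_names.
  have en : n = nw.
    have := congr1 (fun d => size d.2.1) e; rewrite /data_of /gadget /= !size_map -?enumT ?size_enum_ord size_iota -?enumT ?size_enum_ord.
    by rewrite size_names.
  subst m n; have [h1 h2 h3 h4] := gadget_smc_eq (esym e).
  by apply: (selection_of_matching h1 h2 h3 tgt1 tgt2 hmu); rewrite -h4.
have [mu hmu hb] := matching_of_selection (I := gadget_smc) (fun _ => erefl) (fun _ => erefl) erefl erefl hs.
exists nm, nw, gadget_smc, (2 * nb).-1; rewrite enc_smcE data_gadget_smc card_starW; split=> //.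
- by lia.
- by exists mu.
Qed.

Lemma SMC1_restricted_gadget :
  SMC1_restricted (enc (gadget bd links (2 * nb).-1)) (3 * nb).
Proof.
have nb0 : 0 < nb by rewrite -has_count; apply/(has_nthP false); exists 0.
exists nm, nw, gadget_smc, (2 * nb).-1; rewrite enc_smcE data_gadget_smc card_starW; split=> //.
- by lia.
- exact: gadget_restricted.
Qed.

End Instance.

(** * Blocks of options and implications *)

(* A gap is [(i, (a, b))]: the [i]-th gap, between the consecutive ones [a] and
   [b], where input node [v] has position [v.+1] and the positions 0 and
   [cinputs c + 1] count as ones.  An option is a partial assignment of values to
   variables: variable 0 is a flag, 1 is [beta] and [i.+2] is the [i]-th gap. *)
Notation value := (seq (nat * nat)).
Notation opt := (seq (nat * value)).
Notation gap := (nat * (nat * nat))%type.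

Fixpoint tuples (A : Type) (n : nat) (s : seq A) : seq (seq A) :=
  if n is n'.+1 then [seq x :: t | x <- s, t <- tuples n' s] else [:: [::]].

(** One block for each [n]-tuple of gap indices, repetitions allowed. A repeated index may receive
    different gaps within an entry; the links to the block of that variable exclude such entries. *)
Fixpoint gap_blocks (n : nat) (idx : seq nat) (gv : seq (nat * nat)) : seq (seq (seq gap)) :=
  if n is n'.+1 then
    [seq [seq (i, g) :: P | g <- gv, P <- blk] | i <- idx, blk <- gap_blocks n' idx gv]
  else [:: [:: [::]]].

(* The pair (may be true, may be false), given the gaps [P]. *)
Definition unrefuted_input (P : seq gap) (v : nat) : bool * bool :=
  (~~ has (fun g : gap => (g.2.1 < v.+1) && (v.+1 < g.2.2)) P,
   ~~ has (fun g : gap => g.2.1 == v.+1) P).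

(** [size vs] is the number of the gate being evaluated. An and-gate may be false only through a
    picked argument, which means any argument of a small gate but only a guessed one of a large
    gate; dually for or-gates. So few arguments suffice for a refutation. *)
Definition unrefuted_gate (beta : value) (vs : seq (bool * bool)) (g : gate) : bool * bool :=
  let T i := (nth (true, true) vs i).1 in
  let F i := (nth (true, true) vs i).2 in
  let pick s i := (size s <= 2) || ((size vs, i) \in beta) in
  match g with
  | GNot i => (F i, T i)
  | GAnd s => (all T s, has (fun i => pick s i && F i) s)
  | GOr s => (has (fun i => pick s i && T i) s, all F s)
  end.

Definition unrefuted (c : circuit) (beta : value) (P : seq gap) : seq (bool * bool) :=
  node_values [seq unrefuted_input P v | v <- iota 0 (cinputs c)] (unrefuted_gate beta) (cgates c).

Definition gaps_ok (k n : nat) (P : seq gap) : bool :=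
  all (fun g : gap => [&& g.2.1 < g.2.2, g.2.2 <= n.+1, (g.1 == 0) ==> (g.2.1 == 0)
        & (g.1 == k) ==> (g.2.2 == n.+1)]) P &&
  all (fun g : gap => all (fun g' : gap => (g'.1 == g.1.+1) ==> (g'.2.1 == g.2.2)) P) P.

Definition locally_ok (c : circuit) (k : nat) (beta : value) (P : seq gap) : bool :=
  gaps_ok k (cinputs c) P && (nth (true, true) (unrefuted c beta P) (coutput c)).1.

Definition gap_values (c : circuit) : seq (nat * nat) :=
  [seq (a, b) | a <- iota 0 (cinputs c).+2, b <- iota 0 (cinputs c).+2].

(** The [.+1] makes [(0, 0)] available as padding even for a circuit without nodes, so that no block
    is empty. *)
Definition betas (r : nat) (c : circuit) : seq value :=
  let N := (cinputs c + size (cgates c)).+1 in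
  tuples r [seq (g, i) | g <- iota 0 N, i <- iota 0 N].

Definition good : value := [:: (0, 0)].

(** [ok] tells whether the input is valid. If not, every tuple fails its test, which gives a
    no-instance of the restricted form. *)
Definition local_option (ok : bool) (c : circuit) (k : nat) (beta : value) (P : seq gap) : opt :=
  (0, if ok && locally_ok c k beta P then good else [::]) :: (1, beta) ::
  [seq (g.1.+2, [:: g.2]) | g : gap <- P].

(* Tuples failing the test assign [[::]] to the flag, which the first block forces
   to be [good]; its option has two bindings because options with exactly one are
   the targets of links.  The last block is a single column, as the gadget
   requires. *)
Definition blocks (q r : nat) (ok : bool) (c : circuit) (k : nat) : seq (seq opt) :=
  [:: [:: [:: (0, good); (0, good)]]] ++
  [seq [seq local_option ok c k beta P | beta <- betas r c, P <- blk]
     | blk <- gap_blocks q (iota 0 k.+1) (gap_values c)] ++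
  [seq [seq [:: (i.+2, [:: g])] | g <- gap_values c] | i <- iota 0 k.+1] ++
  [:: [seq [:: (1, beta)] | beta <- betas r c];
      [:: [:: (0, [::])]; [:: (0, good)]];
      [:: [::]] ].

Definition link (o1 o2 : opt) : bool :=
  [&& size o2 == 1, size o1 != 1 & head (0, [::]) o2 \in o1].

Definition links_of (opts : seq opt) : seq (nat * nat) :=
  [seq p <- [seq (y, x) | y <- iota 0 (size opts), x <- iota 0 (size opts)]
    | (p.1 < p.2) && link (nth [::] opts p.1) (nth [::] opts p.2)].

Definition block_starts (A : Type) (bs : seq (seq A)) : seq bool :=
  flatten [seq true :: [seq false | _ <- behead b] | b <- bs].

Definition smc_of_blocks (bs : seq (seq opt)) : smc_data :=
  gadget (block_starts bs) (links_of (flatten bs)) (2 * size bs).-1.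

Lemma node_values_rcons (W : Type) inp (f : seq W -> gate -> W) gs g :
  node_values inp f (rcons gs g) =
  rcons (node_values inp f gs) (f (node_values inp f gs) g).
Proof. by rewrite /node_values -cats1 foldl_cat. Qed.

Lemma size_node_values (W : Type) inp (f : seq W -> gate -> W) gs :
  size (node_values inp f gs) = size inp + size gs.
Proof.
elim/last_ind: gs => [|gs g ih]; first by rewrite addn0.
by rewrite node_values_rcons !size_rcons ih addnS.
Qed.

(** * Columns as positions in the concatenated blocks *)

Section Blocks.
Variables (A : eqType) (x0 : A) (bs : seq (seq A)).
Hypothesis bs_ne : all (fun b => 0 < size b) bs.

Lemma size_block_starts : size (block_starts bs) = size (flatten bs).
Proof.
elim: bs bs_ne => //= b s ih /andP [hb hs]; rewrite !size_cat /= ih // size_map size_behead.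
by rewrite -addSn prednK.
Qed.

Lemma count_block_starts : count id (block_starts bs) = size bs.
Proof.
elim: bs => //= b s ih; rewrite count_cat -/(block_starts s) ih.
by rewrite (_ : count id _ = 0) //; elim: (behead b).
Qed.

Lemma reshape_index_cons n sh i : reshape_index (n :: sh) i =
  if i < n then 0 else (reshape_index sh (i - n)).+1.
Proof.
rewrite /reshape_index /= subn_eq0; case: ltnP => // h.
by rewrite subSn.
Qed.

Lemma seg_blocks x : x < size (flatten bs) ->
  seg (block_starts bs) x = (reshape_index (shape bs) x).+1.
Proof.
elim: bs bs_ne x => // b s ih /= /andP [hb hs] x.
rewrite size_cat /seg => hx.
have -> : block_starts (b :: s) = (true :: nseq (size b).-1 false) ++ block_starts s.
  rewrite /block_starts /=; congr (_ :: _ ++ _); rewrite -size_behead.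
  by elim: (behead b) => //= ? ? ->.
rewrite reshape_index_cons take_cat /= size_nseq prednK //.
case: (ltnP x.+1 (size b)) => h1.
  by rewrite ltnW //= take_nseq ?count_nseq //; lia.
rewrite [count _ _]/= count_cat count_nseq mul0n add0n add1n; congr _.+1.
case: (ltnP x (size b)) => h2.
  by rewrite (_ : x.+1 - size b = 0) ?take0 //; lia.
by rewrite subSn // -/(seg (block_starts s) _) ih //; lia.
Qed.

Definition pos i j := flatten_index (shape bs) i j.

Lemma posP i j : i < size bs -> j < size (nth [::] bs i) ->
  [/\ pos i j < size (flatten bs), seg (block_starts bs) (pos i j) = i.+1 &
      nth x0 (flatten bs) (pos i j) = nth x0 (nth [::] bs i) j].
Proof.
move=> hi hj; have hj' : j < nth 0 (shape bs) i by rewrite (nth_map [::]).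
have hp : pos i j < size (flatten bs) by rewrite size_flatten; exact: flatten_indexP.
split=> //; first by rewrite seg_blocks // flatten_indexKl.
by rewrite nth_flatten flatten_indexKl // flatten_indexKr.
Qed.

Lemma pos_of x : x < size (flatten bs) ->
  exists i j, [/\ i < size bs, j < size (nth [::] bs i) & x = pos i j].
Proof.
move=> hx; have hs : x < sumn (shape bs) by rewrite -size_flatten.
exists (reshape_index (shape bs) x), (reshape_offset (shape bs) x).
have hi : reshape_index (shape bs) x < size bs by rewrite -(size_map size); exact: reshape_indexP.
split=> //; last by rewrite /pos reshape_indexK.
by have := reshape_offsetP hs; rewrite (nth_map [::]).
Qed.

Lemma block_start0 : 0 < size bs -> nth false (block_starts bs) 0.
Proof. by case: bs. Qed.

Lemma block_start_last : 0 < size bs -> size (last [::] bs) = 1 ->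
  nth false (block_starts bs) (size (block_starts bs)).-1.
Proof.
case/lastP: bs => // s b _; rewrite last_rcons => hb.
rewrite /block_starts map_rcons flatten_rcons size_cat nth_cat.
by case: b hb => [|a []] //= _; rewrite addn1 /= ltnn subnn.
Qed.

End Blocks.

Lemma tuplesP (A : eqType) n (s t : seq A) :
  (t \in tuples n s) = (size t == n) && all (mem s) t.
Proof.
elim: n t => [|n ih] [|x t] //=.
  by apply/allpairsP => -[[y u] /= [_ _]].
apply/allpairsP/andP => [[[y u] /= [hy hu [-> ->]]]|[/eqP [ht] /andP [hx hs]]].
  by move: hu; rewrite ih => /andP [/eqP -> ->]; rewrite hy eqxx.
by exists (x, t); rewrite /= ih -ht eqxx.
Qed.

Lemma tuples_uniq (A : eqType) n (s : seq A) : uniq s -> uniq (tuples n s).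
Proof.
move=> us; elim: n => //= n ih; apply: allpairs_uniq => //.
by move=> [x t] [y u] _ _ /= [-> ->].
Qed.

Lemma gap_blocks_keys n idx gv blk : blk \in gap_blocks n idx gv ->
  exists2 tau, size tau = n /\ {subset tau <= idx} &
    forall P : seq gap, (P \in blk) = (unzip1 P == tau) && all (mem gv) (unzip2 P).
Proof.
elim: n blk => [|n ih] blk /=.
  by rewrite inE => /eqP ->; exists [::] => // -[|p P].
case/allpairsP => -[i b] /= [hi /ih [tau [st hs] hb] ->].
exists (i :: tau); first by split; [rewrite /= st | move=> j; rewrite inE => /predU1P [->|/hs]].
move=> P; apply/allpairsP/idP => [[[g Q] /= [hg hQ ->]]|].
  by rewrite /= eqseq_cons eqxx /= hg /=; rewrite hb in hQ.
case: P => [|[j g] P] //=; rewrite eqseq_cons => /andP [/andP [/eqP -> h1] /andP [h2 h3]].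
by exists (g, P); rewrite hb h1.
Qed.

Lemma gap_blocks_ex n idx gv tau : size tau = n -> {subset tau <= idx} ->
  exists2 blk, blk \in gap_blocks n idx gv &
    forall P : seq gap, (P \in blk) = (unzip1 P == tau) && all (mem gv) (unzip2 P).
Proof.
elim: n tau => [|n ih] [|i tau] //= st hs; first by exists [:: [::]] => // -[|p P].
have [|j hj|b hb hP] := ih tau; [by case: st | by apply: hs; rewrite inE hj orbT |].
exists [seq (i, g) :: P | g <- gv, P <- b].
  by apply/allpairsP; exists (i, b); rewrite hs ?mem_head.
move=> P; apply/allpairsP/idP => [[[g Q] /= [hg hQ ->]]|].
  by rewrite /= eqseq_cons eqxx /= hg /=; rewrite hP in hQ.
case: P => [|[j g] P] //=; rewrite eqseq_cons => /andP [/andP [/eqP -> h1] /andP [h2 h3]].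
by exists (g, P); rewrite hP h1.
Qed.

Lemma gap_blocks_uniq n idx gv blk : uniq gv -> blk \in gap_blocks n idx gv -> uniq blk.
Proof.
move=> ug; elim: n blk => [|n ih] blk /=; first by rewrite inE => /eqP ->.
case/allpairsP => -[i b] /= [_ /ih ub ->]; apply: allpairs_uniq => //.
by move=> [x t] [y u] _ _ /= [-> ->].
Qed.

Lemma size_gap_blocks n idx gv : size (gap_blocks n idx gv) = size idx ^ n.
Proof. by elim: n => //= n ih; rewrite size_allpairs ih expnS. Qed.

Lemma links_ofP (opts : seq opt) p : p \in links_of opts =
  [&& p.1 < p.2, p.2 < size opts & link (nth [::] opts p.1) (nth [::] opts p.2)].
Proof.
case: p => y x; rewrite mem_filter /=; case: ltnP => //= yx; case hl: (link _ _); rewrite /= ?andbF //.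
rewrite andbT; apply/allpairsP/idP => [[[a b] /= [_ h2 [_ ->]]]|h].
  by rewrite mem_iota in h2.
by exists (y, x); rewrite /= !mem_iota /=; split=> //; exact: ltn_trans yx h.
Qed.

Arguments blocks q r ok c k : simpl never.
Arguments gap_values c : simpl never.
Arguments betas r c : simpl never.

(** * Selections of options as assignments to variables *)

Section LocalCSP.
Variables (q r : nat) (ok : bool) (c : circuit) (k : nat).
Notation bs := (blocks q r ok c k).
Notation opts := (flatten bs).
Notation gv := (gap_values c).
Notation bt := (betas r c).
Notation gbs := (gap_blocks q (iota 0 k.+1) gv).
Notation Zbs := [seq [seq local_option ok c k beta P | beta <- bt, P <- blk] | blk <- gbs].

Lemma gap_values_uniq : uniq gv.
Proof. by apply: allpairs_uniq; rewrite ?iota_uniq // => -[x t] [y u] _ _ /= [-> ->]. Qed.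

Lemma betas_uniq : uniq bt.
Proof.
apply: tuples_uniq; apply: allpairs_uniq; rewrite ?iota_uniq // => -[x t] [y u] _ _ /= [-> ->] //.
Qed.

Lemma gap_values_ne : (0, 0) \in gv.
Proof. by apply/allpairsP; exists (0, 0). Qed.

Lemma betas_ne : nseq r (0, 0) \in bt.
Proof.
rewrite tuplesP size_nseq eqxx; apply/allP => p /nseqP [-> _].
by apply/allpairsP; exists (0, 0).
Qed.

Lemma local_option_inj beta beta' P P' :
  local_option ok c k beta P = local_option ok c k beta' P' -> beta = beta' /\ P = P'.
Proof.
move=> [_ -> h]; split=> //; move: P P' h.
by apply: inj_map => -[i g] [j g'] /= [-> ->].
Qed.

Definition dom (v : nat) : seq value :=
  match v with 0 => [:: [::]; good] | 1 => bt | _ => [seq [:: g] | g <- gv] end.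

Definition single (v : nat) : seq opt := [seq [:: (v, x)] | x <- dom v].

Lemma blocksE : bs = [:: [:: [:: (0, good); (0, good)]]] ++ Zbs ++
  [seq single i.+2 | i <- iota 0 k.+1] ++ [:: single 1; single 0; [:: [::]]].
Proof.
rewrite /blocks; do 3!congr cat.
by apply: eq_map => i; rewrite /single /= -map_comp.
Qed.

Lemma mem_blocks b : b \in bs -> [\/ b = [:: [:: (0, good); (0, good)]],
  exists2 blk, blk \in gbs & b = [seq local_option ok c k beta P | beta <- bt, P <- blk],
  exists2 v, v < k.+3 & b = single v | b = [:: [::]]].
Proof.
rewrite blocksE !mem_cat => /or4P [].
- by rewrite inE => /eqP; constructor 1.
- by move=> /mapP [blk h ->]; constructor 2; exists blk.
- by move=> /mapP [i]; rewrite mem_iota => h ->; constructor 3; exists i.+2; rewrite ?ltnS.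
rewrite !inE => /or3P [] /eqP ->; [constructor 3; exists 1|constructor 3; exists 0|constructor 4] => //.
Qed.

(** Since the options of a block bind the same variables in the same order, at most one agrees with
    a given assignment, and being the target of links is a property of the block. *)
Lemma block_facts b : b \in bs -> [/\ 0 < size b, uniq b &
  exists ks, forall o, o \in b -> unzip1 o = ks].
Proof.
case/mem_blocks => [->|[blk hb ->]|[v _ ->]|->].
- by split=> //; exists [:: 0; 0] => o; rewrite inE => /eqP ->.
- have [tau [st hs] hP] := gap_blocks_keys hb; split.
  + rewrite size_allpairs muln_gt0; apply/andP; split.
      by rewrite -has_predT; apply/hasP; exists (nseq r (0, 0)); first exact: betas_ne.
    rewrite -has_predT; apply/hasP; exists [seq (i, (0, 0)) | i <- tau] => //.
    rewrite hP /unzip1 /unzip2 -!map_comp map_id eqxx; apply/allP => g /mapP [i _ ->]; exact: gap_values_ne.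
  + apply: allpairs_uniq; [exact: betas_uniq | exact: gap_blocks_uniq gap_values_uniq hb |].
    by move=> [x t] [y u] _ _ /= /local_option_inj [-> ->].
  + exists (0 :: 1 :: [seq i.+2 | i <- tau]) => o /allpairsP [[beta P] /= [_]].
    rewrite hP => /andP [/eqP <- _] ->.
    by rewrite /=; do 2!congr cons; elim: (P) => //= g P' ->.
- rewrite /single; split.
  + rewrite size_map; case: v => [|[|v]] //=.
      by rewrite -has_predT; apply/hasP; exists (nseq r (0, 0)); first exact: betas_ne.
  + rewrite map_inj_uniq; last by move=> x y [].
    have u : uniq [seq [:: g] | g <- gv] by rewrite map_inj_uniq ?gap_values_uniq // => x y [].
    by case: v => [|[|v]]; [by []|exact: betas_uniq|exact: u].
  + by exists [:: v] => o /mapP [x _ ->].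
- by split=> //; exists [::] => o; rewrite inE => /eqP ->.
Qed.

Lemma blocks_ne : all (fun b => 0 < size b) bs.
Proof. by apply/allP => b /block_facts []. Qed.

Definition consistent (alpha : nat -> value) (o : opt) : bool :=
  all (fun p => p.2 == alpha p.1) o.

Lemma consistentE alpha o : consistent alpha o -> o = [seq (v, alpha v) | v <- unzip1 o].
Proof. by elim: o => //= -[v x] o ih /andP [/eqP /= <- /ih {1}->]. Qed.

Definition single_index (v : nat) : nat :=
  (size Zbs).+1 + (if v == 0 then k.+2 else if v == 1 then k.+1 else v.-2).

Lemma single_indexP v : v < k.+3 -> single_index v < size bs /\
  nth [::] bs (single_index v) = single v.
Proof.
have hX X : nth [::] bs ((size Zbs).+1 + X) = if X < k.+1 then single X.+2 else
    nth [::] [:: single 1; single 0; [:: [::]]] (X - k.+1).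
  rewrite blocksE -[LHS]/(nth [::] (Zbs ++ [seq single i.+2 | i <- iota 0 k.+1] ++
    [:: single 1; single 0; [:: [::]]]) (size Zbs + X)).
  rewrite nth_cat ltnNge leq_addr [~~ _]/= addKn nth_cat size_map size_iota.
  by case: ltnP => // h; rewrite (nth_map 0) ?size_iota // nth_iota.
move=> hv; rewrite /single_index hX; split.
  by rewrite blocksE !size_cat !size_map size_iota /=; case: v hv => [|[|v]] /=; lia.
case: v hv => [|[|v]] hv.
- by rewrite ltnNge leqnSn subSnn.
- by rewrite ltnn subnn.
- by have -> : v.+2.-2 < k.+1 by [].
Qed.

Notation T := (size opts).
Notation bd := (block_starts bs).
Notation ps := (pos bs).

(** The single-variable blocks define an assignment [alpha]. Links make the option chosen for each
    tuple agree with it, and the first block makes the flag [good], so every tuple passes its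
    test. *)
Lemma selection_sound sel : selection bd (links_of opts) sel ->
  ok /\ exists beta g, [/\ beta \in bt, forall i, i <= k -> g i \in gv &
    forall tau, size tau = q -> all (fun i => i <= k) tau ->
      locally_ok c k beta [seq (i, g i) | i <- tau]].
Proof.
move=> [s1 s2 s3]; rewrite size_block_starts ?blocks_ne // in s1 s2.
have chosen i : i < size bs -> exists j, [/\ j < size (nth [::] bs i), ps i j < T & sel (ps i j)].
  move=> hi; have [h0 _ _] := block_facts (mem_nth [::] hi).
  have [h1 h2 _] := posP [::] blocks_ne hi h0.
  have [y [yT e sy]] := s1 _ h1; have [i' [j [hi' hj ey]]] := pos_of yT.
  have [h3 h4 _] := posP [::] blocks_ne hi' hj.
  rewrite ey h4 h2 in e; case: e => e; subst i'.
  by exists j; rewrite -ey.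
pose jv v := find (fun j => sel (ps (single_index v) j)) (iota 0 (size (dom v))).
pose alpha v := nth [::] (dom v) (jv v).
have jvP v : v < k.+3 -> jv v < size (dom v) /\ sel (ps (single_index v) (jv v)).
  move=> hv; have [hi en] := single_indexP hv; have [j [hj _ sj]] := chosen _ hi.
  rewrite en size_map in hj.
  have hh : has (fun j => sel (ps (single_index v) j)) (iota 0 (size (dom v))).
    by apply/hasP; exists j; rewrite ?mem_iota.
  have h1 : jv v < size (dom v) by move: hh; rewrite has_find size_iota.
  by split=> //; have := nth_find 0 hh; rewrite -/(jv v) nth_iota.
(* The chosen option is linked to the column [(v, x)] further right; that column is therefore
   selected, and its block has only one selected column. *)
have forced v x i j : v < k.+3 -> x \in dom v -> i < single_index v -> i < size bs ->
    j < size (nth [::] bs i) -> sel (ps i j) ->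
    size (nth [::] (nth [::] bs i) j) != 1 -> (v, x) \in nth [::] (nth [::] bs i) j ->
    x = alpha v.
  move=> hv hx hiv hi hj sj sz hin; have [hsi en] := single_indexP hv; have [ja sa] := jvP v hv.
  have hx' : index x (dom v) < size (nth [::] bs (single_index v)) by rewrite en size_map index_mem.
  have ja' : jv v < size (nth [::] bs (single_index v)) by rewrite en size_map.
  have [a1 a2 a3] := posP [::] blocks_ne hi hj.
  have [b1 b2 b3] := posP [::] blocks_ne hsi hx'.
  have [c1 c2 c3] := posP [::] blocks_ne hsi ja'.
  rewrite en (nth_map [::]) ?index_mem // nth_index // in b3.
  rewrite en (nth_map [::]) // -/(alpha v) in c3.
  have hl : (ps i j, ps (single_index v) (index x (dom v))) \in links_of opts.
    rewrite links_ofP; apply/and3P; split; [|exact: b1|].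
      by rewrite ltnNge; apply/negP => /(seg_mono bd); rewrite a2 b2; lia.
    by rewrite [nth _ _ _.1]a3 [nth _ _ _.2]b3 /link sz [head _ _]/= hin.
  have sx := s3 _ hl sj; rewrite /= in sx.
  have e := s2 _ _ b1 c1 sx sa; rewrite b2 c2 in e.
  by move: b3; rewrite e // c3 => -[].
have a0 : alpha 0 = good.
  have h0 : 0 < size bs by rewrite blocksE.
  have [j [hj _ sj]] := chosen 0 h0; have ej : j = 0 by move: hj; rewrite blocksE /=; lia.
  rewrite ej in sj hj; apply/esym; apply: (forced 0 good 0 0) => //; rewrite ?blocksE //=.
have hZ tau : size tau = q -> all (fun i => i <= k) tau ->
    [/\ ok, locally_ok c k (alpha 1) [seq (i, head (0, 0) (alpha i.+2)) | i <- tau] &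
      alpha 1 \in bt].
  move=> st ht; have hs : {subset tau <= iota 0 k.+1}.
    by move=> i hi; rewrite mem_iota /= ltnS; exact: (allP ht).
  have [blk hb hP] := gap_blocks_ex gv st hs.
  pose i0 := (index blk gbs).+1.
  have hib : index blk gbs < size gbs by rewrite index_mem.
  have hi0 : i0 < size bs by rewrite blocksE !size_cat size_map /i0 [size [:: _]]/=; lia.
  have hsi v : i0 < single_index v by rewrite /single_index /i0 size_map; lia.
  have en : nth [::] bs i0 = [seq local_option ok c k beta P | beta <- bt, P <- blk].
    by rewrite blocksE /= nth_cat size_map hib (nth_map [::]) // nth_index.
  have [j [hj _ sj]] := chosen _ hi0.
  have := mem_nth [::] hj; rewrite {2}en => /allpairsP [[beta P] /= [hbeta]].
  rewrite hP => /andP [/eqP eP aP] eo.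
  have sz : size (nth [::] (nth [::] bs i0) j) != 1 by rewrite eo.
  have hflag : (if ok && locally_ok c k beta P then good else [::]) = good.
    rewrite -[RHS]a0; apply: (forced 0 _ i0 j) => //; last by rewrite eo mem_head.
    by case: ifP.
  have hbe : beta = alpha 1.
    by apply: (forced 1 _ i0 j) => //; rewrite eo !inE eqxx orbT.
  have hg i g : (i, g) \in P -> [:: g] = alpha i.+2.
    move=> hin; apply: (forced i.+2 _ i0 j) => //.
    - have : i \in tau by rewrite -eP; apply/mapP; exists (i, g).
      by move/(allP ht).
    - by apply: map_f; apply: (allP aP); apply/mapP; exists (i, g).
    - by rewrite eo !inE; apply/orP; right; apply/orP; right; apply/mapP; exists (i, g).
  have eP' : P = [seq (i, head (0, 0) (alpha i.+2)) | i <- tau].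
    rewrite -eP -map_comp -[LHS]map_id; apply/eq_in_map => -[i g] hin /=.
    by rewrite -(hg _ _ hin).
  rewrite -eP' -hbe; move: hflag; case hok: (ok && locally_ok c k beta P) => // _.
  by case/andP: hok.
(* Some tuple is needed to extract [ok] and the range of [beta]; gap 0 always exists. *)
have hq : all (fun i => i <= k) (nseq q 0) by apply/allP => i /nseqP [->].
have [hok _ hb] := hZ _ (size_nseq q 0) hq.
split=> //; exists (alpha 1), (fun i => head (0, 0) (alpha i.+2)); split=> // [i hi|tau st ht].
  have hv : i.+2 < k.+3 by [].
  have h1 : jv i.+2 < size gv by have [] := jvP _ hv; rewrite -[size gv](size_map (fun g => [:: g])).
  have -> : alpha i.+2 = [:: nth (0, 0) gv (jv i.+2)] by exact: nth_map.
  exact: mem_nth.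
by have [] := hZ tau st ht.
Qed.

(** Select the options that agree with the assignment. A link leads to one of the bindings of its
    source, so agreement is inherited. *)
Lemma selection_complete beta g : ok -> beta \in bt -> (forall i, i <= k -> g i \in gv) ->
  (forall tau, size tau = q -> all (fun i => i <= k) tau ->
      locally_ok c k beta [seq (i, g i) | i <- tau]) ->
  exists sel, selection bd (links_of opts) sel.
Proof.
move=> hok hb hg hl.
pose alpha v := match v with 0 => good | 1 => beta | i.+2 => [:: g i] end.
exists (fun x => consistent alpha (nth [::] opts x)).
have size_bd : size bd = T by apply: size_block_starts; exact: blocks_ne.
split; rewrite ?size_bd.
- move=> x xT; have [i [j [hi hj ex]]] := pos_of xT.
  have [_ h2 _] := posP [::] blocks_ne hi hj.
  suff [o ho co] : exists2 o, o \in nth [::] bs i & consistent alpha o.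
    have hjo : index o (nth [::] bs i) < size (nth [::] bs i) by rewrite index_mem.
    have [h3 h4 h5] := posP [::] blocks_ne hi hjo.
    by exists (ps i (index o (nth [::] bs i))); rewrite ex h2 h4 h5 nth_index.
  case/mem_blocks: (mem_nth [::] hi) => [->|[blk hblk ->]|[v hv ->]|->].
  + by exists [:: (0, good); (0, good)]; rewrite ?mem_head.
  + have [tau [st hs] hP] := gap_blocks_keys hblk.
    have ht : all (fun i => i <= k) tau by apply/allP => z /hs; rewrite mem_iota.
    exists (local_option ok c k beta [seq (i, g i) | i <- tau]).
      apply/allpairsP; exists (beta, [seq (i, g i) | i <- tau]); split=> //=.
      rewrite hP /unzip1 /unzip2 -!map_comp map_id eqxx.
      by apply/allP => z /mapP [y /(allP ht) hy ->]; exact: hg.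
    rewrite /local_option hok hl // /consistent /= !eqxx /=.
    by apply/allP => p /mapP [[y u] /mapP [z _ [-> ->]] ->] /=.
  + exists [:: (v, alpha v)]; last by rewrite /consistent /= eqxx.
    apply: map_f; case: v hv => [|[|v]] hv; [by [] | exact: hb |].
    exact: (map_f (fun g => [:: g]) (hg v hv)).
  + by exists [::]; rewrite ?mem_head.
- move=> x y xT yT cx cy e; have [i [j [hi hj ex]]] := pos_of xT.
  have [i' [j' [hi' hj' ey]]] := pos_of yT.
  have [_ h2 h3] := posP [::] blocks_ne hi hj; have [_ h2' h3'] := posP [::] blocks_ne hi' hj'.
  rewrite ex ey h2 h2' in e; case: e => e; subst i'.
  rewrite ex h3 in cx; rewrite ey h3' in cy.
  have [_ ub [ks hks]] := block_facts (mem_nth [::] hi).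
  have ejj : nth [::] (nth [::] bs i) j = nth [::] (nth [::] bs i) j'.
    by rewrite (consistentE cx) (consistentE cy) !hks ?mem_nth.
  by move/eqP: ejj; rewrite nth_uniq // => /eqP ejj; rewrite ex ey ejj.
- move=> p; rewrite links_ofP => /and3P [_ _ /and3P [h1 _ h3]] cp.
  move: h1 h3; case: (nth [::] opts p.2) => [|e [|]] //= _ he.
  by rewrite /consistent /= (allP cp _ he).
Qed.

Definition target x := size (nth [::] opts x) == 1.

Lemma target_links p : p \in links_of opts -> ~~ target p.1 /\ target p.2.
Proof. by rewrite links_ofP => /and3P [_ _ /and3P [h1 h2 _]]. Qed.

Lemma links_lt p : p \in links_of opts -> p.1 < p.2 < size bd.
Proof.
have e : size bd = T := size_block_starts blocks_ne.
by rewrite links_ofP e => /and3P [-> ->].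
Qed.

Lemma size_blocks : size bs = (k.+1) ^ q + k + 5.
Proof. rewrite blocksE !size_cat !size_map size_gap_blocks !size_iota /=; lia. Qed.

Lemma target_block x :
  target x = (size (head [::] (nth [::] bs (seg bd x).-1)) == 1).
Proof.
have [xT|xT] := ltnP x T.
  have [i [j [hi hj ->]]] := pos_of xT.
  have [_ h2 h3] := posP [::] blocks_ne hi hj.
  have [_ _ [ks hks]] := block_facts (mem_nth [::] hi).
  rewrite /target h3 h2 -pred_Sn -nth0 -!(size_map fst) -/(unzip1 _).
  by rewrite hks ?mem_nth // -/(unzip1 _) hks // mem_nth //; apply: leq_ltn_trans hj.
(* Beyond the last column the default option is empty, and [seg] gives the last block, whose option
   is empty too. *)
rewrite /target nth_default // /seg take_oversize; last first.
  by rewrite (size_block_starts blocks_ne); exact: leq_trans xT _.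
rewrite count_block_starts nth_last blocksE !last_cat /=.
by [].
Qed.

Lemma target_seg x y : seg bd x = seg bd y -> target x = target y.
Proof. by rewrite !target_block => ->. Qed.

Lemma blocks_start0 : nth false bd 0.
Proof. by apply: block_start0; rewrite size_blocks addnS. Qed.

Lemma blocks_start_last : nth false bd (size bd).-1.
Proof. by apply: block_start_last; [rewrite size_blocks addnS | rewrite blocksE !last_cat]. Qed.

Lemma blocks_T0 : 0 < size bd.
Proof. by rewrite ltnNge; apply/negP => h; have := blocks_start0; rewrite nth_default. Qed.

Theorem SMC1_blocks : SMC1 (enc (smc_of_blocks bs)) (3 * size bs) <->
  ok /\ exists beta g, [/\ beta \in bt, forall i, i <= k -> g i \in gv &
    forall tau, size tau = q -> all (fun i => i <= k) tau ->
      locally_ok c k beta [seq (i, g i) | i <- tau]].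
Proof.
have := @SMC1_gadget bd (links_of opts) blocks_T0 blocks_start0 blocks_start_last links_lt _ target_links target_seg.
rewrite count_block_starts -/(smc_of_blocks bs) => ->; split=> [[sel]|[hok [beta [g [h1 h2 h3]]]]].
  exact: selection_sound.
exact: selection_complete h1 h2 h3.
Qed.

Theorem SMC1_restricted_blocks : SMC1_restricted (enc (smc_of_blocks bs)) (3 * size bs).
Proof.
have := @SMC1_restricted_gadget bd (links_of opts) blocks_T0 blocks_start0 blocks_start_last.
by rewrite count_block_starts.
Qed.

End LocalCSP.

(** * Circuits and gaps *)

Section NodeValuesNth.
Variables (V : Type) (d : V) (inp : seq V) (f : seq V -> gate -> V).

Lemma node_values_cat gs gs' :
  take (size inp + size gs) (node_values inp f (gs ++ gs')) = node_values inp f gs.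
Proof.
elim/last_ind: gs' => [|gs' g ih].
  by rewrite cats0 take_oversize // size_node_values.
rewrite -rcons_cat node_values_rcons -cats1 takel_cat //.
by rewrite size_node_values size_cat addnA leq_addr.
Qed.

Lemma nth_node_values_input gs i : i < size inp ->
  nth d (node_values inp f gs) i = nth d inp i.
Proof.
move=> hi; have := node_values_cat [::] gs; rewrite addn0 /= /node_values /= -/(node_values _ _ _).
by move=> h; rewrite -(nth_take d hi) h.
Qed.

Lemma nth_node_values_gate gs j : j < size gs ->
  nth d (node_values inp f gs) (size inp + j) =
  f (take (size inp + j) (node_values inp f gs)) (nth (GNot 0) gs j).
Proof.
move=> hj; have e := cat_take_drop j gs; rewrite (drop_nth (GNot 0) hj) in e.
have st : size (take j gs) = j by rewrite size_take hj.
have h1 := node_values_cat (take j gs) (nth (GNot 0) gs j :: drop j.+1 gs).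
rewrite e st in h1; rewrite h1.
have h2 := node_values_cat (rcons (take j gs) (nth (GNot 0) gs j)) (drop j.+1 gs).
rewrite cat_rcons e size_rcons st addnS in h2.
rewrite -(nth_take d (ltnSn _)) h2 node_values_rcons nth_rcons size_node_values st.
by rewrite ltnn eqxx.
Qed.

End NodeValuesNth.

Section Circuit.
Variable c : circuit.
Hypothesis wf : circuit_wf c.
Let n := cinputs c.
Let gs := cgates c.
Let N := n + size gs.
Notation gate_at j := (nth (GNot 0) gs j).

Lemma args_lt j i : j < size gs -> i \in gate_args (gate_at j) -> i < n + j.
Proof. by move=> hj hi; case: wf => _ /(_ j hj) /andP [_ /allP h]; apply: h. Qed.

Definition weft_at v := nth 0 (node_values (nseq n 0)
  (fun ws g => large g + \max_(i <- gate_args g) nth 0 ws i) gs) v.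

Definition depth_at v := nth 0 (node_values (nseq n 0)
  (fun ds g => (\max_(i <- gate_args g) nth 0 ds i).+1) gs) v.

Lemma weft_at_arg j i : j < size gs -> i \in gate_args (gate_at j) ->
  large (gate_at j) + weft_at i <= weft_at (n + j).
Proof.
move=> hj hi; have hij := args_lt hj hi.
have e := @nth_node_values_gate _ 0 (nseq n 0)
  (fun ws g => large g + \max_(i <- gate_args g) nth 0 ws i) gs j hj.
rewrite size_nseq in e; rewrite /weft_at e leq_add2l.
by rewrite -(nth_take 0 hij); apply: (@leq_bigmax_seq _ _ predT (fun i => nth 0 _ i)).
Qed.

Lemma depth_at_arg j i : j < size gs -> i \in gate_args (gate_at j) -> depth_at i < depth_at (n + j).
Proof.
move=> hj hi; have hij := args_lt hj hi.
have e := @nth_node_values_gate _ 0 (nseq n 0)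
  (fun ds g => (\max_(i <- gate_args g) nth 0 ds i).+1) gs j hj.
rewrite size_nseq in e; rewrite /depth_at e ltnS.
by rewrite -(nth_take 0 hij); apply: (@leq_bigmax_seq _ _ predT (fun i => nth 0 _ i)).
Qed.

Lemma depth_at_gate j : j < size gs -> 0 < depth_at (n + j).
Proof.
move=> hj; have := @nth_node_values_gate _ 0 (nseq n 0)
  (fun ds g => (\max_(i <- gate_args g) nth 0 ds i).+1) gs j hj.
by rewrite size_nseq /depth_at => ->.
Qed.

Section Assignment.
Variable a : seq bool.
Hypothesis sa : size a = n.

Definition value_at v := nth false (node_values a gate_eval gs) v.

Lemma value_at_input v : v < n -> value_at v = nth false a v.
Proof. by move=> hv; rewrite /value_at nth_node_values_input ?sa. Qed.

Lemma value_at_gate j : j < size gs -> value_at (n + j) =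
  match gate_at j with GNot i => ~~ value_at i | GAnd s => all value_at s | GOr s => has value_at s end.
Proof.
move=> hj; have := @nth_node_values_gate _ false a gate_eval gs j hj; rewrite sa /value_at => ->.
have := @args_lt j ^~ hj; case: (gate_at j) => [i|s|s] /= hargs.
- by rewrite nth_take ?hargs ?inE.
- by apply: eq_in_all => i hi; rewrite nth_take ?hargs.
- by apply: eq_in_has => i hi; rewrite nth_take ?hargs.
Qed.

Definition unrefuted_at beta P v := nth (true, true) (unrefuted c beta P) v.

Lemma unrefuted_at_input beta P v : v < n -> unrefuted_at beta P v = unrefuted_input P v.
Proof.
move=> hv; rewrite /unrefuted_at /unrefuted nth_node_values_input ?size_map ?size_iota //.
by rewrite (nth_map 0) ?size_iota // nth_iota.
Qed.

Lemma unrefuted_at_gate beta P j : j < size gs -> unrefuted_at beta P (n + j) =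
  let pick s i := (size s <= 2) || ((n + j, i) \in beta) in
  match gate_at j with
  | GNot i => ((unrefuted_at beta P i).2, (unrefuted_at beta P i).1)
  | GAnd s => (all (fun i => (unrefuted_at beta P i).1) s, has (fun i => pick s i && (unrefuted_at beta P i).2) s)
  | GOr s => (has (fun i => pick s i && (unrefuted_at beta P i).1) s, all (fun i => (unrefuted_at beta P i).2) s)
  end.
Proof.
move=> hj; have := @nth_node_values_gate _ (true, true) [seq unrefuted_input P v | v <- iota 0 n] (unrefuted_gate beta) gs j hj.
rewrite size_map size_iota /unrefuted_at /unrefuted => ->.
have st : size (take (n + j) (node_values [seq unrefuted_input P v | v <- iota 0 n] (unrefuted_gate beta) gs)) = n + j.
  rewrite size_takel // size_node_values size_map size_iota leq_add2l; exact: ltnW.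
have := @args_lt j ^~ hj; case: (gate_at j) => [i|s|s] /= hargs.
- by rewrite nth_take ?hargs ?inE.
- rewrite st; congr pair; [apply: eq_in_all|apply: eq_in_has] => i hi; by rewrite nth_take ?hargs.
- rewrite st; congr pair; [apply: eq_in_has|apply: eq_in_all] => i hi; by rewrite nth_take ?hargs.
Qed.

Lemma node_cases (K : nat -> Prop) : (forall v, v < n -> K v) ->
  (forall j, j < size gs -> (forall i, i \in gate_args (gate_at j) -> K i) -> K (n + j)) ->
  forall v, v < N -> K v.
Proof.
move=> h1 h2 v; elim: v {-2}v (leqnn v) => [|m ih] v hm hv.
  have [h|h] := ltnP v n; first exact: h1.
  have e : v = n + (v - n) by lia.
  rewrite e; apply: h2 => [|i hi]; first by rewrite /N in hv; lia.
  by have := @args_lt (v - n) i _ hi; rewrite /N in hv; lia.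
have [h|h] := ltnP v n; first exact: h1.
have hj : v - n < size gs by rewrite /N in hv; lia.
have e : v = n + (v - n) by lia.
rewrite e; apply: h2 => // i hi; have := args_lt hj hi => hi'.
by apply: ih; rewrite /N in hv *; lia.
Qed.

Definition sound (P : seq gap) := forall v, v < n ->
  if nth false a v then (unrefuted_input P v).1 else (unrefuted_input P v).2.

Lemma weft0_sound beta P : sound P -> forall v, v < N -> weft_at v = 0 ->
  if value_at v then (unrefuted_at beta P v).1 else (unrefuted_at beta P v).2.
Proof.
move=> hs; apply: node_cases => [v hv _|j hj ih w0].
  by rewrite value_at_input // unrefuted_at_input //; apply: hs.
have {}ih i : i \in gate_args (gate_at j) -> if value_at i then (unrefuted_at beta P i).1 else (unrefuted_at beta P i).2.
  by move=> hi; apply: ih => //; have := weft_at_arg hj hi; rewrite w0; lia.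
(* [weft_at_arg] bounds the weft through an argument, so a gate without arguments is treated
   apart. *)
have small : size (gate_args (gate_at j)) <= 2 \/ gate_args (gate_at j) = [::].
  case e : (gate_args (gate_at j)) => [|i s]; [by right | left].
  have := @weft_at_arg j i hj; rewrite e mem_head w0 /large e => /(_ isT); by case: ltnP.
rewrite value_at_gate // unrefuted_at_gate //; case: (gate_at j) small ih => [i|s|s] /= small ih.
- by have := ih i (mem_head _ _); case: (value_at i).
- case: allP => hb; first by apply/allP => i hi; have := ih i hi; rewrite hb.
  case/allP/allPn: hb => i hi nb; apply/hasP; exists i => //.
  have -> : size s <= 2 by case: small => // e; rewrite e in hi.
  by have := ih i hi; rewrite (negPf nb).
- case: hasP => [[i hi hb]|hb].
    apply/hasP; exists i => //; have -> : size s <= 2 by case: small => // e; rewrite e in hi.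
    by have := ih i hi; rewrite hb.
  apply/allP => i hi; have := ih i hi; case hbi: (value_at i) => //.
  by case: hb; exists i.
Qed.

Lemma union_certificates (M : nat) (D : pred (nat * nat)) (K : nat -> seq (nat * nat) -> Prop) (s : seq nat) :
  (forall i b b', {subset b <= b'} -> K i b -> K i b') ->
  (forall i, i \in s -> exists2 b, size b <= M /\ all D b & K i b) ->
  exists2 b, size b <= size s * M /\ all D b & forall i, i \in s -> K i b.
Proof.
move=> mono; elim: s => [|i s ih] h; first by exists [::].
have [|b [sb db] kb] := ih; first by move=> z hz; apply: h; rewrite inE hz orbT.
have [b' [sb' db'] kb'] := h i (mem_head _ _).
exists (b' ++ b); first by rewrite size_cat mulSn leq_add // all_cat db' db.
move=> z; rewrite inE => /predU1P [->|hz].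
  by apply: mono kb' => p; rewrite mem_cat => ->.
by apply: mono (kb z hz) => p; rewrite mem_cat => ->; rewrite orbT.
Qed.

Definition in_range (p : nat * nat) : bool := (p.1 < N) && (p.2 < N).

(** At a large gate one decisive argument is enough, since the arguments have weft 0 and need no
    certificate themselves. A small gate unites the certificates of at most two arguments, whence
    [2 ^ h]. *)
Lemma certificate h v : v < N -> weft_at v <= 1 -> depth_at v <= h ->
  exists2 b0, size b0 <= 2 ^ h /\ all in_range b0 &
    forall beta P, {subset b0 <= beta} -> sound P ->
      if value_at v then (unrefuted_at beta P v).1 else (unrefuted_at beta P v).2.
Proof.
move=> hv; elim/node_cases: v / hv h => [v hv|j hj ih] h hw hd.
  by exists [::] => // beta P _ hs; rewrite value_at_input // unrefuted_at_input //; apply: hs.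
case: h hd => [|h] hd; first by have := depth_at_gate hj; lia.
have argN i : i \in gate_args (gate_at j) -> i < N.
  by move=> hi; have := args_lt hj hi; rewrite /N; lia.
have jN : n + j < N by rewrite /N; lia.
case hl: (large (gate_at j)).
  have hz i : i \in gate_args (gate_at j) -> forall beta P, sound P ->
      if value_at i then (unrefuted_at beta P i).1 else (unrefuted_at beta P i).2.
    move=> hi beta P hs; apply: weft0_sound => //; first exact: argN.
    by have := weft_at_arg hj hi; rewrite hl; lia.
  have e2 : 1 <= 2 ^ h.+1 by rewrite expn_gt0.
  rewrite value_at_gate //; move: hl hz argN; case eg: (gate_at j) => [i|s|s] //= hl hz argN.
  - case: allP => hb.
      exists [::] => // beta P _ hs; rewrite unrefuted_at_gate // eg /=; apply/allP => i hi.
      by have := hz i hi beta P hs; rewrite hb.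
    case/allP/allPn: hb => i hi nb; exists [:: (n + j, i)].
      by rewrite /= /in_range /= jN argN.
    move=> beta P hsub hs; rewrite unrefuted_at_gate // eg /=; apply/hasP; exists i => //.
    rewrite (hsub (n + j, i)) ?mem_head // orbT /=.
    by have := hz i hi beta P hs; rewrite (negPf nb).
  - case: hasP => [[i hi hb]|hb].
      exists [:: (n + j, i)]; first by rewrite /= /in_range /= jN argN.
      move=> beta P hsub hs; rewrite unrefuted_at_gate // eg /=; apply/hasP; exists i => //.
      rewrite (hsub (n + j, i)) ?mem_head // orbT /=.
      by have := hz i hi beta P hs; rewrite hb.
    exists [::] => // beta P _ hs; rewrite unrefuted_at_gate // eg /=; apply/allP => i hi.
    by have := hz i hi beta P hs; case hbi: (value_at i) => //; case: hb; exists i.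
have [b [sb db] hb] : exists2 b, size b <= size (gate_args (gate_at j)) * 2 ^ h /\ all in_range b &
    forall i, i \in gate_args (gate_at j) -> forall beta P, {subset b <= beta} -> sound P ->
      if value_at i then (unrefuted_at beta P i).1 else (unrefuted_at beta P i).2.
  apply: (@union_certificates _ _ (fun i b => forall beta P, {subset b <= beta} -> sound P ->
      if value_at i then (unrefuted_at beta P i).1 else (unrefuted_at beta P i).2)).
    by move=> i b b' sbb k1 beta P hs; apply: k1 => p hp; apply: hs; apply: sbb.
  move=> i hi; apply: ih => //; first by have := weft_at_arg hj hi; lia.
  by have := depth_at_arg hj hi; lia.
exists b.
  split=> //; apply: leq_trans sb _; rewrite expnS leq_mul2r.
  by rewrite [_ <= 2]leqNgt -/(large _) hl orbT.
move=> beta P hsub hs; rewrite value_at_gate // unrefuted_at_gate //.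
move: hl hb; case: (gate_at j) => [i|s|s] /=; rewrite /large /= => hl hb.
- by have := hb i (mem_head _ _) _ _ hsub hs; case: (value_at i).
- case: allP => ha; first by apply/allP => i hi; have := hb i hi _ _ hsub hs; rewrite ha.
  case/allP/allPn: ha => i hi nb; apply/hasP; exists i => //.
  have -> : size s <= 2 by rewrite leqNgt hl.
  by have := hb i hi _ _ hsub hs; rewrite (negPf nb).
- case: hasP => [[i hi ha]|ha].
    apply/hasP; exists i => //; have -> : size s <= 2 by rewrite leqNgt hl.
    by have := hb i hi _ _ hsub hs; rewrite ha.
  apply/allP => i hi; have := hb i hi _ _ hsub hs; case hbi: (value_at i) => //.
  by case: ha; exists i.
Qed.

(** Where [sound] says that [P] never contradicts the assignment, this says that [P] contains a
    witness for each input node in [X]. *)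
Definition knows (P : seq gap) (X : seq nat) := forall v, v \in X ->
  if nth false a v then ~~ (unrefuted_input P v).2 else ~~ (unrefuted_input P v).1.

Lemma union_refutations M (K : nat -> seq gap -> Prop) (s : seq nat) :
  (forall i, i \in s -> exists2 X, size X <= M /\ all (gtn n) X & forall P, knows P X -> K i P) ->
  exists2 X, size X <= size s * M /\ all (gtn n) X & forall P, knows P X -> forall i, i \in s -> K i P.
Proof.
elim: s => [|i s ih] h; first by exists [::].
have [|X [sX aX] kX] := ih; first by move=> z hz; apply: h; rewrite inE hz orbT.
have [X' [sX' aX'] kX'] := h i (mem_head _ _).
exists (X' ++ X); first by rewrite size_cat mulSn leq_add // all_cat aX' aX.
move=> P kP z; rewrite inE => /predU1P [->|hz].
  by apply: kX' => v hv; apply: kP; rewrite mem_cat hv.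
by apply: kX => // v hv; apply: kP; rewrite mem_cat hv orbT.
Qed.

(** Either one argument settles the gate, or all picked ones have to be refuted: at most [r] at a
    large gate, 2 at a small one. So each level multiplies the number of input nodes by at most
    [r + 2]. *)
Lemma refutation r beta h v : size beta <= r -> v < N -> depth_at v <= h ->
  exists2 X, size X <= (r + 2) ^ h /\ all (gtn n) X &
    forall P, knows P X -> if value_at v then ~~ (unrefuted_at beta P v).2 else ~~ (unrefuted_at beta P v).1.
Proof.
move=> hr hv; elim/node_cases: v / hv h => [v hv|j hj ih] h hd.
  exists [:: v]; first by rewrite /= hv expn_gt0 addn2.
  by move=> P hP; rewrite value_at_input // unrefuted_at_input //; apply: hP; rewrite mem_head.
case: h hd => [|h] hd; first by have := depth_at_gate hj; lia.
have {}ih i : i \in gate_args (gate_at j) -> exists2 X, size X <= (r + 2) ^ h /\ all (gtn n) X &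
    forall P, knows P X -> if value_at i then ~~ (unrefuted_at beta P i).2 else ~~ (unrefuted_at beta P i).1.
  by move=> hi; apply: ih => //; have := depth_at_arg hj hi; lia.
have grow X : size X <= (r + 2) ^ h -> size X <= (r + 2) ^ h.+1.
  by move=> hX; apply: leq_trans hX _; rewrite leq_pexp2l // addn2.
pose cand s := if size s <= 2 then s else [seq e.2 | e <- beta & (e.1 == n + j) && (e.2 \in s)].
have sc s : size (cand s) <= r + 2.
  rewrite /cand; case: ifP => h2; first by lia.
  by rewrite size_map size_filter; exact: leq_trans (count_size _ _) (leq_trans hr (leq_addr _ _)).
have cs s i : i \in cand s -> i \in s.
  by rewrite /cand; case: ifP => // _ /mapP [e]; rewrite mem_filter => /andP [/andP [_ he] _] ->.
have sel s i : i \in s -> (size s <= 2) || ((n + j, i) \in beta) -> i \in cand s.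
  rewrite /cand; case: ifP => //= _ hi hb; apply/mapP; exists (n + j, i) => //.
  by rewrite mem_filter /= eqxx hi.
have bound s X : size X <= size (cand s) * (r + 2) ^ h -> size X <= (r + 2) ^ h.+1.
  by move=> hX; apply: leq_trans hX _; rewrite expnS leq_mul2r sc orbT.
rewrite value_at_gate //; move: ih; case eg: (gate_at j) => [i|s|s] /= ih.
- have [X [sX aX] kX] := ih i (mem_head _ _); exists X; first by split=> //; apply: grow.
  move=> P /kX; rewrite unrefuted_at_gate // eg /=; by case: (value_at i).
- case: allP => hb.
    have [X [sX aX] kX] : exists2 X, size X <= size (cand s) * (r + 2) ^ h /\ all (gtn n) X &
        forall P, knows P X -> forall i, i \in cand s -> ~~ (unrefuted_at beta P i).2.
      apply: union_refutations => i hi; have [X hX kX] := ih i (cs _ _ hi); exists X => // P /kX.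
      by rewrite hb //; apply: cs.
    exists X; first by split=> //; apply: bound sX.
    move=> P kP; rewrite unrefuted_at_gate // eg /=; apply/hasPn => i hi; apply/negP => /andP [h1 h2].
    by have := kX P kP i (sel _ _ hi h1); rewrite h2.
  case/allP/allPn: hb => i hi nb; have [X [sX aX] kX] := ih i hi; exists X; first by split=> //; apply: grow.
  move=> P /kX; rewrite (negPf nb) unrefuted_at_gate // eg /= => h1; apply/allPn; by exists i.
- case: hasP => [[i hi hb]|hb].
    have [X [sX aX] kX] := ih i hi; exists X; first by split=> //; apply: grow.
    move=> P /kX; rewrite hb unrefuted_at_gate // eg /= => h1; apply/allPn; by exists i.
  have [X [sX aX] kX] : exists2 X, size X <= size (cand s) * (r + 2) ^ h /\ all (gtn n) X &
      forall P, knows P X -> forall i, i \in cand s -> ~~ (unrefuted_at beta P i).1.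
    apply: union_refutations => i hi; have [X hX kX] := ih i (cs _ _ hi); exists X => // P /kX.
    by case hbi: (value_at i) => //; case: hb; exists i => //; apply: cs.
  exists X; first by split=> //; apply: bound sX.
  move=> P kP; rewrite unrefuted_at_gate // eg /=; apply/hasPn => i hi; apply/negP => /andP [h1 h2].
  by have := kX P kP i (sel _ _ hi h1); rewrite h2.
Qed.

End Assignment.
End Circuit.

(** * Assignments with [k] ones as sequences of [k.+1] gaps *)

Section Equivalence.
Variables (c : circuit) (d k : nat).
Hypothesis wf : circuit_wf c.
Hypothesis depthd : depth c <= d.
Let n := cinputs c.
Let r := 2 ^ d.
Let q := (r + 2) ^ d + 2.

Lemma output_lt : coutput c < n + size (cgates c).
Proof. by case: wf. Qed.

Definition locally_satisfiable : Prop :=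
  exists beta g, [/\ beta \in betas r c, forall i, i <= k -> g i \in gap_values c &
    forall tau, size tau = q -> all (fun i => i <= k) tau ->
      locally_ok c k beta [seq (i, g i) | i <- tau]].

Section Complete.
Hypothesis weft1 : weft c <= 1.
Variable a : seq bool.
Hypothesis sa : size a = n.
Hypothesis ka : count_mem true a = k.
Hypothesis evala : circuit_eval c a.

Definition pts := [seq p <- iota 0 n.+2 | [|| p == 0, p == n.+1 | nth false a p.-1]].
Local Arguments pts : simpl never.
Let g i := (nth 0 pts i, nth 0 pts i.+1).

Lemma pts_sorted : sorted ltn pts.
Proof. by apply: sorted_filter (iota_ltn_sorted _ _); exact: ltn_trans. Qed.

Lemma ptsE : pts = 0 :: rcons [seq p <- iota 1 n | nth false a p.-1] n.+1.
Proof.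
have e : iota 1 n.+1 = rcons (iota 1 n) n.+1 by rewrite -[in LHS](addn1 n) iotaD cats1 add1n.
rewrite /pts -[iota 0 n.+2]/(0 :: iota 1 n.+1) e /= filter_rcons eqxx /=; congr (_ :: rcons _ _).
by apply: eq_in_filter => p; rewrite mem_iota => hp; rewrite gtn_eqF ?ltn_eqF //; lia.
Qed.

Lemma size_pts : size pts = k.+2.
Proof.
rewrite ptsE /= size_rcons; congr _.+2.
rewrite size_filter -ka -[in RHS](mkseq_nth false a) count_map sa -[1]addn0 iotaDl count_map.
by apply: eq_count => v /=; case: (nth false a v).
Qed.

Lemma pts_lt i j : i < k.+2 -> j < k.+2 -> (nth 0 pts i < nth 0 pts j) = (i < j).
Proof.
move=> hi hj; have mono x y : x < y -> y < k.+2 -> nth 0 pts x < nth 0 pts y.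
  move=> xy hy; apply: (sorted_ltn_nth ltn_trans 0 pts_sorted); rewrite ?inE ?size_pts //.
  exact: ltn_trans xy hy.
case: (ltngtP i j) => h; first by rewrite mono.
  by have := mono _ _ h hi; lia.
by rewrite h ltnn.
Qed.

Lemma pts_le i : nth 0 pts i <= n.+1.
Proof.
have [h|h] := ltnP i (size pts); last by rewrite nth_default.
by have := mem_nth 0 h; rewrite mem_filter mem_iota => /andP [_].
Qed.

Lemma pts0 : nth 0 pts 0 = 0.
Proof. by rewrite ptsE. Qed.

Lemma pts_last : nth 0 pts k.+1 = n.+1.
Proof.
have e : k.+1 = (size pts).-1 by rewrite size_pts.
by rewrite e nth_last ptsE /= last_rcons.
Qed.

Lemma gaps_ok_g tau : all (fun i => i <= k) tau -> gaps_ok k n [seq (i, g i) | i <- tau].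
Proof.
have E i : ((i, g i).1 = i) * ((i, g i).2.1 = nth 0 pts i) * ((i, g i).2.2 = nth 0 pts i.+1) by [].
move=> ht; apply/andP; split; apply/allP => p /mapP [i /(allP ht) hi ->].
  rewrite !E pts_lt ?ltnSn ?pts_le; try lia.
  by apply/and4P; split=> //; apply/implyP => /eqP ->; rewrite ?pts0 ?pts_last.
by apply/allP => p' /mapP [j _ ->]; rewrite !E; apply/implyP => /eqP ->.
Qed.

Lemma sound_g tau : all (fun i => i <= k) tau -> sound c a [seq (i, g i) | i <- tau].
Proof.
have E i : ((i, g i).2.1 = nth 0 pts i) * ((i, g i).2.2 = nth 0 pts i.+1) by [].
move=> ht v hv; case: ifP => av.
  (* A one is itself a point, and no point lies strictly between two consecutive ones. *)
  have vin : v.+1 \in pts by rewrite mem_filter mem_iota /= av !orbT; lia.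
  apply/hasPn => p /mapP [i /(allP ht) hi ->]; have im := vin; rewrite -index_mem in im.
  have hi2 : i < k.+1 by [].
  rewrite size_pts in im; rewrite !E -(nth_index 0 vin) !pts_lt //; lia.
apply/hasPn => p /mapP [i /(allP ht) hi ->]; rewrite E; apply/negP => /eqP e.
have him : i < size pts by rewrite size_pts; lia.
have := mem_nth 0 him; rewrite e mem_filter /= av orbF => /andP [/eqP e2 _].
by rewrite -/n in hv; lia.
Qed.

Lemma sat_locally : locally_satisfiable.
Proof.
have [b0 [sb rb] hb] := certificate wf sa output_lt weft1 depthd.
have sbr : size b0 <= r := sb.
pose N := (cinputs c + size (cgates c)).+1.
have inN x y : x < N -> y < N -> (x, y) \in [seq (u, v) | u <- iota 0 N, v <- iota 0 N].
  by move=> h1 h2; apply/allpairsP; exists (x, y); split; rewrite ?mem_iota.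
(* Padding to length exactly [r] is harmless, as a certificate works for every list that contains
   it. *)
exists (b0 ++ nseq (r - size b0) (0, 0)), g; split.
- rewrite tuplesP size_cat size_nseq subnKC // eqxx andTb all_cat; apply/andP; split.
    apply/allP => -[x y] hin; have /andP [/= h1 h2] := allP rb _ hin; apply: inN; exact: ltnW.
  by apply/allP => p /nseqP [-> _]; apply: inN.
- move=> i hi; have inp m : nth 0 pts m \in iota 0 n.+2 by rewrite mem_iota add0n ltnS pts_le.
  by apply/allpairsP; exists (g i); split; [exact: inp | exact: inp | case: (g i)].
move=> tau st ht; rewrite /locally_ok gaps_ok_g //=.
have := hb (b0 ++ nseq (r - size b0) (0, 0)) _ _ (sound_g ht).
have -> : value_at c a (coutput c) by exact: evala.
by apply=> p; rewrite mem_cat => ->.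
Qed.

End Complete.

Section Sound.
Variables (beta : value) (g : nat -> nat * nat).
Hypothesis hbeta : beta \in betas r c.
Hypothesis hloc : forall tau, size tau = q -> all (fun i => i <= k) tau ->
  locally_ok c k beta [seq (i, g i) | i <- tau].

(** Tests exist only for tuples of length exactly [q]; shorter ones are padded with gap 0. *)
Lemma local_pad tau : size tau <= q -> all (fun i => i <= k) tau ->
  exists2 tau', {subset tau <= tau'} & locally_ok c k beta [seq (i, g i) | i <- tau'].
Proof.
move=> st ht; exists (tau ++ nseq (q - size tau) 0); first by move=> i hi; rewrite mem_cat hi.
apply: hloc; first by rewrite size_cat size_nseq subnKC.
by rewrite all_cat ht; apply/allP => i /nseqP [->].
Qed.

Lemma gap_facts i : i <= k -> [/\ (g i).1 < (g i).2, (g i).2 <= n.+1,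
  i = 0 -> (g i).1 = 0 & i = k -> (g i).2 = n.+1].
Proof.
move=> hi; have [||tau' hs /andP [/andP [/allP h _] _]] := @local_pad [:: i].
- by rewrite /q addn2.
- by rewrite /= hi.
have := h (i, g i) (map_f (fun i => (i, g i)) (hs i (mem_head _ _))).
move=> /and4P [/= h1 h2 /implyP h3 /implyP h4]; split=> // e.
  by apply/eqP; apply: h3; rewrite e.
by apply/eqP; apply: h4; rewrite e.
Qed.

Lemma gap_next i : i < k -> (g i.+1).1 = (g i).2.
Proof.
move=> hi; have [||tau' hs /andP [/andP [_ /allP h] _]] := @local_pad [:: i; i.+1].
- by rewrite /q addn2.
- by rewrite /= hi (ltnW hi).
have h1 := map_f (fun i => (i, g i)) (hs i (mem_head _ _)).
have h2 : (i.+1, g i.+1) \in [seq (i, g i) | i <- tau'].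
  by apply: (map_f (fun i => (i, g i))); apply: hs; rewrite !inE eqxx orbT.
by have /allP /(_ _ h2) /implyP /= /(_ (eqxx _)) /eqP := h _ h1.
Qed.

Lemma gap_mono i j : i < j -> j <= k -> (g i).1 < (g j).1.
Proof.
elim: j => // j ih; rewrite ltnS leq_eqVlt => /predU1P [->|hij] hj.
  by rewrite gap_next //; have [] := gap_facts (ltnW hj).
apply: ltn_trans (ih hij (ltnW hj)) _.
by rewrite gap_next //; have [] := gap_facts (ltnW hj).
Qed.

(** Gap 0 starts at position 0, which is no input node; the [k] ones are the left ends of the other
    gaps. *)
Let L := [seq (g i).1 | i <- iota 1 k].
Let a := [seq v.+1 \in L | v <- iota 0 n].

Lemma size_a : size a = n.
Proof. by rewrite size_map size_iota. Qed.

Lemma nth_a v : v < n -> nth false a v = (v.+1 \in L).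
Proof. by move=> hv; rewrite (nth_map 0) ?size_iota // nth_iota. Qed.

Lemma L_range p : p \in L -> 0 < p <= n.
Proof.
move=> /mapP [i]; rewrite mem_iota => hi ->; have hik : i <= k by lia.
have [h1 h2 _ _] := gap_facts hik.
have h0 : (g 0).1 < (g i).1 by apply: gap_mono; lia.
by lia.
Qed.

Lemma L_uniq : uniq L.
Proof.
rewrite map_inj_in_uniq ?iota_uniq // => i j; rewrite !mem_iota => hi hj e.
have [hik hjk] : i <= k /\ j <= k by lia.
by case: (ltngtP i j) => // h; [have := gap_mono h hjk | have := gap_mono h hik]; rewrite e ltnn.
Qed.

Lemma count_a : count_mem true a = k.
Proof.
rewrite count_map -[RHS](size_iota 1 k) -(size_map (fun i => (g i).1)) -/L.
rewrite (@eq_count _ _ (fun v => v.+1 \in L)); last by move=> v /=; case: (_ \in L).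
rewrite -size_filter -(size_map succn); apply: perm_size; apply: uniq_perm L_uniq _.
  by rewrite map_inj_uniq ?filter_uniq ?iota_uniq // => x y [].
move=> p; apply/mapP/idP => [[v]|hp].
  by rewrite mem_filter => /andP [h _] ->.
have /andP [p0 pn] := L_range hp; exists p.-1; last by rewrite prednK.
by rewrite mem_filter mem_iota prednK //= hp.
Qed.

Lemma gap_cover p : 0 < p < n.+1 -> exists2 i, i <= k & (g i).1 <= p < (g i).2.
Proof.
move=> hp; have h j : j <= k -> p < (g j).2 -> exists2 i, i <= k & (g i).1 <= p < (g i).2.
  elim: j => [|j ih] hj h1.
    by exists 0 => //; have [_ _ -> // _] := gap_facts hj; rewrite h1.
  have [h2|h2] := leqP (g j.+1).1 p; first by exists j.+1; rewrite // h2.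
  by apply: ih; [lia | rewrite -gap_next].
by apply: (h k) => //; have [_ _ _ ->] := gap_facts (leqnn k); lia.
Qed.

Lemma covering X : all (gtn n) X -> exists2 tau, size tau = size X /\ all (fun i => i <= k) tau &
  forall tau', {subset tau <= tau'} -> knows a [seq (i, g i) | i <- tau'] X.
Proof.
elim: X => [|v X ih] /=; first by exists [::].
move=> /andP [hv /ih [tau [st ht] hk]].
suff [i hi hki] : exists2 i, i <= k & forall tau', i \in tau' ->
    knows a [seq (i, g i) | i <- tau'] [:: v].
  exists (i :: tau); first by rewrite /= st hi.
  move=> tau' hs u; rewrite inE => /predU1P [->|hu].
    by apply: hki; [apply: hs; rewrite mem_head | rewrite mem_head].
  by apply: hk => // j hj; apply: hs; rewrite inE hj orbT.
case hL: (v.+1 \in L).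
  move/mapP: (hL) => [i hi e]; exists i; first by move: hi; rewrite mem_iota; lia.
  move=> tau' hin u; rewrite inE => /eqP ->; rewrite nth_a // hL /= negbK.
  by apply/hasP; exists (i, g i); [apply: (map_f (fun i => (i, g i))) | rewrite /= e].
have hv' : 0 < v.+1 < n.+1 by [].
have [i hi /andP [h1 h2]] := gap_cover hv'; exists i => // tau' hin u.
rewrite inE => /eqP ->; rewrite nth_a // hL /= negbK.
apply/hasP; exists (i, g i); [exact: (map_f (fun i => (i, g i))) | rewrite /= h2 andbT].
(* Equality would make [v.+1] the left end of a gap: 0 for gap 0, an element of [L] otherwise. *)
rewrite ltn_neqAle h1 andbT; apply/negP => /eqP e.
case: (posnP i) => [i0|i0]; first by have [_ _ h _] := gap_facts hi; rewrite h in e.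
move/negP: hL; apply; apply/mapP; exists i => //; rewrite mem_iota; lia.
Qed.

(** If the assignment read off the gaps made the output false, at most [(r + 2) ^ d] gaps would
    refute the value true, and the tuple of these gaps would fail its test. *)
Lemma locally_sat : exists a', [/\ size a' = n, count_mem true a' = k & circuit_eval c a'].
Proof.
exists a; split; [exact: size_a | exact: count_a |].
apply: contraT => hc.
have sb : size beta <= r by move: hbeta; rewrite tuplesP => /andP [/eqP -> _].
have [X [sX aX] kX] := refutation wf size_a sb output_lt depthd.
have [tau [st ht] hk] := covering aX.
have [|tau' hs /andP [_ h]] := local_pad _ ht.
  by rewrite st; apply: leq_trans sX _; rewrite leq_addr.
have := kX _ (hk tau' hs); rewrite (negPf (hc : ~~ value_at c a (coutput c))).
by rewrite /unrefuted_at h.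
Qed.

End Sound.
End Equivalence.

(* The gaps needed to refute an output, plus two to compare adjacent gaps. *)
Definition quota (d : nat) : nat := (2 ^ d + 2) ^ d + 2.

Theorem WCS_locally c d k : circuit_wf c -> weft c <= 1 -> depth c <= d ->
  (exists a, [/\ size a = cinputs c, count_mem true a = k & circuit_eval c a]) <->
  (exists beta g, [/\ beta \in betas (2 ^ d) c, forall i, i <= k -> g i \in gap_values c &
    forall tau, size tau = quota d -> all (fun i => i <= k) tau ->
      locally_ok c k beta [seq (i, g i) | i <- tau]]).
Proof.
move=> wf w1 dd; split=> [[a [sa ka ea]]|[beta [g [h1 _ h2]]]].
  exact: (sat_locally wf dd w1 sa ka ea).
exact: (locally_sat wf dd h1 h2).
Qed.

(** * The reduction in polynomial time *)

(** The decoders are total, so they can be run on any tree; [is_circuit] recognizes the trees that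
    do encode a circuit. *)
Fixpoint spine (t : tree) : seq tree := if t is Node l r then l :: spine r else [::].
Definition tree_hd (t : tree) : tree := if t is Node l _ then l else Leaf.
Definition tree_tl (t : tree) : tree := if t is Node _ r then r else Leaf.
Definition dec_nat (t : tree) : nat := size (spine t).
Definition dec_list (t : tree) : seq nat := [seq dec_nat u | u <- spine t].
Definition dec_gate (t : tree) : gate :=
  if dec_nat (tree_hd t) == 0 then GNot (dec_nat (tree_tl t))
  else if dec_nat (tree_hd t) == 1 then GAnd (dec_list (tree_tl t)) else GOr (dec_list (tree_tl t)).
Definition dec_circuit (t : tree) : circuit :=
  Circuit (dec_nat (tree_hd t)) [seq dec_gate u | u <- spine (tree_hd (tree_tl t))] (dec_nat (tree_tl (tree_tl t))).

Definition is_leaf (t : tree) : bool := nilp (spine t).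
Definition is_nat (t : tree) : bool := all is_leaf (spine t).
Definition is_nat_list (t : tree) : bool := all is_nat (spine t).
Definition is_gate (t : tree) : bool :=
  [&& ~~ is_leaf t, is_nat (tree_hd t) & if dec_nat (tree_hd t) == 0 then is_nat (tree_tl t)
      else (dec_nat (tree_hd t) <= 2) && is_nat_list (tree_tl t)].
Definition is_circuit (t : tree) : bool :=
  [&& ~~ is_leaf t, is_nat (tree_hd t), ~~ is_leaf (tree_tl t),
      all is_gate (spine (tree_hd (tree_tl t))) & is_nat (tree_tl (tree_tl t))].

(** Absence of duplicates is phrased with filters and sizes, for which [poly] has rules. *)
Definition gate_wfb (g : gate) : bool :=
  if g is GNot _ then true
  else all (fun x => size [seq y <- gate_args g | y == x] <= 1) (gate_args g)
       && (2 <= size (gate_args g)).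

Definition circuit_wfb (c : circuit) : bool :=
  (coutput c < cinputs c + size (cgates c)) &&
  all (fun j => let g := nth (GNot 0) (cgates c) j in
    gate_wfb g && all (fun i => i < cinputs c + j) (gate_args g))
   (iota 0 (size (cgates c))).

Definition valid_input (d : nat) (x : tree) : bool :=
  let c := dec_circuit x in
  [&& is_circuit x, circuit_wfb c, weft c <= 1 & depth c <= d].

Definition reduction (d q r : nat) (p : tree * nat) : smc_data * nat :=
  let bs := blocks q r (valid_input d p.1) (dec_circuit p.1) p.2 in
  (smc_of_blocks bs, 3 * size bs).

Lemma poly_gadget : poly (fun p : seq bool * (seq (nat * nat) * nat) => gadget p.1 p.2.1 p.2.2).
Proof. rewrite /gadget /names /adj /starred /seg_end; poly. Qed.

Section Trees.
Context {A : Type} {EA : Enc A}.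

Lemma enc_spine (t : tree) : enc (spine t) = t.
Proof. by rewrite /enc /Enc_seq; elim: t => //= l _ r ->. Qed.

Lemma poly_spine (f : A -> tree) : poly f -> poly (fun a => spine (f a)).
Proof. by apply: poly_recode => a; rewrite enc_spine. Qed.

Lemma poly_tree_hd (f : A -> tree) : poly f -> poly (fun a => tree_hd (f a)).
Proof.
apply: (@poly_comp _ _ _ _ _ _ tree_hd).
apply: (@poly_expr _ _ _ _ _ (EHd (EVar 0)) id) => [t s /= -> //| |[|l r]] //.
  by auto with pb.
by rewrite /enc /Enc_tree /=; lia.
Qed.

Lemma poly_tree_tl (f : A -> tree) : poly f -> poly (fun a => tree_tl (f a)).
Proof.
apply: (@poly_comp _ _ _ _ _ _ tree_tl).
apply: (@poly_expr _ _ _ _ _ (ETl (EVar 0)) id) => [t s /= -> //| |[|l r]] //.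
  by auto with pb.
by rewrite /enc /Enc_tree /=; lia.
Qed.

Lemma poly_tree B {EB : Enc B} (f : A -> B) : poly f -> poly (fun a => enc (f a)).
Proof. exact: poly_recode. Qed.

Lemma poly_dec_nat (f : A -> tree) : poly f -> poly (fun a => dec_nat (f a)).
Proof. by move=> pf; apply: poly_size_seq; apply: poly_spine. Qed.

End Trees.

Ltac poly_tree_rule := lazymatch goal with
  | |- @poly _ _ _ _ (fun _ => tree_hd _) => apply: poly_tree_hd
  | |- @poly _ _ _ _ (fun _ => tree_tl _) => apply: poly_tree_tl
  | |- @poly _ _ _ _ (fun _ => spine _) => apply: poly_spine
  | |- @poly _ _ _ _ (fun _ => dec_nat _) => apply: poly_dec_nat
  | |- @poly _ _ _ _ (fun _ => @enc _ _ _) => apply: poly_tree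
  end.
Ltac poly ::= repeat (cbv beta; first [eassumption | poly_eqs | poly_eta; first [poly_rule | poly_tree_rule]]).

Section Gates.
Context {A : Type} {EA : Enc A}.

Lemma poly_dec_list (f : A -> tree) : poly f -> poly (fun a => dec_list (f a)).
Proof. by rewrite /dec_list => pf; poly. Qed.

Lemma poly_GNot (f : A -> nat) : poly f -> poly (fun a => GNot (f a)).
Proof. by move=> pf; apply: (poly_recode (f := fun a => (0, f a))) => //; poly. Qed.

Lemma poly_GAnd (f : A -> seq nat) : poly f -> poly (fun a => GAnd (f a)).
Proof. by move=> pf; apply: (poly_recode (f := fun a => (1, f a))) => //; poly. Qed.

Lemma poly_GOr (f : A -> seq nat) : poly f -> poly (fun a => GOr (f a)).
Proof. by move=> pf; apply: (poly_recode (f := fun a => (2, f a))) => //; poly. Qed.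

Definition gate_kind (g : gate) : nat := dec_nat (tree_hd (enc g)).

Lemma poly_gate_kind (f : A -> gate) : poly f -> poly (fun a => gate_kind (f a)).
Proof. by rewrite /gate_kind => pf; poly. Qed.

Lemma dec_nat_enc n : dec_nat (enc_nat n) = n.
Proof. by rewrite /dec_nat; elim: n => //= n ->. Qed.

Lemma dec_list_enc s : dec_list (enc_seq enc_nat s) = s.
Proof. by rewrite /dec_list; elim: s => //= n s ->; rewrite dec_nat_enc. Qed.

Lemma poly_gate_args (f : A -> gate) : poly f -> poly (fun a => gate_args (f a)).
Proof.
move=> pf; apply: (poly_ext (f := fun a => if gate_kind (f a) == 0
   then [:: dec_nat (tree_tl (enc (f a)))] else dec_list (tree_tl (enc (f a))))).
  move=> a; case: (f a) => [i|s|s].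
  - exact: (congr1 (fun n => [:: n]) (dec_nat_enc i)).
  - exact: dec_list_enc.
  - exact: dec_list_enc.
apply: poly_if; [poly; exact: poly_gate_kind | by poly | by apply: poly_dec_list; poly].
Qed.

Lemma poly_circuit (n o : A -> nat) (gs : A -> seq gate) :
  poly n -> poly gs -> poly o -> poly (fun a => Circuit (n a) (gs a) (o a)).
Proof.
by move=> p1 p2 p3; apply: (poly_recode (f := fun a => (n a, (gs a, o a)))) => //; poly.
Qed.

Lemma poly_cinputs (f : A -> circuit) : poly f -> poly (fun a => cinputs (f a)).
Proof.
move=> pf; apply: (poly_recode (f := fun a => tree_hd (enc (f a)))) => [a|]; last by poly.
by case: (f a).
Qed.

Lemma poly_cgates (f : A -> circuit) : poly f -> poly (fun a => cgates (f a)).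
Proof.
move=> pf; apply: (poly_recode (f := fun a => tree_hd (tree_tl (enc (f a))))) => [a|]; last by poly.
by case: (f a).
Qed.

Lemma poly_coutput (f : A -> circuit) : poly f -> poly (fun a => coutput (f a)).
Proof.
move=> pf; apply: (poly_recode (f := fun a => tree_tl (tree_tl (enc (f a))))) => [a|]; last by poly.
by case: (f a).
Qed.

End Gates.

Section GateDecoding.
Context {A : Type} {EA : Enc A}.

Lemma poly_dec_gate (f : A -> tree) : poly f -> poly (fun a => dec_gate (f a)).
Proof.
move=> pf; apply: poly_if; first by poly.
  by apply: poly_GNot; poly.
apply: poly_if; first by poly.
  by apply: poly_GAnd; apply: poly_dec_list; poly.
by apply: poly_GOr; apply: poly_dec_list; poly.
Qed.

End GateDecoding.

Ltac poly_gate_rule := lazymatch goal with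
  | |- @poly _ _ _ _ (fun _ => dec_list _) => apply: poly_dec_list
  | |- @poly _ _ _ _ (fun _ => dec_gate _) => apply: poly_dec_gate
  | |- @poly _ _ _ _ (fun _ => gate_kind _) => apply: poly_gate_kind
  | |- @poly _ _ _ _ (fun _ => gate_args _) => apply: poly_gate_args
  | |- @poly _ _ _ _ (fun _ => Circuit _ _ _) => apply: poly_circuit
  | |- @poly _ _ _ _ (fun _ => cinputs _) => apply: poly_cinputs
  | |- @poly _ _ _ _ (fun _ => cgates _) => apply: poly_cgates
  | |- @poly _ _ _ _ (fun _ => coutput _) => apply: poly_coutput
  end.
Ltac poly ::= repeat (cbv beta; first [eassumption | poly_eqs | poly_eta; first [poly_rule | poly_tree_rule | poly_gate_rule]]).

Lemma poly_dec_circuit : poly dec_circuit.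
Proof. by rewrite /dec_circuit; poly. Qed.

Lemma poly_is_circuit : poly is_circuit.
Proof. by rewrite /is_circuit /is_gate /is_nat_list /is_nat /is_leaf; poly. Qed.

Lemma poly_circuit_wfb : poly circuit_wfb.
Proof.
have pg : poly (fun g => (gate_kind g == 0) || all (fun x => size [seq y <- gate_args g | y == x] <= 1) (gate_args g)
       && (2 <= size (gate_args g))) by poly.
have {}pg : poly gate_wfb by apply: poly_ext pg; case.
rewrite /circuit_wfb; poly.
by apply: (poly_comp pg); poly.
Qed.

Section Rcons.
Context {A V : Type} {EA : Enc A} {EV : Enc V}.

Lemma poly_rcons (s : A -> seq V) (x : A -> V) :
  poly s -> poly x -> poly (fun a => rcons (s a) (x a)).
Proof.
move=> ps px; apply: (poly_ext (f := fun a => s a ++ [:: x a])); last by poly.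
by move=> a; rewrite cats1.
Qed.

End Rcons.

Section NodeValues.
Context {A V : Type} {EA : Enc A} {EV : Enc V}.

Lemma poly_node_values (inp : A -> seq V) (f : A -> seq V -> gate -> V) (gs : A -> seq gate) :
  poly inp -> poly (fun p : A * (seq V * gate) => f p.1 p.2.1 p.2.2) -> poly gs ->
  (exists b, poly_bounded b /\ forall a gs1 gs2, gs a = gs1 ++ gs2 ->
     esize (node_values (inp a) (f a) gs1) <= b (esize a)) ->
  poly (fun a => node_values (inp a) (f a) (gs a)).
Proof.
move=> pi pf pg; apply: (poly_foldl (h := fun a vs g => rcons vs (f a vs g))) => //.
by apply: poly_rcons; [poly | exact: pf].
Qed.

End NodeValues.

Section NatNodes.
Context {A : Type} {EA : Enc A}.

(** A gate exceeds the values of its arguments by at most one. This bounds the unary encodings of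
    all intermediate depths and wefts. *)
Lemma nat_node_values_bound n (f : seq nat -> gate -> nat) :
  (forall vs g, f vs g <= (\max_(i <- gate_args g) nth 0 vs i).+1) ->
  forall gs, all (fun v => v <= size gs) (node_values (nseq n 0) f gs).
Proof.
move=> hf; elim/last_ind => [|gs g ih]; first by apply/allP => v /nseqP [->].
rewrite node_values_rcons all_rcons size_rcons; apply/andP; split.
  apply: leq_trans (hf _ _) _; rewrite ltnS.
  apply/bigmax_leqP_seq => i _ _; have [hi|hi] := ltnP i (size (node_values (nseq n 0) f gs)).
    exact: (all_nthP 0 ih).
  by rewrite nth_default.
by apply: sub_all ih => v hv; exact: leq_trans hv (leqnSn _).
Qed.

Lemma esize_nats (s : seq nat) M : all (fun v => v <= M) s ->
  esize s <= size s * (M * 2 + 2) + 1.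
Proof.
elim: s => [|x s ih]; first by rewrite esize_nil.
move=> /andP [hx /ih]; rewrite esize_cons esize_nat [size (x :: s)]/= -/(size s) mulSn.
by have {}hx : x <= M by []; lia.
Qed.

Lemma poly_bigmax {B} {EB : Enc B} (s : A -> seq B) (F : A -> B -> nat) :
  poly s -> poly (fun p : A * B => F p.1 p.2) -> poly (fun a => \max_(i <- s a) F a i).
Proof.
move=> ps pF.
have pm : poly (fun a => [seq F a i | i <- s a]) by apply: poly_map.
have bmE (t : seq nat) : \max_(i <- t) i = foldl (fun m x => if m <= x then x else m) 0 t.
  elim/last_ind: t => [|t x ih]; first by rewrite big_nil.
  rewrite -cats1 foldl_cat big_cat big_seq1 /= ih /maxn /=; case: ltngtP => //.
apply: (poly_ext (f := fun a => foldl (fun m x => if m <= x then x else m) 0 [seq F a i | i <- s a])).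
  by move=> a; rewrite -bmE big_map.
apply: (poly_foldl (h := fun _ m x => if m <= x then x else m)) => //; [by poly|by poly|].
have [C1 [e1 h1]] := poly_size pm.
exists (fun n => C1 * n ^ e1); split; first by auto 20 with pb.
move=> a l1 l2 el; apply: leq_trans (h1 a); rewrite el.
apply: leq_trans _ (leq_esize_cat _ _).
rewrite -bmE; elim: l1 {el} => [|x l1 ih]; first by rewrite big_nil.
rewrite big_cons esize_cons; rewrite !esize_nat in ih *; lia.
Qed.

End NatNodes.

Ltac poly_circuit_rule := lazymatch goal with
  | |- @poly _ _ _ _ (fun _ => rcons _ _) => apply: poly_rcons
  | |- @poly _ _ _ _ (fun _ => nat_of_bool _) => apply: poly_if
  | |- @poly _ _ _ _ (fun _ => \max_(i <- _) _) => apply: poly_bigmax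
  | |- @poly _ _ _ _ (fun _ => is_circuit _) => apply: (poly_comp poly_is_circuit)
  | |- @poly _ _ _ _ (fun _ => circuit_wfb _) => apply: (poly_comp poly_circuit_wfb)
  | |- @poly _ _ _ _ (fun _ => dec_circuit _) => apply: (poly_comp poly_dec_circuit)
  end.
Ltac poly ::= repeat (cbv beta; first [eassumption | poly_eqs | poly_eta; first [poly_rule | poly_tree_rule | poly_gate_rule | poly_circuit_rule]]).

Lemma poly_nodes_nat (f : seq nat -> gate -> nat) :
  poly (fun p : seq nat * gate => f p.1 p.2) ->
  (forall vs g, f vs g <= (\max_(i <- gate_args g) nth 0 vs i).+1) ->
  poly (fun c => nth 0 (node_values (nseq (cinputs c) 0) f (cgates c)) (coutput c)).
Proof.
move=> pf hf; have pn : poly (fun c => nseq (cinputs c) 0).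
  apply: (poly_ext (f := fun c => [seq 0 | _ <- iota 0 (cinputs c)])); last by poly.
  have mapE (s : seq nat) : [seq 0 | _ <- s] = nseq (size s) 0.
    by elim: s => //= _ s ->.
  by move=> c; rewrite mapE size_iota.
apply: poly_nth; [by poly|by poly|].
apply: (poly_node_values (f := fun _ => f)) => //; [|by poly|].
  by apply: (poly_comp pf); poly.
have [C1 [e1 h1]] : exists C e, forall c : circuit, cinputs c + size (cgates c) <= C * esize c ^ e.
  by apply: poly_size_nat; poly.
exists (fun n => C1 * n ^ e1 * (C1 * n ^ e1 * 2 + 2) + 1); split; first by auto 20 with pb.
move=> c gs1 gs2 el.
have hs : size gs1 <= size (cgates c) by rewrite el size_cat leq_addr.
apply: leq_trans (esize_nats (nat_node_values_bound (cinputs c) hf gs1)) _.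
rewrite size_node_values size_nseq leq_add2r leq_mul //.
  by apply: leq_trans (h1 c); rewrite leq_add2l.
by rewrite leq_add2r leq_mul2r /= (leq_trans _ (h1 c)) // (leq_trans hs) // leq_addl.
Qed.

Lemma poly_depth : poly depth.
Proof. by apply: poly_nodes_nat; first by poly. Qed.

Lemma poly_weft : poly weft.
Proof.
apply: poly_nodes_nat => [|vs g]; first by rewrite /large; poly.
by rewrite -add1n leq_add2r leq_b1.
Qed.

Lemma poly_valid_input d : poly (valid_input d).
Proof.
rewrite /valid_input; poly.
  by apply: (poly_comp poly_weft); poly.
by apply: (poly_comp poly_depth); poly.
Qed.

Lemma poly_unrefuted : poly (fun p : circuit * (value * seq gap) => unrefuted p.1 p.2.1 p.2.2).
Proof.
rewrite /unrefuted; apply: (poly_node_values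
  (inp := fun p : circuit * (value * seq gap) => [seq unrefuted_input p.2.2 v | v <- iota 0 (cinputs p.1)])
  (f := fun p => unrefuted_gate p.2.1) (gs := fun p => cgates p.1)).
- by rewrite /unrefuted_input; poly.
- pose T (vs : seq (bool * bool)) i := (nth (true, true) vs i).1.
  pose F (vs : seq (bool * bool)) i := (nth (true, true) vs i).2.
  pose pick (beta : value) (vs : seq (bool * bool)) (s : seq nat) (i : nat) :=
    (size s <= 2) || ((size vs, i) \in beta).
  pose h (beta : value) vs g := if gate_kind g == 0 then
      (F vs (head 0 (gate_args g)), T vs (head 0 (gate_args g)))
    else if gate_kind g == 1 then
      (all (T vs) (gate_args g), has (fun i => pick beta vs (gate_args g) i && F vs i) (gate_args g))
    else (has (fun i => pick beta vs (gate_args g) i && T vs i) (gate_args g), all (F vs) (gate_args g)).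
  apply: (poly_ext (f := fun p : circuit * (value * seq gap) * (seq (bool * bool) * gate) =>
     h p.1.2.1 p.2.1 p.2.2)).
    by move=> [[c [b P]] [vs g]]; case: g.
  by rewrite /h /T /F /pick; poly.
- by poly.
have [C1 [e1 h1]] : exists C e, forall p : circuit * (value * seq gap),
    cinputs p.1 + size (cgates p.1) <= C * esize p ^ e.
  by apply: poly_size_nat; poly.
exists (fun n => C1 * n ^ e1 * 8 + 1); split; first by auto 20 with pb.
move=> p gs1 gs2 el.
have hs : size gs1 <= size (cgates p.1) by rewrite el size_cat leq_addr.
have hb (s : seq (bool * bool)) : esize s <= size s * 8 + 1.
  elim: s => [|[x y] s ih]; first by rewrite esize_nil.
  rewrite esize_cons [size (_ :: s)]/= -/(size s) mulSn.
  have hxy : esize (x, y) <= 7 by case: (x); case: (y).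
  by lia.
apply: leq_trans (hb _) _; rewrite leq_add2r leq_mul2r /=.
apply: leq_trans (h1 p); rewrite size_node_values size_map size_iota.
by rewrite leq_add2l.
Qed.

Lemma poly_locally_ok : poly (fun p : circuit * nat * (value * seq gap) =>
  locally_ok p.1.1 p.1.2 p.2.1 p.2.2).
Proof.
rewrite /locally_ok /gaps_ok; poly.
by apply: (poly_comp (g := fun p => unrefuted p.1 p.2.1 p.2.2) (f := fun p : circuit * nat * (value * seq gap) => (p.1.1, (p.2.1, p.2.2))) poly_unrefuted); poly.
Qed.

Section Tuples.
Context {A B : Type} {EA : Enc A} {EB : Enc B}.

(** The length is a constant, in the end depending on [d] only, and it enters the degree of the
    polynomial. *)
Lemma poly_tuples n (s : A -> seq B) : poly s -> poly (fun a => tuples n (s a)).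
Proof. by move=> ps; elim: n => [|n ih] /=; poly. Qed.

Lemma poly_gap_blocks n (idx : A -> seq nat) (gv : A -> seq (nat * nat)) :
  poly idx -> poly gv -> poly (fun a => gap_blocks n (idx a) (gv a)).
Proof.
move=> pi pg; elim: n => [|n ih]; rewrite [gap_blocks]lock -lock /=; first by poly.
poly.
by apply: (poly_comp (g := gv) (f := fun p : A * nat * seq (seq gap) => p.1.1)); poly.
Qed.

End Tuples.

Lemma poly_blocks q r : poly (fun p : bool * (circuit * nat) => blocks q r p.1 p.2.1 p.2.2).
Proof.
rewrite /blocks /local_option.
have pgv : poly gap_values by rewrite /gap_values; poly.
have pb : poly (betas r) by rewrite /betas; apply: poly_tuples; poly.
poly.
all: try (apply: poly_gap_blocks).
all: poly.
all: try by (apply: (poly_comp pgv); poly).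
all: try by (apply: (poly_comp pb); poly).
apply: (poly_comp (g := fun p => locally_ok p.1.1 p.1.2 p.2.1 p.2.2)
  (f := fun p : bool * (circuit * nat) * seq (seq gap) * value * seq gap =>
    ((p.1.1.1.2.1, p.1.1.1.2.2), (p.1.2, p.2))) poly_locally_ok); poly.
Qed.

Lemma poly_smc_of_blocks : poly smc_of_blocks.
Proof.
have pl : poly links_of by rewrite /links_of /link; poly.
have ps : poly (fun bs : seq (seq opt) => block_starts bs) by rewrite /block_starts; poly.
rewrite /smc_of_blocks.
apply: (poly_comp (g := fun p => gadget p.1 p.2.1 p.2.2)
  (f := fun bs => (block_starts bs, (links_of (flatten bs), (2 * size bs).-1))) poly_gadget).
poly.
by apply: (poly_comp pl); poly.
Qed.

Lemma poly_reduction d q r : poly (reduction d q r).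
Proof.
have pb : poly (fun p : tree * nat => blocks q r (valid_input d p.1) (dec_circuit p.1) p.2).
  apply: (poly_comp (g := fun p => blocks q r p.1 p.2.1 p.2.2)
    (f := fun p : tree * nat => (valid_input d p.1, (dec_circuit p.1, p.2))) (poly_blocks q r)).
  by poly; apply: (poly_comp (poly_valid_input d)); poly.
rewrite /reduction; poly.
by apply: (poly_comp poly_smc_of_blocks pb).
Qed.

(** * Decoding inverts encoding; correctness of the reduction *)

Lemma is_leafP t : is_leaf t -> t = Leaf.
Proof. by case: t. Qed.

Lemma enc_dec_nat t : is_nat t -> enc_nat (dec_nat t) = t.
Proof. by elim: t => //= l _ r ih /andP [/is_leafP -> /ih e]; congr Node. Qed.

Lemma enc_dec_list t : is_nat_list t -> enc_seq enc_nat (dec_list t) = t.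
Proof. by elim: t => //= l _ r ih /andP [/enc_dec_nat h /ih e]; congr Node. Qed.

Lemma enc_dec_gate t : is_gate t -> enc_gate (dec_gate t) = t.
Proof.
case: t => // l r /and3P [_ /= hl hr]; rewrite /dec_gate /=.
have el := enc_dec_nat hl; move: hr; case e: (dec_nat l) el => [|[|[|m]]] //= el hr.
- by rewrite enc_dec_nat // -el.
- by rewrite enc_dec_list // -el.
- by rewrite enc_dec_list // -el.
Qed.

Lemma enc_dec_circuit t : is_circuit t -> enc_circuit (dec_circuit t) = t.
Proof.
case: t => // l [|g o] /and5P [_ //= hl _ hg ho].
rewrite /enc_circuit /dec_circuit /= !enc_dec_nat //; congr (Node _ (Node _ _)).
by elim: g hg => //= u _ g ih /andP [/enc_dec_gate -> /ih ->].
Qed.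

Lemma is_nat_enc n : is_nat (enc_nat n).
Proof. by elim: n. Qed.

Lemma is_nat_list_enc s : is_nat_list (enc_seq enc_nat s).
Proof. by elim: s => //= i s; rewrite /is_nat_list /= is_nat_enc. Qed.

Lemma is_gate_enc g : is_gate (enc_gate g).
Proof. by case: g => s; rewrite /is_gate /= ?is_nat_enc ?is_nat_list_enc. Qed.

Lemma dec_gate_enc g : dec_gate (enc_gate g) = g.
Proof. by case: g => s; rewrite /dec_gate /= ?dec_nat_enc ?dec_list_enc. Qed.

Lemma is_circuit_enc c : is_circuit (enc_circuit c).
Proof.
case: c => n gs o; rewrite /is_circuit /= !is_nat_enc andbT /=.
by elim: gs => //= g gs ->; rewrite is_gate_enc.
Qed.

Lemma dec_circuit_enc c : dec_circuit (enc_circuit c) = c.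
Proof.
case: c => n gs o; rewrite /dec_circuit /= !dec_nat_enc; congr Circuit.
by elim: gs => //= g gs ->; rewrite dec_gate_enc.
Qed.

Lemma gate_wfbE g : gate_wfb g = gate_wf g.
Proof.
have h (s : seq nat) : all (fun x => size [seq y <- s | y == x] <= 1) s = uniq s.
  apply/allP/idP => [h|us x _]; last by rewrite size_filter count_uniq_mem // leq_b1.
  apply: count_mem_uniq => x; case hx: (x \in s).
    have := h x hx; rewrite size_filter.
    by have : 0 < count_mem x s; [rewrite -has_count has_pred1 | case: (count_mem x s) => [|[]]].
  by apply/eqP; rewrite -leqn0 leqNgt -has_count has_pred1 hx.
by case: g => //= s; rewrite h.
Qed.

Lemma circuit_wfbP c : reflect (circuit_wf c) (circuit_wfb c).
Proof.
apply: (iffP andP) => -[h1 h2]; split=> //.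
  move=> j hj; have /= := allP h2 j; rewrite gate_wfbE; apply.
  by rewrite mem_iota.
by apply/allP => j; rewrite mem_iota /= gate_wfbE => hj; exact: h2.
Qed.

Lemma WCS_valid d x k : WCS 1 d x k <->
  valid_input d x /\ exists a, [/\ size a = cinputs (dec_circuit x), count_mem true a = k & circuit_eval (dec_circuit x) a].
Proof.
split=> [[c [-> wf w dd ha]]|[/and4P [hx /circuit_wfbP wf w dd] ha]].
  rewrite dec_circuit_enc; split=> //; rewrite /valid_input is_circuit_enc dec_circuit_enc w dd !andbT.
  exact/circuit_wfbP.
by exists (dec_circuit x); rewrite enc_dec_circuit.
Qed.

Lemma reduction_correct d x k (red := reduction d (quota d) (2 ^ d) (x, k)) :
  WCS 1 d x k <-> SMC1 (enc red.1) red.2.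
Proof.
rewrite WCS_valid /red /reduction /= SMC1_blocks.
split=> -[hv h]; split=> //; move: h;
  by case/and4P: hv => _ /circuit_wfbP wf w dd; rewrite (WCS_locally k wf w dd).
Qed.

Lemma reduction_restricted d x k (red := reduction d (quota d) (2 ^ d) (x, k)) :
  SMC1_restricted (enc red.1) red.2.
Proof. exact: SMC1_restricted_blocks. Qed.

Lemma reduction_param d x k :
  (reduction d (quota d) (2 ^ d) (x, k)).2 = 3 * (k.+1 ^ quota d + k + 5).
Proof. exact: (congr1 (muln 3) (size_blocks _ _ _ _ _)). Qed.

(** * Computable functions and fpt-reductions *)

Fixpoint expr_vars (e : expr) : nat :=
  match e with
  | EVar x => x.+1
  | ENil => 0
  | ECons e1 e2 => maxn (expr_vars e1) (expr_vars e2)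
  | EHd e1 => expr_vars e1
  | ETl e1 => expr_vars e1
  end.

Fixpoint cmd_vars (c : cmd) : nat :=
  match c with
  | Skip => 0
  | Assign x _ => x.+1
  | Seq c1 c2 => maxn (cmd_vars c1) (cmd_vars c2)
  | If _ c1 c2 => maxn (cmd_vars c1) (cmd_vars c2)
  | While _ c1 => cmd_vars c1
  end.

Lemma exec_unassigned c s t s' : exec c s t s' -> forall y, cmd_vars c <= y -> s' y = s y.
Proof.
elim=> {c s t s'} [s|s x e|c1 c2 s1 s2 s3 t1 t2 _ ih1 _ ih2|
    e c1 c2 s1 s2 t _ _ ih|e c1 c2 s1 s2 t _ _ ih|e c s _|
    e c s1 s2 s3 t1 t2 _ _ ih1 _ ih2] y //=.
- by rewrite /update; case: eqP => // ->; rewrite ltnn.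
- by rewrite geq_max => /andP [h1 h2]; rewrite ih2 ?ih1.
- by rewrite geq_max => /andP [h1 h2]; rewrite ih.
- by rewrite geq_max => /andP [h1 h2]; rewrite ih.
- by move=> h; rewrite ih2 ?ih1.
Qed.

(** A program witnessing [computable] may rely on all other registers being [Leaf], so the one for
    [g] runs beyond every register that the one for [f] has assigned. *)
Lemma computable_poly2 (f g : nat -> nat) (h : nat * (nat * nat) -> nat) :
  computable f -> computable g -> poly h -> computable (fun n => h (n, (f n, g n))).
Proof.
move=> [cf hf] [cg hg] /poly_shift [ch [C [e [_ hh]]]].
(* The [.+2] also keeps [M] away from registers 0 and 1, which hold [n] and [f n]. *)
pose M := (cmd_vars (cmd_shift 1 cf)).+2.
exists (Seq (Assign 1 (EVar 0)) (Seq (cmd_shift 1 cf) (Seq (Assign M (EVar 0)) (Seq (cmd_shift M cg)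
  (Seq (Assign 0 (ECons (EVar 0) (ECons (EVar 1) (EVar M)))) (cmd_shift 0 ch)))))) => n.
have [tf [sf xf vf]] := hf n; have [tg [sg xg vg]] := hg n.
pose s0 := init (enc_nat n); pose s1 := update s0 1 (s0 0).
have [|s2 [x2 v2 k2]] := exec_shift (d := 1) xf (s := s1).
  by case.
pose s3 := update s2 M (s2 0).
have s20 : s2 0 = enc_nat n by rewrite k2.
have [|s4 [x4 v4 k4]] := exec_shift (d := M) xg (s := s3).
  move=> y; rewrite /s3 /update /init /update -[X in _ == X]addn0 eqn_add2l; case: eqP => // y0.
  rewrite (exec_unassigned x2); last by rewrite /M; lia.
  by rewrite /s1 /update /s0 /init /update /M; case: y y0 => //= y _.
have e0 : s4 0 = enc_nat n by rewrite k4 // /s3 /update.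
have e1 : s4 1 = enc_nat (f n).
  by rewrite k4 // /s3 /update /= (v2 0).
have eM : s4 M = enc_nat (g n) by rewrite -vg -(v4 0) addn0.
pose (s5 := update s4 0 (enc (n, (f n, g n)))).
have [t6 [s6 [x6 v6 _ _]]] := hh 0 (n, (f n, g n)) s5 erefl.
eexists; exists s6; last exact: v6.
apply: ExecSeq; first exact: ExecAssign.
apply: ExecSeq; first exact: x2.
apply: ExecSeq; first exact: ExecAssign.
apply: ExecSeq; first exact: x4.
apply: ExecSeq x6; rewrite /s5.
have := ExecAssign s4 0 (ECons (EVar 0) (ECons (EVar 1) (EVar M))).
by rewrite /= e0 e1 eM; apply.
Qed.

(** Running time of a composition: [n + 2 * k + 2] is the size of the encoded input, and together
    with the time [t1] of the first program it bounds the size of what the second one reads. *)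
Lemma fpt_bound (C e e1 f1 k n t1 : nat) : 0 < n -> t1 <= f1 * n ^ e1 ->
  t1 + C * (t1 + (n + 2 * k + 2)) ^ e <=
  (f1 + C * (f1 + (2 * k + 3)) ^ e) * n ^ (e1 + (e1 + 1) * e).
Proof.
move=> n0 ht; have n1 m m' : m <= m' -> n ^ m <= n ^ m' by move=> h; rewrite leq_pexp2l.
have h1 : t1 <= f1 * n ^ (e1 + 1).
  by apply: leq_trans ht _; rewrite leq_mul2l n1 ?orbT ?leq_addr.
have h2 : n + 2 * k + 2 <= (2 * k + 3) * n ^ (e1 + 1).
  have hn : n <= n ^ (e1 + 1) by rewrite -{1}[n]expn1 n1 // leq_addl.
  have : (2 * k + 3) * n <= (2 * k + 3) * n ^ (e1 + 1) by rewrite leq_mul2l hn orbT.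
  apply: leq_trans; rewrite mulnDl; have : 2 * k * 1 <= 2 * k * n by rewrite leq_mul2l n0 orbT.
  by lia.
have h3 : t1 + (n + 2 * k + 2) <= (f1 + (2 * k + 3)) * n ^ (e1 + 1).
  by rewrite mulnDl leq_add.
rewrite mulnDl leq_add //.
  by apply: leq_trans ht _; rewrite leq_mul2l n1 ?orbT ?leq_addr.
rewrite -mulnA leq_mul2l; apply/orP; right.
apply: leq_trans (leq_expn e h3) _; rewrite expnMn -expnM leq_mul2l.
by rewrite n1 ?orbT ?leq_addl.
Qed.

Lemma esize_input (x : tree) (k : nat) : esize (x, k) = tsize x + 2 * k + 2.
Proof.
have -> : esize (x, k) = (tsize x + esize k).+1 by [].
by rewrite esize_nat; lia.
Qed.

Theorem SMC1_hard_on_restricted : W1_hard_on SMC1_restricted SMC1.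
Proof.
move=> A [d [c1 [f1 [g1 [e1 [cf1 cg1 h1]]]]]].
pose q := quota d; pose red := reduction d q (2 ^ d).
have [c2 [C [e [_ h2]]]] := poly_shift (poly_reduction d q (2 ^ d)).
pose F (p : nat * (nat * nat)) := p.2.1 + C * (p.2.1 + (2 * p.1 + 3)) ^ e.
pose G (p : nat * (nat * nat)) := 3 * (p.2.2.+1 ^ q + p.2.2 + 5).
exists (Seq c1 (cmd_shift 0 c2)), (fun k => F (k, (f1 k, g1 k))), (fun k => G (k, (f1 k, g1 k))),
  (e1 + (e1 + 1) * e); split.
- by apply: computable_poly2 => //; rewrite /F; poly.
- by apply: computable_poly2 => //; rewrite /G; poly.
move=> x k; have [t1 [x1 [k1 [[s1 r1 v1] ht1 hk1 hA _]]]] := h1 x k.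
have [t2 [s2 [r2 v2 ht2 _]]] := h2 0 (x1, k1) s1 v1.
pose y := red (x1, k1).
exists (t1 + t2), (enc y.1), y.2; split.
- by exists s2; first exact: ExecSeq r1 r2.
- apply: leq_trans (fpt_bound C e k (tsize_gt0 x) ht1); rewrite leq_add2l.
  apply: leq_trans ht2 _; rewrite leq_mul2l leq_expn ?orbT //.
  have hs : esize (x1, k1) = tsize (s1 0) by rewrite v1.
  have e0 : tsize (init (Node x (enc_nat k)) 0) = tsize x + 2 * k + 2 := esize_input x k.
  (* The intermediate instance is either the untouched input or has been paid for within [t1]. *)
  rewrite hs; case: (exec_size r1 0) => [->|]; last by lia.
  by rewrite e0 leq_addl.
- rewrite /y /red reduction_param /G /=.
  by rewrite leq_mul2l /= leq_add2r leq_add // leq_expn // ltnS.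
- by rewrite hA; exact: reduction_correct.
- exact: reduction_restricted.
Qed.

Theorem theorem2 : W1_hard SMC1 /\ W1_hard_on SMC1_restricted SMC1.
Proof.
split; last exact: SMC1_hard_on_restricted.
move=> A hA; have [c [f [g [e [hf hg h]]]]] := SMC1_hard_on_restricted hA.
exists c, f, g, e; split=> // x k; have [t [x' [k' [h1 h2 h3 h4 _]]]] := h x k.
by exists t, x', k'.
Qed.
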